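(* Let $p,q_1,\dots,q_k\in\mathbb Z_{\ge1}$, let $n=\sum_i q_i$, and let $\alpha=(p,q_1,\dots,q_k)$, regarded as a dimension vector of the star quiver $\Delta[k]$. Then, for generic data $B=(B_1,\dots,B_k)\in\bigoplus_{i=1}^k\mathrm{Mat}_{p\times q_i}(\mathbb R)$: \begin{itemize} \item $f_B$ is bounded above if and only if $\alpha$ is Schofield semistable; \item iPCA exists if and only if $\alpha$ is Schofield polystable; \item iPCA exists uniquely if and only if $\alpha$ is Schofield stable. \end{itemize}
   Context: iPCA. For $B_i\in \mathrm{Mat}_{p\times q_i}(\mathbb R)$ and symmetric positive definite real matrices $\Theta$ ($p\times p$), $\Theta_i$ ($q_i\times q_i$), put $$f_B(\Theta,\Theta_1,\dots,\Theta_k)=n\log\det\Theta+p\sum_{i=1}^k\log\det\Theta_i-\sum_{i=1}^k\mathrm{Tr}(\Theta B_i\Theta_iB_i^{\top}).$$ iPCA exists for $B$ if $f_B$ attains a maximum over positive definite tuples; it exists uniquely if moreover the Kronecker products $\Theta\otimes\Theta_i$ are the same for all maximizers (equivalently, the maximizer is unique up to $(\Theta,\Theta_i)\mapsto(c\Theta,c^{-1}\Theta_i)$, $c>0$). ''Generic'' means: for all $B$ in some nonempty Zariski open subset of the real vector space; each item asserts that the property on the left holds for generic $B$ if and only if the property of $\alpha$ on the right holds. Quivers. The star quiver $\Delta[k]$ has vertices $x,y_1,\dots,y_k$ and arrows $a_i:y_i\to x$, $1\le i\le k$. Dimension vectors and weights are listed in the order $x,y_1,\dots,y_k$. All representations in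 the stability notions are over $\mathbb C$: a representation $V$ assigns complex vector spaces of dimensions $p,q_1,\dots,q_k$ and linear maps $V(a_i):V(y_i)\to V(x)$; $\mathrm{Rep}(\Delta[k],\alpha)=\bigoplus_i\mathrm{Mat}_{p\times q_i}(\mathbb C)$. For a weight $\sigma\in\mathbb Z^{k+1}$ write $\sigma(\beta)$ for the standard pairing. A representation $V$ with $\sigma(\underline{\dim}V)=0$ is $\sigma$-semistable if $\sigma(\beta)\le0$ for the dimension vector $\beta$ of every subrepresentation, $\sigma$-stable if $\sigma(\beta)<0$ for every such $\beta\ne0,\underline{\dim}V$, and $\sigma$-polystable if it is a finite direct sum of $\sigma$-stable representations. The dimension vector $\alpha$ is $\sigma$-semistable/polystable/stable if a generic $V\in\mathrm{Rep}(\Delta[k],\alpha)$ is. The Schofield weight of $\alpha$ is $\sigma=(-n,p,p,\dots,p)$ (in general $\sigma(\beta)=\langle\alpha,\beta\rangle-\langle\beta,\alpha\rangle$ with $\langle\cdot,\cdot\rangle$ the Euler form), and $\alpha$ is Schofield semistable/polystable/stable if it is $\sigma$-semistable/polystable/stable for this $\sigma$. *)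

(* Defs.v *)
From HB Require Import structures.
From mathcomp Require Import all_boot all_order all_algebra.
From mathcomp Require Import complex mxtens ring.
From mathcomp Require Import classical_sets reals exp.
(* Not imported: the notations of mpoly clash with those of the analysis
   library. *)
From mathcomp Require mpoly.

Set Implicit Arguments.
Unset Strict Implicit.
Unset Printing Implicit Defensive.

Import Order.TTheory GRing.Theory Num.Theory.
Local Open Scope classical_set_scope.
Local Open Scope ring_scope.

(** * Zariski topology on finite direct sums of matrix spaces *)

Section Zariski.
Variables (K : fieldType) (I : finType) (m n : I -> nat).

Definition mxfam := forall a : I, 'M[K]_(m a, n a).

Definition mxfam_index : finType := {a : I & ('I_(m a) * 'I_(n a))%type}.

Definition mxfam_coord (B : mxfam) (j : 'I_#|mxfam_index|) : K :=
  let: existT a (r, c) := enum_val j in B a r c.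

(* A Zariski open set is the set of points where at least one polynomial of
   some set [S] of polynomials in the matrix entries does not vanish. *)
Definition zariski_open (U : set mxfam) : Prop :=
  exists S : set (mpoly.mpoly #|mxfam_index| K),
    U = [set B | exists2 f, S f & mpoly.meval (mxfam_coord B) f != 0].

Definition generic (P : set mxfam) : Prop :=
  exists U : set mxfam, [/\ zariski_open U, U !=set0 & U `<=` P].

End Zariski.

(** * Quiver representations *)

Record quiver := Quiver {
  vertex : finType;
  arrow : finType;
  src : arrow -> vertex;
  tgt : arrow -> vertex }.

Section Representations.
Variable Q : quiver.

Definition dimvec := vertex Q -> nat.
Definition weight := vertex Q -> int.

Definition weight_pairing (sigma : weight) (beta : dimvec) : int :=
  \sum_v sigma v * (beta v)%:Z.

Definition euler_form (alpha beta : dimvec) : int :=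
  \sum_v (alpha v)%:Z * (beta v)%:Z
  - \sum_(a : arrow Q) (alpha (src a))%:Z * (beta (tgt a))%:Z.

Variable K : fieldType.

(* [V a] acts on column vectors, [V a : K^(alpha (src a)) -> K^(alpha (tgt a))]. *)
Definition rep (alpha : dimvec) :=
  @mxfam K (arrow Q) (fun a => alpha (tgt a)) (fun a => alpha (src a)).

Definition subrep (alpha : dimvec) (V : rep alpha)
    (W : forall v, {vspace 'cV[K]_(alpha v)}) : Prop :=
  forall (a : arrow Q) (u : 'cV[K]_(alpha (src a))),
    u \in W (src a) -> V a *m u \in W (tgt a).

Definition subdim (alpha : dimvec)
    (W : forall v, {vspace 'cV[K]_(alpha v)}) : dimvec :=
  fun v => \dim (W v).

Definition semistable (sigma : weight) (alpha : dimvec) (V : rep alpha) : Prop :=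
  weight_pairing sigma alpha = 0 /\
  forall W, subrep V W -> weight_pairing sigma (subdim W) <= 0.

Definition stable (sigma : weight) (alpha : dimvec) (V : rep alpha) : Prop :=
  weight_pairing sigma alpha = 0 /\
  forall W, subrep V W ->
    ~ (subdim W =1 (fun=> 0%N)) -> ~ (subdim W =1 alpha) ->
    weight_pairing sigma (subdim W) < 0.

Definition rep_iso (alpha beta : dimvec) (V : rep alpha) (V' : rep beta) : Prop :=
  exists (g : forall v, 'M[K]_(beta v, alpha v))
         (h : forall v, 'M[K]_(alpha v, beta v)),
    [/\ forall v, h v *m g v = 1%:M,
        forall v, g v *m h v = 1%:M
      & forall a, g (tgt a) *m V a = V' a *m g (src a)].

(* Block diagonal matrices with rectangular blocks. When [i = j] the cast
   [conform_mx 0 (S j a)] is [S j a] itself. *)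
Definition direct_sum (m : nat) (beta : 'I_m -> dimvec)
    (S : forall j, rep (beta j)) : rep (fun v => (\sum_j beta j v)%N) :=
  fun a => \mxblock_(i, j)
    (if i == j
     then conform_mx (0 : 'M[K]_(beta i (tgt a), beta j (src a))) (S j a)
     else 0).

Definition polystable (sigma : weight) (alpha : dimvec) (V : rep alpha) : Prop :=
  exists (m : nat) (beta : 'I_m -> dimvec) (S : forall j, rep (beta j)),
    (forall j, stable sigma (S j)) /\ rep_iso V (direct_sum S).

Definition dim_semistable (sigma : weight) (alpha : dimvec) : Prop :=
  generic [set V : rep alpha | semistable sigma V].

Definition dim_polystable (sigma : weight) (alpha : dimvec) : Prop :=
  generic [set V : rep alpha | polystable sigma V].

Definition dim_stable (sigma : weight) (alpha : dimvec) : Prop :=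
  generic [set V : rep alpha | stable sigma V].

End Representations.

(** * Star quivers and the Schofield weight *)

(* The vertex [None] is the sink x and [Some i] is the source y_i. *)
Definition star_quiver (k : nat) : quiver :=
  @Quiver (option 'I_k) 'I_k (fun i => Some i) (fun=> None).

Definition star_dim (k p : nat) (q : 'I_k -> nat) : dimvec (star_quiver k) :=
  fun v => if v is Some i then q i else p.

Definition schofield_weight (k : nat) (alpha : dimvec (star_quiver k)) :
    weight (star_quiver k) :=
  fun v => if v is Some _ then (alpha None)%:Z
           else - (\sum_i alpha (Some i))%N%:Z.

Lemma schofield_weightE (k : nat) (alpha beta : dimvec (star_quiver k)) :
  weight_pairing (schofield_weight alpha) beta
  = euler_form alpha beta - euler_form beta alpha.
Proof.
have sum_opt (F : option 'I_k -> int) :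
    \sum_v F v = F None + \sum_i F (Some i).
  rewrite (bigD1 None) //=; congr (_ + _).
  rewrite (reindex_omap Some id) /=; last by case.
  by apply: eq_bigl => i; rewrite eqxx.
rewrite /weight_pairing /euler_form /= !sum_opt /=.
rewrite -!mulr_sumr -!mulr_suml.
under [X in _ = _ - (_ + X - _)]eq_bigr do rewrite mulrC.
have -> : (\sum_i alpha (Some i))%N%:Z = \sum_i (alpha (Some i))%:Z.
  by rewrite -natz natr_sum; apply: eq_bigr => i _; rewrite natz.
ring.
Qed.

Section Schofield.
Variables (R : realType) (k : nat) (alpha : dimvec (star_quiver k)).

Definition schofield_semistable : Prop :=
  dim_semistable R[i] (schofield_weight alpha) alpha.

Definition schofield_polystable : Prop :=
  dim_polystable R[i] (schofield_weight alpha) alpha.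

Definition schofield_stable : Prop :=
  dim_stable R[i] (schofield_weight alpha) alpha.

End Schofield.

(** * iPCA *)

Definition posdefmx (R : realType) (d : nat) (A : 'M[R]_d) : Prop :=
  A^T = A /\ forall u : 'cV[R]_d, u != 0 -> 0 < (u^T *m A *m u) 0 0.

Section IPCA.
Variables (R : realType) (k p : nat) (q : 'I_k -> nat).

Definition ipca_data := @mxfam R 'I_k (fun=> p) q.

Variable B : ipca_data.

Definition ipca_fun (T : 'M[R]_p) (Ts : forall i, 'M[R]_(q i)) : R :=
  (\sum_i q i)%N%:R * ln (\det T) + p%:R * (\sum_i ln (\det (Ts i)))
  - \sum_i \tr (T *m B i *m Ts i *m (B i)^T).

Definition posdef_tuple (T : 'M[R]_p) (Ts : forall i, 'M[R]_(q i)) : Prop :=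
  posdefmx T /\ forall i, posdefmx (Ts i).

Definition ipca_bounded_above : Prop :=
  exists M : R, forall T Ts, posdef_tuple T Ts -> ipca_fun T Ts <= M.

Definition ipca_maximizer (T : 'M[R]_p) (Ts : forall i, 'M[R]_(q i)) : Prop :=
  posdef_tuple T Ts /\
  forall T' Ts', posdef_tuple T' Ts' -> ipca_fun T' Ts' <= ipca_fun T Ts.

Definition ipca_exists : Prop := exists T Ts, ipca_maximizer T Ts.

Definition ipca_exists_uniquely : Prop :=
  ipca_exists /\
  forall T Ts T' Ts', ipca_maximizer T Ts -> ipca_maximizer T' Ts' ->
    forall i, T *t Ts i = T' *t Ts' i.

End IPCA.

(* Main.v *)
Require Import Defs.
From mathcomp Require Import all_boot all_order all_algebra.
From mathcomp Require Import complex mxtens zify ring lra.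
From mathcomp Require Import boolp classical_sets reals exp.
From mathcomp Require Import topology normedtype sequences derive.
From mathcomp Require mpoly closed_field.
Import -(notations) mpoly.

(** Let n be the sum of the q_i. A subrepresentation of dimension b at the sink
    and c_i at the sources has Schofield weight p * (sum of the c_i) - n * b.
    The theorem combines a dictionary for one real tuple B with a comparison of
    generic real and generic complex tuples.

    One real tuple. Diagonalizing T = U exp(s) U^T and Ts i = V_i exp(t_i) V_i^T
    turns the objective into
      n sum_a s_a + p sum_j t_j - sum_(a,j) c_aj exp(s_a + t_j),
    where the c_aj are the squared entries of the matrices U^T B_i V_i. A
    rectangle of zeros of c is a subrepresentation spanned by basis vectors
    (frame_sub), so semistability is the Hall condition for the bipartite graph
    of the nonzero c_aj, and compactness of the orthogonal groups makes it
    uniform in U and V (frames_hall). A transport plan with marginals n and p on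
    this graph, with w x - c exp x <= const on its edges, bounds the objective
    (transport_bound, diag_obj_bounded); conversely, contracting a
    subrepresentation of positive weight makes the objective unbounded
    (bounded_semistable). If B is stable, the marginals may be perturbed by one
    unit, the objective is coercive up to scaling, and it has a maximum
    (diag_obj_attained).

    After a change of basis a maximum sits at the identity, and there the
    first-order conditions say that the tuple is balanced: sum_i C_i C_i^T = n
    and C_i^T C_i = p (maximizer_balanced). Conversely, the matrix c of a
    balanced tuple has constant row and column sums, so that the loss relative
    to the identity is the sum of the c_aj (exp x_aj - 1 - x_aj) with
    x_aj = s_a + t_j: the identity is a maximizer (balanced_maximizer), and the
    others are given by x_aj = 0 where c_aj is nonzero. This relates uniqueness
    to stability (stable_unique, unique_stable).

    Polystability means semistability together with invariant complements for
    the subrepresentations of weight zero (polystableP). A polystable real tuple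
    is a direct sum of stable ones, each of which can be balanced, hence can be
    balanced itself (polystable_balanced). A balanced real tuple is polystable
    even over the complex numbers, because orthogonal projections onto
    subrepresentations of weight zero are morphisms (balanced_retract).

    From complex to real. The real or the imaginary part of a nonzero complex
    polynomial is a nonzero real polynomial (generic_real_points), and
    semistability, stability and complements pass from the complexification of
    a real tuple to the tuple itself.

    From real to complex. The tuples with a subrepresentation of given
    dimension vector are the values of a polynomial map with rational
    coefficients. Hence a polynomial whose nonvanishing excludes such
    subrepresentations over the reals excludes them over the complex numbers
    (no_sub_extension), which settles semistability and stability. Polystability
    is a first-order condition, so by quantifier elimination it holds
    generically or fails generically over the complex numbers
    (mxpolystable_generic); the second case is impossible when generic real
    tuples have a maximum, because a tuple with natural entries would be generic
    in both senses (generic_common_extension). *)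

Set Implicit Arguments.
Unset Strict Implicit.
Unset Printing Implicit Defensive.

Import Order.TTheory GRing.Theory Num.Theory.
Import numFieldNormedType.Exports.

Local Open Scope classical_set_scope.
Local Open Scope ring_scope.

(** * Polynomial functions and generic conditions *)

Section PolynomialFunctions.
Variables (K : comNzRingType) (I : finType).

(** Polynomials indexed by an arbitrary finite type, seen as functions, so that
    matrix entries can serve as variables without an enumeration. *)
Definition polyfun (F : (I -> K) -> K) : Prop :=
  exists P : mpoly #|I| K, forall z, F z = meval (fun j => z (enum_val j)) P.

Lemma polyfun_eq F G : F =1 G -> polyfun F -> polyfun G.
Proof. by move=> FG [P HP]; exists P => z; rewrite -FG. Qed.

Lemma polyfun_cst c : polyfun (fun=> c).
Proof. by exists (mpolyC #|I| c) => z; rewrite mevalC. Qed.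

Lemma polyfun_coord i : polyfun (fun z => z i).
Proof.
exists (mpolyX K (mnm1 (enum_rank i))) => z.
by rewrite mevalXU enum_rankK.
Qed.

Lemma polyfunD F G : polyfun F -> polyfun G -> polyfun (fun z => F z + G z).
Proof.
by move=> [P HP] [Q HQ]; exists (P + Q) => z; rewrite HP HQ rmorphD.
Qed.

Lemma polyfunM F G : polyfun F -> polyfun G -> polyfun (fun z => F z * G z).
Proof.
by move=> [P HP] [Q HQ]; exists (P * Q) => z; rewrite HP HQ rmorphM.
Qed.

Lemma polyfunN F : polyfun F -> polyfun (fun z => - F z).
Proof. by move=> [P HP]; exists (- P) => z; rewrite HP rmorphN. Qed.

Lemma polyfun_sum (T : Type) (r : seq T) (p : pred T) (F : T -> (I -> K) -> K) :
  (forall t, polyfun (F t)) -> polyfun (fun z => \sum_(t <- r | p t) F t z).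
Proof.
move=> HF; elim: r => [|t r IHr].
  by apply: polyfun_eq (polyfun_cst 0) => z; rewrite big_nil.
have := polyfunD (HF t) IHr; case pt: (p t) => H; last first.
  by apply: polyfun_eq IHr => z; rewrite big_cons pt.
by apply: polyfun_eq H => z; rewrite big_cons pt.
Qed.

Lemma polyfun_prod (T : Type) (r : seq T) (p : pred T) (F : T -> (I -> K) -> K) :
  (forall t, polyfun (F t)) -> polyfun (fun z => \prod_(t <- r | p t) F t z).
Proof.
move=> HF; elim: r => [|t r IHr].
  by apply: polyfun_eq (polyfun_cst 1) => z; rewrite big_nil.
have := polyfunM (HF t) IHr; case pt: (p t) => H; last first.
  by apply: polyfun_eq IHr => z; rewrite big_cons pt.
by apply: polyfun_eq H => z; rewrite big_cons pt.
Qed.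

Lemma polyfunX F n : polyfun F -> polyfun (fun z => F z ^+ n).
Proof.
move=> HF; elim: n => [|n IHn]; first by apply: polyfun_eq (polyfun_cst 1) => z; rewrite expr0.
by apply: polyfun_eq (polyfunM HF IHn) => z; rewrite exprS.
Qed.

Lemma polyfun_mulmx a b c (A : (I -> K) -> 'M[K]_(a, b))
    (B : (I -> K) -> 'M[K]_(b, c)) :
  (forall i j, polyfun (fun z => A z i j)) ->
  (forall i j, polyfun (fun z => B z i j)) ->
  forall i j, polyfun (fun z => (A z *m B z) i j).
Proof.
move=> HA HB i j.
apply: polyfun_eq (polyfun_sum (index_enum _) xpredT (fun t => polyfunM (HA i t) (HB t j))).
by move=> z; rewrite mxE.
Qed.

Lemma polyfun_det a (A : (I -> K) -> 'M[K]_a) :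
  (forall i j, polyfun (fun z => A z i j)) -> polyfun (fun z => \det (A z)).
Proof.
move=> HA; rewrite /determinant; apply: polyfun_sum => s.
by apply: polyfunM; [exact: polyfun_cst | exact: polyfun_prod].
Qed.

End PolynomialFunctions.

Lemma polyfun_comp (K : comNzRingType) (I J : finType) (F : (I -> K) -> K)
    (G : (J -> K) -> I -> K) :
  polyfun F -> (forall i, polyfun (fun z => G z i)) -> polyfun (fun z => F (G z)).
Proof.
move=> [P HP] HG.
have H := polyfun_sum (msupp P) xpredT (fun m => polyfunM (@polyfun_cst K J (mcoeff m P))
   (polyfun_prod (index_enum _) xpredT (fun i => polyfunX (m i) (HG (enum_val i))))).
by apply: polyfun_eq H => z; rewrite HP mevalE.
Qed.

Section NaturalPoints.
Variables (K : numFieldType).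

Lemma poly_nat_nonroot (P : {poly K}) : P != 0 -> exists m : nat, P.[m%:R] != 0.
Proof.
move=> P0; apply: contrapT => H.
pose s := [seq (m%:R : K) | m <- iota 0 (size P)].
have us : uniq s.
  by rewrite map_inj_uniq ?iota_uniq // => x y /eqP; rewrite eqr_nat => /eqP.
have rs : all (root P) s.
  apply/allP => _ /mapP[m _ ->]; apply/rootP; apply/eqP.
  by apply: contrapT => /negP Pm; apply: H; exists m.
by have := max_poly_roots P0 rs us; rewrite size_map size_iota ltnn.
Qed.

Variable I : finType.

Lemma polyfun_curve (F : (I -> K) -> K) (u : I -> {poly K}) :
  polyfun F -> exists P : {poly K}, forall t, P.[t] = F (fun i => (u i).[t]).
Proof.
move=> [P HP].
exists (\sum_(m <- msupp P) (mcoeff m P)%:P * \prod_i u (enum_val i) ^+ m i).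
move=> t; rewrite HP mevalE horner_sum; apply: eq_bigr => m _.
rewrite hornerM hornerC horner_prod; congr (_ * _).
by apply: eq_bigr => i _; rewrite horner_exp.
Qed.

(** Coordinates are replaced one at a time: with the others held fixed, a
    nonzero polynomial in one variable has a natural number among its
    nonroots. *)
Lemma polyfun_nat_point (F : (I -> K) -> K) (z : I -> K) :
  polyfun F -> F z != 0 -> exists x : I -> nat, F (fun i => (x i)%:R) != 0.
Proof.
move=> HF Fz.
suff [x [Fx xn]] : exists x : I -> K, F x != 0 /\ forall i, exists m : nat, x i = m%:R.
  have [m mE] := @boolp.choice _ _ (fun i (m : nat) => x i = m%:R) xn.
  by exists m; rewrite (_ : (fun i => _) = x) //; apply/funext => i.
suff H : forall s : seq I, exists x : I -> K,
    F x != 0 /\ forall i, i \in s -> exists m : nat, x i = m%:R.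
  have [x [Fx xs]] := H (enum I); exists x; split=> // i.
  by apply: xs; rewrite mem_enum.
elim=> [|j s [x [Fx xs]]]; first by exists z.
pose u i : {poly K} := if i == j then 'X else (x i)%:P.
have [P HP] := polyfun_curve u HF.
have P0 : P != 0.
  apply: contraNneq Fx => P0; have := HP (x j); rewrite P0 horner0 => ->.
  apply/eqP; congr F; apply/funext => i; rewrite /u.
  by case: eqP => [->|_]; rewrite ?hornerX ?hornerC.
have [m Pm] := poly_nat_nonroot P0.
exists (fun i => (u i).[m%:R]); rewrite -HP; split=> // i; rewrite inE /u.
by case: eqP => [_ _|_ /= /xs[m' ->]]; [exists m; rewrite hornerX | exists m'; rewrite hornerC].
Qed.

(** Two nonvanishing loci always meet: restrict both functions to the line
    through a point of each. *)
Lemma polyfun_common_point (F G : (I -> K) -> K) (z w : I -> K) :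
  polyfun F -> polyfun G -> F z != 0 -> G w != 0 ->
  exists2 x : I -> K, F x != 0 & G x != 0.
Proof.
move=> HF HG Fz Gw.
pose u i : {poly K} := (z i)%:P + (w i - z i) *: 'X.
have u0 : (fun i => (u i).[0]) = z.
  by apply/funext => i; rewrite /u hornerD hornerZ hornerC hornerX mulr0 addr0.
have u1 : (fun i => (u i).[1]) = w.
  by apply/funext => i; rewrite /u hornerD hornerZ hornerC hornerX mulr1 addrC subrK.
have [P HP] := polyfun_curve u HF; have [Q HQ] := polyfun_curve u HG.
have P0 : P != 0.
  by apply: contraNneq Fz => P0; have := HP 0; rewrite u0 P0 horner0 => <-.
have Q0 : Q != 0.
  by apply: contraNneq Gw => Q0; have := HQ 1; rewrite u1 Q0 horner0 => <-.
have /poly_nat_nonroot[m] : P * Q != 0 by rewrite mulf_neq0.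
by rewrite hornerM mulf_eq0 negb_or HP HQ => /andP[? ?]; eexists; eassumption.
Qed.

End NaturalPoints.

Section GenericPredicates.
Variables (K : fieldType) (I : finType) (m n : I -> nat).

Definition coords (B : mxfam K m n) (j : mxfam_index m n) : K :=
  let: existT a (r, c) := j in B a r c.

Definition of_coords (z : mxfam_index m n -> K) : mxfam K m n :=
  fun a => \matrix_(r, c) z (existT _ a (r, c)).

Lemma of_coordsK z : coords (of_coords z) = z.
Proof. by apply/funext => -[a [r c]]; rewrite /= mxE. Qed.

Lemma coordsK B : of_coords (coords B) = B.
Proof. by apply/functional_extensionality_dep => a; apply/matrixP => r c; rewrite mxE. Qed.

(** A basic open set suffices: of the polynomials defining a nonempty open set
    one is nonzero somewhere. *)
Lemma genericP (P : set (mxfam K m n)) :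
  generic P <-> exists F : (mxfam_index m n -> K) -> K,
    [/\ polyfun F, exists B, F (coords B) != 0
      & forall B, F (coords B) != 0 -> P B].
Proof.
have cE B : mxfam_coord B = fun j => coords B (enum_val j) by [].
split=> [[U [[S ->] [B [f Sf fB]] UP]]|[F [[f Hf] [B FB] FP]]].
  exists (fun z => meval (fun j => z (enum_val j)) f); split.
  - by exists f.
  - by exists B; rewrite -cE.
  - by move=> B' H; apply: UP; exists f; rewrite ?cE.
exists [set B | exists2 g, [set f] g & meval (mxfam_coord B) g != 0]; split.
- by exists [set f].
- by exists B; exists f; rewrite //= cE -Hf.
- by move=> B' [_ ->]; rewrite cE -Hf; exact: FP.
Qed.

Lemma generic_sub (P P' : set (mxfam K m n)) :
  (forall V, P V -> P' V) -> generic P -> generic P'.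
Proof.
by move=> PP' /genericP[F [pF nF FP]]; apply/genericP; exists F; split=> // B /FP /PP'.
Qed.

Lemma generic_true (P : set (mxfam K m n)) : (forall V, P V) -> generic P.
Proof.
move=> HP; apply/genericP; exists (fun=> 1); split=> //; first exact: polyfun_cst.
by exists (fun=> 0); rewrite oner_neq0.
Qed.

End GenericPredicates.

(** Nonempty open sets over an infinite field intersect. *)
Lemma generic_and (K : numFieldType) (I : finType) (m n : I -> nat)
    (P P' : set (mxfam K m n)) :
  generic P -> generic P' -> generic (P `&` P').
Proof.
move=> /genericP[F [pF [B FB] FP]] /genericP[G [pG [C GC] GP]].
apply/genericP; exists (fun z => F z * G z); split; first exact: polyfunM.
  have [z Fz Gz] := polyfun_common_point pF pG FB GC.
  by exists (of_coords z); rewrite of_coordsK mulf_neq0.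
by move=> V; rewrite mulf_eq0 negb_or => /andP[/FP ? /GP ?].
Qed.

(** * First-order conditions over an algebraically closed field *)

Section ConstructibleSets.
Variable K : numClosedFieldType.
Local Notation term := (GRing.term K).
Local Notation formula := (GRing.formula K).

(** The valuation of first-order variables by a point, in enumeration order. *)
Definition env (I : finType) (z : I -> K) : seq K := [seq z i | i <- enum I].

Lemma size_env (I : finType) (z : I -> K) : size (env z) = #|I|.
Proof. by rewrite size_map -cardE. Qed.

Lemma nth_env (I : finType) (z : I -> K) i : nth 0 (env z) (enum_rank i) = z i.
Proof.
rewrite /env (nth_map i) ?nth_enum_rank //.
by rewrite -cardE ltn_ord.
Qed.

Lemma env_surj (I : finType) (s : seq K) :
  size s = #|I| -> exists z : I -> K, env z = s.
Proof.
move=> sI; exists (fun i => nth 0 s (enum_rank i)).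
apply: (@eq_from_nth _ 0) => [|j]; first by rewrite size_env.
rewrite size_env => jI.
have -> : j = enum_rank (enum_val (Ordinal jI)) by rewrite enum_valK.
by rewrite nth_env.
Qed.

Lemma termfun_polyfun (I : finType) (t : term) : GRing.rterm t ->
  polyfun (fun z : I -> K => GRing.eval (env z) t).
Proof.
elim: t => //= [j _|c _|m _|t IHt u IHu /andP[rt ru]|t IHt rt|t IHt m rt
               |t IHt u IHu /andP[rt ru]|t IHt m rt].
- case: (ltnP j #|I|) => jI; last first.
    apply: polyfun_eq (@polyfun_cst K I 0) => z.
    by rewrite nth_default // size_env.
  have H := @polyfun_coord K I (enum_val (Ordinal jI)); apply: (polyfun_eq _ H) => z.
  by rewrite -[LHS]nth_env enum_valK.
- exact: polyfun_cst.
- exact: polyfun_cst.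
- by apply: polyfunD; [exact: IHt | exact: IHu].
- by apply: polyfunN; exact: IHt.
- apply: polyfun_eq (polyfunM (IHt rt) (@polyfun_cst K I m%:R)) => z.
  by rewrite mulr_natr.
- by apply: polyfunM; [exact: IHt | exact: IHu].
- by apply: polyfunX; exact: IHt.
Qed.

(** The map rho renames the coordinates to variables of a larger formula. *)
Lemma polyfun_termfun (I : finType) (F : (I -> K) -> K) (rho : I -> nat) :
  polyfun F -> exists t : term,
    forall e : seq K, GRing.eval e t = F (fun i => nth 0 e (rho i)).
Proof.
move=> [P HP].
pose mon (m : multinom #|I|) : term := foldr (fun j t =>
  GRing.Mul (GRing.Exp (GRing.Var K (rho (enum_val j))) (m j)) t)
  (GRing.NatConst K 1) (index_enum 'I_#|I|).
exists (foldr (fun m t => GRing.Add (GRing.Mul (GRing.Const (mcoeff m P)) (mon m)) t)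
  (GRing.NatConst K 0) (msupp P)) => e.
rewrite HP mevalE; elim: (msupp P) => [|m s IHs] /=; first by rewrite big_nil.
rewrite big_cons IHs; congr (_ * _ + _); rewrite /mon.
elim: (index_enum _) => [|j r IHr] /=; first by rewrite big_nil.
by rewrite big_cons IHr.
Qed.

Lemma holds_exists_block (f : formula) m (e : seq K) :
  GRing.holds e (foldr (@GRing.Exists K) f (iota (size e) m)) <->
  exists2 s : seq K, size s = m & GRing.holds (e ++ s) f.
Proof.
elim: m e => [|m IHm] e /=.
  split=> [H|[s /size0nil ->]]; last by rewrite cats0.
  by exists [::]; rewrite ?cats0.
have E x : set_nth 0 e (size e) x = rcons e x.
  by elim: e {IHm} => //= y e ->.
split=> [[x]|[[//|x s] [sm] H]].
  rewrite E -(size_rcons e x) => /IHm[s sm H].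
  by exists (x :: s); rewrite /= ?sm // -cat_rcons.
exists x; rewrite E -(size_rcons e x); apply/IHm; exists s => //.
by rewrite cat_rcons.
Qed.

Lemma holds_forall_block (f : formula) m (e : seq K) :
  GRing.holds e (foldr (@GRing.Forall K) f (iota (size e) m)) <->
  forall s : seq K, size s = m -> GRing.holds (e ++ s) f.
Proof.
elim: m e => [|m IHm] e /=.
  split=> [H s /size0nil ->|H]; first by rewrite cats0.
  by rewrite -[e]cats0; exact: H.
have E x : set_nth 0 e (size e) x = rcons e x.
  by elim: e {IHm} => //= y e ->.
split=> [H [//|x s] [sm]|H x].
  have := H x; rewrite E -(size_rcons e x) => /IHm/(_ _ sm).
  by rewrite cat_rcons.
rewrite E -(size_rcons e x); apply/IHm => s sm.
by rewrite cat_rcons; apply: H; rewrite /= sm.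
Qed.

(** A quantifier-free formula is constant where none of the nonzero
    polynomials among its atoms vanishes. *)
Lemma qf_generic_constant (I : finType) (f : formula) :
  GRing.qf_form f -> GRing.rformula f ->
  exists (F : (I -> K) -> K) (b : bool), [/\ polyfun F, exists z, F z != 0
    & forall z, F z != 0 -> GRing.qf_eval (env z) f = b].
Proof.
have both (f1 f2 : formula) (op : bool -> bool -> bool) :
    (exists (F : (I -> K) -> K) (b : bool), [/\ polyfun F, exists z, F z != 0
    & forall z, F z != 0 -> GRing.qf_eval (env z) f1 = b]) ->
    (exists (F : (I -> K) -> K) (b : bool), [/\ polyfun F, exists z, F z != 0
    & forall z, F z != 0 -> GRing.qf_eval (env z) f2 = b]) ->
    exists (F : (I -> K) -> K) (b : bool), [/\ polyfun F, exists z, F z != 0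
    & forall z, F z != 0 ->
      op (GRing.qf_eval (env z) f1) (GRing.qf_eval (env z) f2) = b].
  move=> [F1 [b1 [P1 [z1 N1] H1]]] [F2 [b2 [P2 [z2 N2] H2]]].
  exists (fun z => F1 z * F2 z), (op b1 b2); split.
  - exact: polyfunM.
  - have [z F1z F2z] := polyfun_common_point P1 P2 N1 N2.
    by exists z; rewrite mulf_neq0.
  - by move=> z; rewrite mulf_eq0 negb_or => /andP[/H1 -> /H2 ->].
elim: f => //= [b|t u|f1 IH1 f2 IH2|f1 IH1 f2 IH2|f1 IH1 f2 IH2|f1 IH1].
- exists (fun=> 1), b; split=> //; first exact: polyfun_cst.
  by exists (fun=> 0); rewrite oner_neq0.
- move=> _ /andP[rt ru].
  have HF := polyfunD (termfun_polyfun I rt) (polyfunN (termfun_polyfun I ru)).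
  have [[z Hz]|H] := pselect (exists z : I -> K,
      GRing.eval (env z) t - GRing.eval (env z) u != 0).
    exists (fun z => GRing.eval (env z) t - GRing.eval (env z) u), false.
    by split=> // [|z']; [exists z | rewrite subr_eq0 => /negbTE].
  exists (fun=> 1), true; split; first exact: polyfun_cst.
    by exists (fun=> 0); rewrite oner_neq0.
  move=> z _; apply/eqP; apply: contrapT => E; apply: H; exists z.
  by rewrite subr_eq0; apply/eqP.
- by move=> /andP[q1 q2] /andP[r1 r2]; apply: (both _ _ andb); [exact: IH1 | exact: IH2].
- by move=> /andP[q1 q2] /andP[r1 r2]; apply: (both _ _ orb); [exact: IH1 | exact: IH2].
- by move=> /andP[q1 q2] /andP[r1 r2]; apply: (both _ _ implb); [exact: IH1 | exact: IH2].
- move=> q1 r1; have [F [b [P N H]]] := IH1 q1 r1.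
  by exists F, (~~ b); split=> // z /H ->.
Qed.

(** Quantifier elimination over an algebraically closed field makes every
    first-order condition generically true or generically false. *)
Lemma formula_generic_constant (I : finType) (f : formula) :
  exists (F : (I -> K) -> K), [/\ polyfun F, exists z, F z != 0
    & (forall z, F z != 0 -> GRing.holds (env z) f) \/
      (forall z, F z != 0 -> ~ GRing.holds (env z) f)].
Proof.
pose ok := @closed_field.ClosedFieldQE.holds_ex_elim K (@GRing.solve_monicpoly K).
pose wf := @closed_field.ClosedFieldQE.wf_ex_elim K.
pose g := GRing.quantifier_elim (@closed_field.ClosedFieldQE.ex_elim K) (GRing.to_rform f).
have gP (z : I -> K) : reflect (GRing.holds (env z) f) (GRing.qf_eval (env z) g).
  have H := GRing.quantifier_elim_rformP wf ok (env z) (GRing.to_rform_rformula f).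
  by apply: (iffP H); move/GRing.to_rformP.
have /andP[qg rg] := GRing.quantifier_elim_wf wf (GRing.to_rform_rformula f).
have [F [[] [P N H]]] := qf_generic_constant I qg rg; exists F; split=> //.
- by left=> z /H/gP.
- by right=> z /H E /gP; rewrite E.
Qed.

Definition splice (I J : finType) (z : I -> K) (u : J -> K) (t : I + J) : K :=
  match t with inl i => z i | inr j => u j end.

(** The condition P is first-order, with one block of universal and one block of
    existential quantifiers; retractions of all subrepresentations of a given
    dimension vector are of this form. *)
Lemma generic_dichotomy (I U W A A' : finType)
    (E : A -> (I + U -> K) -> K) (E' : A' -> ((I + U) + W -> K) -> K) :
  (forall a, polyfun (E a)) -> (forall a, polyfun (E' a)) ->
  let P z := forall u, (forall a, E a (splice z u) = 0) ->
    exists w, forall a, E' a (splice (splice z u) w) = 0 in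
  exists (F : (I -> K) -> K), [/\ polyfun F, exists z, F z != 0
    & (forall z, F z != 0 -> P z) \/ (forall z, F z != 0 -> ~ P z)].
Proof.
move=> HE HE' P.
(* Variables are laid out in three consecutive blocks: z, then u, then w. *)
pose rho1 (t : I + U) : nat := match t with
  | inl i => enum_rank i | inr j => (#|I| + enum_rank j)%N end.
pose rho2 (t : (I + U) + W) : nat := match t with
  | inl i => rho1 i | inr j => (#|I| + #|U| + enum_rank j)%N end.
have rho1P z u s : (fun t => nth 0 (env z ++ env u ++ s) (rho1 t)) = splice z u.
  apply/funext => -[i|j] /=; rewrite nth_cat size_env.
    by rewrite ltn_ord nth_env.
  by rewrite ltnNge leq_addr /= addKn nth_cat size_env ltn_ord nth_env.
have rho2P z u w :
    (fun t => nth 0 (env z ++ env u ++ env w) (rho2 t)) = splice (splice z u) w.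
  apply/funext => -[t|j] /=; first by rewrite -(rho1P z u (env w)).
  rewrite catA nth_cat size_cat !size_env.
  by rewrite ltnNge leq_addr /= addKn nth_env.
have [tE tEP] := boolp.choice (fun a => polyfun_termfun rho1 (HE a)).
have [tE' tE'P] := boolp.choice (fun a => polyfun_termfun rho2 (HE' a)).
pose conj T (r : seq T) (t : T -> term) : formula :=
  foldr (fun a f => GRing.And (GRing.Equal (t a) (GRing.NatConst K 0)) f)
        (GRing.Bool true) r.
have conjP (T : finType) (t : T -> term) e : GRing.holds e (conj T (enum T) t) <->
    forall a, GRing.eval e (t a) = 0.
  have Q r : GRing.holds e (conj T r t) <->
      forall a, a \in r -> GRing.eval e (t a) = 0.
    elim: r => [|a r IHr] //=; rewrite IHr; split=> [[H1 H2] b|H].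
      by rewrite inE => /orP[/eqP ->//|/H2].
    by split=> [|b br]; apply: H; rewrite inE ?eqxx ?br ?orbT.
  by rewrite Q; split=> H a *; apply: H; rewrite ?mem_enum.
pose f : formula := foldr (@GRing.Forall K) (GRing.Implies (conj A (enum A) tE)
  (foldr (@GRing.Exists K) (conj A' (enum A') tE') (iota (#|I| + #|U|) #|W|)))
  (iota #|I| #|U|).
have fP z : GRing.holds (env z) f <-> P z.
  have := holds_forall_block (GRing.Implies (conj A (enum A) tE)
    (foldr (@GRing.Exists K) (conj A' (enum A') tE') (iota (#|I| + #|U|) #|W|)))
    #|U| (env z).
  have eqIU u : (#|I| + #|U|)%N = size (env z ++ @env U u).
    by rewrite size_cat !size_env.
  rewrite size_env => ->; split=> [H u Eu|H s /env_surj[u <-] /= /conjP Hu].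
    have /= Hu := H (env u) (size_env u).
    have /Hu : GRing.holds (env z ++ env u) (conj A (enum A) tE).
      by apply/conjP => a; rewrite tEP -[env u]cats0 rho1P.
    rewrite (eqIU u) => /holds_exists_block[s /env_surj[w <-]] /conjP Hw.
    by exists w => a; rewrite -(rho2P z u w) catA -tE'P.
  have [|w Hw] := H u.
    by move=> a; have := Hu a; rewrite tEP -[env u]cats0 rho1P.
  rewrite (eqIU u); apply/holds_exists_block; exists (env w); first by rewrite size_env.
  by apply/conjP => a; rewrite tE'P -catA rho2P.
have [F [PF NF H]] := formula_generic_constant I f; exists F; split=> //.
by case: H => H; [left | right] => z /H /fP.
Qed.

End ConstructibleSets.

(** * Matrices for subspaces and direct sums *)

Section VectorSpaces.
Variable K : fieldType.

Definition colspace a b (M : 'M[K]_(a, b)) : {vspace 'cV[K]_a} :=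
  limg (linfun (mulmx M : 'cV[K]_b -> 'cV[K]_a)).

Lemma colspaceP a b (M : 'M[K]_(a, b)) u :
  reflect (exists c : 'cV_b, u = M *m c) (u \in colspace M).
Proof.
apply: (iffP memv_imgP) => [[c _ ->]|[c ->]].
  by exists c; rewrite lfunE.
by exists c; rewrite ?memvf // lfunE.
Qed.

Lemma dim_colspace a b (M : 'M[K]_(a, b)) L :
  L *m M = 1%:M -> \dim (colspace M) = b.
Proof.
move=> LM; rewrite limg_dim_eq; first by rewrite dimvf; exact: muln1.
apply/eqP; rewrite capfv -subv0; apply/subvP => c.
rewrite memv_ker lfunE /= memv0 => /eqP Mc.
by rewrite -[c]mul1mx -LM -mulmxA Mc mulmx0.
Qed.

Lemma mx_left_inverse a b (M : 'M[K]_(a, b)) :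
  (forall c : 'cV_b, M *m c = 0 -> c = 0) -> exists L, L *m M = 1%:M.
Proof.
move=> injM; have : row_free M^T.
  apply: inj_row_free => v vM; apply: trmx_inj; rewrite trmx0; apply: injM.
  by apply: trmx_inj; rewrite trmx_mul trmxK vM trmx0.
move=> /row_freeP[B MB]; exists B^T.
by apply: trmx_inj; rewrite trmx_mul trmxK MB trmx1.
Qed.

Definition basismx a (U : {vspace 'cV[K]_a}) : 'M[K]_(a, \dim U) :=
  \matrix_(r, c) (vbasis U)`_c r 0.

Lemma basismxE a (U : {vspace 'cV[K]_a}) c :
  basismx U *m c = \sum_i c i 0 *: (vbasis U)`_i.
Proof.
apply/matrixP => r s; rewrite ord1 !mxE summxE; apply: eq_bigr => i _.
by rewrite !mxE mulrC.
Qed.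

Lemma mem_basismx a (U : {vspace 'cV[K]_a}) c : basismx U *m c \in U.
Proof.
rewrite basismxE; apply: memv_suml => i _; apply: memvZ; apply: vbasis_mem.
by rewrite mem_nth // size_tuple.
Qed.

Lemma basismxP a (U : {vspace 'cV[K]_a}) u :
  reflect (exists c, u = basismx U *m c) (u \in U).
Proof.
apply: (iffP idP) => [uU|[c ->]]; last exact: mem_basismx.
exists (\col_i coord (vbasis U) i u); rewrite basismxE {1}(coord_vbasis uU).
by apply: eq_bigr => i _; rewrite mxE.
Qed.

Lemma basismx_inv a (U : {vspace 'cV[K]_a}) : exists L, L *m basismx U = 1%:M.
Proof.
apply: mx_left_inverse => c; rewrite basismxE => H.
have /freeP F : free (vbasis U) by apply: basis_free (vbasisP U).
by apply/matrixP => i j; rewrite ord1 [RHS]mxE; apply: (F (fun i => c i 0)).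
Qed.

Lemma mulmx_ext a b (M N : 'M[K]_(a, b)) :
  (forall c : 'cV_b, M *m c = N *m c) -> M = N.
Proof.
move=> H; apply/matrixP => i j.
have /matrixP/(_ i 0) := H (delta_mx j 0).
by rewrite -!colE !mxE.
Qed.

Definition endmx a (f : 'End('cV[K]_a)) : 'M[K]_a :=
  \matrix_(i, j) f (delta_mx j 0) i 0.

Lemma endmxE a (f : 'End('cV[K]_a)) u : endmx f *m u = f u.
Proof.
have -> : u = \sum_j u j 0 *: delta_mx j 0.
  by rewrite {1}[u]matrix_sum_delta; apply: eq_bigr => j _; rewrite big_ord1.
rewrite mulmx_sumr linear_sum; apply: eq_bigr => j _.
rewrite -scalemxAr linearZ /=; congr (_ *: _).
by apply/matrixP => r c; rewrite -colE !mxE ord1.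
Qed.

End VectorSpaces.

Section DirectSums.
Variable K : fieldType.

Definition incl m (r : 'I_m -> nat) (j : 'I_m) : 'M[K]_((\sum_i r i)%N, r j) :=
  mxsub id (tagnat.Rank j) 1%:M.

Lemma submxblock_incl m n (r : 'I_m -> nat) (c : 'I_n -> nat)
    (A : 'M[K]_(\sum_i r i, \sum_i c i)) i j :
  submxblock A i j = (incl r i)^T *m A *m incl c j.
Proof.
rewrite /incl trmx_mxsub trmx1 mulmx_colsub mulmx1 mul_rowsub_mx mul1mx.
by apply/matrixP => x y; rewrite !mxE.
Qed.

Lemma tr_incl_mul m (r : 'I_m -> nat) i j x y :
  ((incl r i)^T *m incl r j) x y = ((i == j) && (x == y :> nat))%:R.
Proof.
rewrite -[(incl r i)^T]mulmx1 -submxblock_incl -tagnat.eq_Rank.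
by rewrite [LHS]mxE [LHS]mxE.
Qed.

Lemma incl_orth m (r : 'I_m -> nat) i j :
  i != j -> (incl r i)^T *m incl r j = 0.
Proof.
by move=> ij; apply/matrixP => x y; rewrite tr_incl_mul (negbTE ij) mxE.
Qed.

Lemma incl_id m (r : 'I_m -> nat) j : (incl r j)^T *m incl r j = 1%:M.
Proof. by apply/matrixP => x y; rewrite tr_incl_mul eqxx mxE. Qed.

Lemma sum_incl m (r : 'I_m -> nat) : \sum_j incl r j *m (incl r j)^T = 1%:M.
Proof.
apply/mxblockP => i j; rewrite !submxblock_incl mulmx1.
rewrite mulmx_sumr mulmx_suml (bigD1 i) //= [X in _ + X]big1 ?addr0; last first.
  by move=> l li; rewrite !mulmxA incl_orth ?mul0mx // eq_sym.
by rewrite !mulmxA incl_id mul1mx.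
Qed.

(** The block matrix as a sum of conjugates of its summands, which turns
    computations with direct sums into orthogonality relations. *)
Lemma direct_sumE (Q : quiver) m (beta : 'I_m -> dimvec Q)
    (S : forall j, rep K (beta j)) a :
  direct_sum S a = \sum_j incl (fun j => beta j (tgt a)) j *m S j a
                     *m (incl (fun j => beta j (src a)) j)^T.
Proof.
apply/mxblockP => i j; rewrite /direct_sum mxblockK.
rewrite submxblock_incl.
rewrite mulmx_sumr mulmx_suml (bigD1 i) //= [X in _ + X]big1 ?addr0; last first.
  by move=> l li; rewrite !mulmxA incl_orth ?mul0mx // eq_sym.
rewrite !mulmxA incl_id mul1mx -mulmxA; case: eqP => [<-|/eqP ij].
  by rewrite incl_id mulmx1 conform_mx_id.
by rewrite incl_orth ?mulmx0.
Qed.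

End DirectSums.

(** * Polystability in the lattice of subrepresentations *)

Section Subrepresentations.
Variables (Q : quiver) (K : fieldType) (sigma : weight Q) (alpha : dimvec Q).
Variable V : rep K alpha.

Local Notation fam := (forall v, {vspace 'cV[K]_(alpha v)}).
Implicit Types A C S U W : fam.

Definition fam_le U W : Prop := forall v, (U v <= W v)%VS.
Definition fam_cap U W : fam := fun v => (U v :&: W v)%VS.
Definition fam_add U W : fam := fun v => (U v + W v)%VS.
Definition fam0 : fam := fun=> 0%VS.
Definition famT : fam := fun=> fullv.
Definition wt W : int := weight_pairing sigma (subdim W).

Lemma fam_eq U W : (forall v, U v = W v) -> U = W.
Proof. by move=> UW; apply/functional_extensionality_dep. Qed.

Lemma subrep_cap U W : subrep V U -> subrep V W -> subrep V (fam_cap U W).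
Proof.
move=> HU HW a u; rewrite !memv_cap => /andP[uU uW].
by rewrite HU // HW.
Qed.

Lemma subrep_add U W : subrep V U -> subrep V W -> subrep V (fam_add U W).
Proof.
move=> HU HW a u /memv_addP[x xU [y yW ->]].
by rewrite mulmxDr memv_add ?HU ?HW.
Qed.

Lemma subrep0 : subrep V fam0.
Proof. by move=> a u; rewrite !memv0 => /eqP ->; rewrite mulmx0. Qed.

Lemma subrepT : subrep V famT.
Proof. by move=> a u _; apply: memvf. Qed.

(** The weight depends only on dimensions, which are modular on subspaces. *)
Lemma wt_modular U W : wt (fam_add U W) + wt (fam_cap U W) = wt U + wt W.
Proof.
rewrite /wt /weight_pairing -!big_split /=; apply: eq_bigr => v _.
by rewrite -!mulrDr -!PoszD dimv_sum_cap.
Qed.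

Lemma wt0 : wt fam0 = 0.
Proof. by rewrite /wt /weight_pairing big1 // => v _; rewrite /subdim dimv0 mulr0. Qed.

Lemma dim_colv a : \dim (fullv : {vspace 'cV[K]_a}) = a.
Proof. by rewrite dimvf; exact: muln1. Qed.

Lemma wtT : wt famT = weight_pairing sigma alpha.
Proof. by apply: eq_bigr => v _; rewrite /subdim dim_colv. Qed.

(** Polystability of a subrepresentation, read inside the modular lattice of
    subrepresentations: semistability together with complements for the
    subrepresentations of weight zero. *)
Definition lpolystable A : Prop :=
  [/\ subrep V A, wt A = 0,
      forall U, subrep V U -> fam_le U A -> wt U <= 0
    & forall U, subrep V U -> fam_le U A -> wt U = 0 ->
        exists C, [/\ subrep V C, fam_cap U C = fam0 & fam_add U C = A]].

(** Stability of a subrepresentation, read inside the same lattice. *)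
Definition lsimple S : Prop :=
  [/\ subrep V S, wt S = 0
    & forall U, subrep V U -> fam_le U S -> [\/ U = fam0, U = S | wt U < 0]].

Lemma lpolystable0 : lpolystable fam0.
Proof.
have le0 U : fam_le U fam0 -> U = fam0.
  by move=> U0; apply: fam_eq => v; apply/eqP; rewrite -subv0; exact: U0.
split; [exact: subrep0 | exact: wt0 | by move=> U _ /le0 ->; rewrite wt0 |].
move=> U _ /le0 -> _; exists fam0; split; first exact: subrep0.
  by apply: fam_eq => v; rewrite /fam_cap capvv.
by apply: fam_eq => v; rewrite /fam_add addvv.
Qed.

Lemma fam_modular U A W :
  fam_le A U -> fam_cap U (fam_add A W) = fam_add A (fam_cap U W).
Proof.
move=> AU; apply: fam_eq => v; rewrite /fam_cap /fam_add.
by rewrite [(A v + W v)%VS]addvC -vspace_modr ?AU // addvC.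
Qed.

(** Adding a simple summand. A subrepresentation U of A + S of weight zero
    meets A in weight zero, and U + A meets S in 0 or in S. In the first case
    U lies in A, and a complement in A is enlarged by S; in the second, a
    complement of the intersection of U and A inside A is already a
    complement of U. *)
Lemma lpolystable_add A S : lpolystable A -> lsimple S -> fam_cap A S = fam0 ->
  lpolystable (fam_add A S).
Proof.
move=> [sA wA ssA cA] [sS wS simS] AS.
have wU U : subrep V U -> fam_le U (fam_add A S) ->
    [/\ wt U = wt (fam_cap U A) + wt (fam_cap (fam_add U A) S),
        wt (fam_cap U A) <= 0, wt (fam_cap (fam_add U A) S) <= 0
      & fam_add U A = fam_add A (fam_cap (fam_add U A) S)].
  move=> sU UAS; have sUA := subrep_add sU sA.
  have sI := subrep_cap sUA sS.
  have E : fam_add U A = fam_add A (fam_cap (fam_add U A) S).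
    rewrite -fam_modular; last by move=> v; exact: addvSr.
    apply: fam_eq => v; apply/esym/capv_idPl.
    by rewrite subv_add UAS addvSl.
  split=> //.
  - have H1 := wt_modular U A; have H2 := wt_modular A (fam_cap (fam_add U A) S).
    have H3 : fam_cap A (fam_cap (fam_add U A) S) = fam0.
      apply: fam_eq => v; apply/eqP; rewrite -subv0 /fam_cap.
      have <- : (A v :&: S v)%VS = 0%VS := congr1 (fun F : fam => F v) AS.
      by rewrite capvS // capvSr.
    move: H2; rewrite -E H3 wt0 addr0 wA add0r => H2.
    by move: H1; rewrite H2 wA addr0 => <-; rewrite addrC.
  - by apply: ssA; [exact: subrep_cap | move=> v; exact: capvSr].
  - have [|->|->|/ltW//] := simS _ sI; first by move=> v; exact: capvSr.
      by rewrite wt0.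
    by rewrite wS.
split; first exact: subrep_add.
- have := wt_modular A S; rewrite AS wt0 wA wS !addr0.
  by [].
- by move=> U sU UAS; have [-> H1 H2 _] := wU U sU UAS; rewrite -[0]addr0 lerD.
move=> U sU UAS wU0; have [E H1 H2 EA] := wU U sU UAS.
have wUA : wt (fam_cap U A) = 0.
  apply/eqP; rewrite eq_le H1 /=; move: E; rewrite wU0 => E.
  by rewrite -(lerD2r (wt (fam_cap (fam_add U A) S))) -E add0r.
have wI : wt (fam_cap (fam_add U A) S) = 0.
  by move: E; rewrite wU0 wUA add0r => <-.
have sUA := subrep_cap sU sA.
have [C [sC UC UCA]] := cA _ sUA (fun v => capvSr _ _) wUA.
have memA v x : x \in A v -> x \in S v -> x = 0.
  move=> xA xS; apply/eqP; rewrite -memv0.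
  have <- : (A v :&: S v)%VS = 0%VS := congr1 (fun F : fam => F v) AS.
  by rewrite memv_cap xA.
have CA v : (C v <= A v)%VS.
  by have <- : (_ + C v)%VS = A v := congr1 (fun F : fam => F v) UCA; exact: addvSr.
have UCv v x : x \in U v -> x \in C v -> x = 0.
  move=> xU xC; apply/eqP; rewrite -memv0.
  have <- : ((U v :&: A v) :&: C v)%VS = 0%VS := congr1 (fun F : fam => F v) UC.
  by rewrite !memv_cap xU xC andbT /=; apply: (subvP (CA v)).
have [|I0|IS|] := simS _ (subrep_cap (subrep_add sU sA) sS); last first.
- by rewrite wI ltxx.
- exists C; split=> //.
    apply: fam_eq => v; apply/eqP; rewrite -subv0; apply/subvP => x.
    by rewrite memv_cap memv0 => /andP[xU xC]; rewrite (UCv v x).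
  apply: fam_eq => v.
  have UAv : (U v + A v = A v + S v)%VS.
    by have := congr1 (fun F : fam => F v) EA; rewrite IS.
  rewrite /fam_add -UAv.
  have <- : (U v :&: A v + C v)%VS = A v := congr1 (fun F : fam => F v) UCA.
  by rewrite addvA; congr (_ + _)%VS; apply/esym/addv_idPl/capvSl.
- have UA v : (U v <= A v)%VS.
    have : (U v + A v = A v)%VS.
      have := congr1 (fun F : fam => F v) EA; rewrite I0 /fam_add /fam0.
      by rewrite addv0.
    by move=> <-; exact: addvSl.
  exists (fam_add C S); split; first exact: subrep_add.
    apply: fam_eq => v; apply/eqP; rewrite -subv0; apply/subvP => x.
    rewrite memv_cap memv0 => /andP[xU /memv_addP[c cC [s sSv xE]]].
    have s0 : s = 0.
      apply: (memA v) => //; rewrite (_ : s = x - c).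
        by rewrite memvB //; [exact: (subvP (UA v)) | exact: (subvP (CA v))].
      by rewrite xE addrC addKr.
    by rewrite s0 addr0 in xE; rewrite (UCv v x) // xE.
  apply: fam_eq => v; rewrite /fam_add addvA; congr (_ + _)%VS.
  have <- : (U v :&: A v + C v)%VS = A v := congr1 (fun F : fam => F v) UCA.
  by congr (_ + _)%VS; apply/esym/capv_idPl.
- by move=> v; exact: capvSr.
Qed.

Lemma lpolystable_sub A U : lpolystable A -> subrep V U -> fam_le U A -> wt U = 0 -> lpolystable U.
Proof.
move=> [sA wA ssA cA] sU UA wU.
have trans W : fam_le W U -> fam_le W A by move=> WU v; exact: subv_trans (WU v) (UA v).
split=> // [W sW /trans|W sW WU wW]; first exact: ssA.
have [C [sC WC WCA]] := cA W sW (trans W WU) wW.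
exists (fam_cap U C); split; first exact: subrep_cap.
  apply: fam_eq => v; apply/eqP; rewrite -subv0.
  have <- : (W v :&: C v)%VS = 0%VS := congr1 (fun F : fam => F v) WC.
  by rewrite /fam_cap capvS // capvSr.
rewrite -fam_modular // WCA; apply: fam_eq => v.
by apply/capv_idPl/UA.
Qed.

Definition fdim W : nat := (\sum_v \dim (W v))%N.

Lemma fdim0 W : fdim W = 0%N -> W = fam0.
Proof.
move=> W0; apply: fam_eq => v; apply/eqP; rewrite -dimv_eq0.
have : (\dim (W v) <= fdim W)%N by rewrite /fdim (bigD1 v) //= leq_addr.
by rewrite W0 leqn0.
Qed.

Lemma fdim_eq U W : fam_le U W -> fdim U = fdim W -> U = W.
Proof.
move=> UW E; apply: fam_eq => v; apply/eqP; rewrite eqEdim UW /=.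
move: E; rewrite /fdim (bigD1 v) //= [RHS](bigD1 v) //= => E.
have H : (\sum_(i | i != v) \dim (U i) <= \sum_(i | i != v) \dim (W i))%N.
  by apply: leq_sum => i _; exact/dimvS/UW.
by rewrite -(leq_add2r (\sum_(i | i != v) \dim (U i))%N) E leq_add2l.
Qed.

Lemma fdim_le U W : fam_le U W -> (fdim U <= fdim W)%N.
Proof. by move=> UW; apply: leq_sum => v _; exact/dimvS/UW. Qed.

(** A nonzero subrepresentation of weight zero and of minimal dimension among
    those inside A is simple; splitting it off lowers the dimension. *)
Lemma lpolystable_decomposition A : lpolystable A ->
  exists (m : nat) (S : 'I_m -> fam), [/\ forall j, lsimple (S j),
    forall v, A v = (\sum_j S j v)%VS & forall v, \dim (A v) = (\sum_j \dim (S j v))%N].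
Proof.
have [N] := ubnP (fdim A); elim: N A => // N IHN A; rewrite ltnS => AN pA.
have [A0|Apos] := eqVneq (fdim A) 0%N.
  have -> := fdim0 A0; exists 0%N, (fun=> fam0); split; first by case.
    by move=> v; rewrite big_ord0.
  by move=> v; rewrite big_ord0 dimv0.
have [sA wA ssA cA] := pA.
pose cand d := `[< exists U, [/\ subrep V U, fam_le U A, wt U = 0, fdim U = d & (0 < d)%N] >].
have exd : exists d, cand d.
  by exists (fdim A); apply/asboolP; exists A; split=> //; rewrite lt0n.
have [U [sU UA wU dU d0]] : exists U, [/\ subrep V U, fam_le U A, wt U = 0,
     fdim U = ex_minn exd & (0 < ex_minn exd)%N].
  by case: ex_minnP => d /asboolP.
have minU W : subrep V W -> fam_le W A -> wt W = 0 -> (0 < fdim W)%N ->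
    (fdim U <= fdim W)%N.
  move=> sW WA wW W0; rewrite dU; case: ex_minnP => d _; apply.
  by apply/asboolP; exists W.
have simU : lsimple U.
  split=> // W sW WU; have WA : fam_le W A.
    by move=> v; exact: subv_trans (WU v) (UA v).
  have := ssA W sW WA; rewrite le_eqVlt => /orP[/eqP wW|]; last by constructor 3.
  have [W0|Wpos] := posnP (fdim W); first by constructor 1; exact: fdim0.
  constructor 2; apply: fdim_eq => //; apply/eqP; rewrite eqn_leq fdim_le //=.
  exact: minU.
have [C [sC UC UCA]] := cA U sU UA wU.
have CA : fam_le C A by move=> v; rewrite -UCA; exact: addvSr.
have UCd v : \dim (A v) = (\dim (U v) + \dim (C v))%N.
  rewrite -dimv_sum_cap.
  have -> : (U v + C v)%VS = A v := congr1 (fun F : fam => F v) UCA.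
  have -> : (U v :&: C v)%VS = 0%VS := congr1 (fun F : fam => F v) UC.
  by rewrite dimv0 addn0.
have wC : wt C = 0 by have := wt_modular U C; rewrite UC UCA wt0 wA wU !add0r => <-.
have CN : (fdim C < N)%N.
  apply: leq_trans AN; rewrite /fdim (eq_bigr _ (fun v _ => UCd v)) big_split /=.
  by rewrite -[X in (X <= _)%N]add1n leq_add2r; rewrite -/(fdim U) dU.
have [m [S [simS CS dS]]] := IHN C CN (lpolystable_sub pA sC CA wC).
exists m.+1, (fun j => if unlift ord0 j is Some j' then S j' else U); split.
- by move=> j; case: unliftP => [j' _|_].
- move=> v; rewrite big_ord_recl unlift_none.
  have -> : A v = (U v + C v)%VS by rewrite -UCA.
  by rewrite CS; congr (_ + _)%VS; apply: eq_bigr => j _; rewrite liftK.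
- move=> v; rewrite big_ord_recl unlift_none UCd dS.
  by congr (_ + _)%N; apply: eq_bigr => j _; rewrite liftK.
Qed.

(** A subrepresentation given by injective matrices X, with restricted maps Z.
    In this form it makes sense for polynomial identities and for field
    extensions. *)
Definition mxsubrep (b : dimvec Q) (X : forall v, 'M[K]_(alpha v, b v))
    (Z : rep K b) : Prop :=
  (forall v, exists L, L *m X v = 1%:M) /\
  forall a, V a *m X (src a) = X (tgt a) *m Z a.

Definition sub_at (b : dimvec Q) : Prop := exists X Z, @mxsubrep b X Z.

Lemma mxsubrep_colspace b X Z : @mxsubrep b X Z ->
  subrep V (fun v => colspace (X v)) /\ subdim (fun v => colspace (X v)) = b.
Proof.
move=> [LX VX]; split.
  move=> a u /colspaceP[c ->]; rewrite mulmxA VX -mulmxA.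
  by apply/colspaceP; exists (Z a *m c).
apply/funext => v; have [L LXv] := LX v; exact: dim_colspace LXv.
Qed.

Lemma subrep_basismx W : subrep V W ->
  exists Z, @mxsubrep (subdim W) (fun v => basismx (W v)) Z.
Proof.
move=> sW.
pose L v : 'M_(\dim (W v), alpha v) := sval (cid (basismx_inv (W v))).
have LE v : L v *m basismx (W v) = 1%:M by rewrite /L; case: cid.
exists (fun a => L (tgt a) *m (V a *m basismx (W (src a)))); split.
  by move=> v; exists (L v); exact: LE.
move=> a; apply: mulmx_ext => c; rewrite -!mulmxA.
have /basismxP[d dE] := sW a _ (@mem_basismx _ _ (W (src a)) c).
by rewrite dE (mulmxA (L _)) LE mul1mx.
Qed.

Lemma sub_atP b : sub_at b <-> exists2 W, subrep V W & subdim W = b.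
Proof.
split=> [[X [Z /mxsubrep_colspace[sW dW]]]|[W sW <-]]; first by eexists; eassumption.
by have [Z H] := subrep_basismx sW; exists (fun v => basismx (W v)), Z.
Qed.

Lemma semistableP : semistable sigma V <->
  weight_pairing sigma alpha = 0 /\
  forall b, sub_at b -> weight_pairing sigma b <= 0.
Proof.
split=> [[w0 H]|[w0 H]]; split=> //.
  by move=> b /sub_atP[W sW <-]; exact: H.
by move=> W sW; apply: H; apply/sub_atP; exists W.
Qed.

Lemma stableP : stable sigma V <->
  weight_pairing sigma alpha = 0 /\
  forall b, sub_at b -> b <> (fun=> 0%N) -> b <> alpha -> weight_pairing sigma b < 0.
Proof.
split=> [[w0 H]|[w0 H]]; split=> //.
  move=> b /sub_atP[W sW <-] b0 b1; apply: H => // E; [apply: b0|apply: b1];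
    exact/funext.
move=> W sW b0 b1; apply: H; first by apply/sub_atP; exists W.
  by move=> E; apply: b0 => v; rewrite E.
by move=> E; apply: b1 => v; rewrite E.
Qed.

(** A retraction of V onto the subrepresentation, that is, an invariant
    complement. *)
Definition mxretract b X Z : Prop :=
  exists P : forall v, 'M[K]_(b v, alpha v),
    (forall v, P v *m X v = 1%:M) /\ (forall a, P (tgt a) *m V a = (Z : rep K b) a *m P (src a)).

(** Polystability as a condition on subrepresentations only; polystableP below
    shows that it is equivalent to being a direct sum of stables. *)
Definition mxpolystable : Prop :=
  [/\ weight_pairing sigma alpha = 0,
      forall b, sub_at b -> weight_pairing sigma b <= 0
    & forall b X Z, @mxsubrep b X Z -> weight_pairing sigma b = 0 -> mxretract X Z].

(** Projections and kernels translate complements into retractions. *)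
Lemma lpolystableP : lpolystable famT <-> mxpolystable.
Proof.
have leT U : fam_le U famT by move=> v; exact: subvf.
split=> [[_ wT ssT cT]|[w0 ss re]].
  split; first by rewrite -wtT.
    by move=> b /sub_atP[W sW <-]; exact: ssT.
  move=> b X Z H wb; have [sW dW] := mxsubrep_colspace H; have [LX VX] := H.
  have [|C [sC WC WCT]] := cT _ sW (leT _); first by rewrite /wt dW.
  pose L v := sval (cid (LX v)).
  have LE v : L v *m X v = 1%:M by rewrite /L; case: cid.
  have WCv v : (colspace (X v) :&: C v)%VS = 0%VS := congr1 (fun F : fam => F v) WC.
  have full v u : u \in (colspace (X v) + C v)%VS.
    by have -> : (colspace (X v) + C v)%VS = fullv := congr1 (fun F : fam => F v) WCT; exact: memvf.
  pose P v := L v *m endmx (daddv_pi (colspace (X v)) (C v)).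
  have PE v c w : w \in C v -> P v *m (X v *m c + w) = c.
    move=> wC; rewrite /P -mulmxA endmxE linearD /= (daddv_pi_id (WCv v)); last first.
      by apply/colspaceP; exists c.
    have -> : daddv_pi (colspace (X v)) (C v) w = 0.
      have E2 : daddv_pi (C v) (colspace (X v)) w = w.
        by apply: daddv_pi_id => //; rewrite capvC.
      have := daddv_pi_add (WCv v) (full v w).
      by rewrite E2 -[X in _ = X]add0r => /addIr.
    by rewrite addr0 mulmxA LE mul1mx.
  exists P; split=> [v|a].
    apply: mulmx_ext => c; rewrite -mulmxA mul1mx -[X v *m c]addr0.
    by rewrite PE // mem0v.
  apply: mulmx_ext => u.
  have /memv_addP[_ /colspaceP[c ->] [w wC ->]] := full (src a) u.
  rewrite -[RHS]mulmxA (PE _ c w wC) -mulmxA mulmxDr mulmxA VX -mulmxA.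
  by rewrite PE //; exact: sC.
split; [exact: subrepT | by rewrite wtT | |].
  by move=> U sU _; apply: ss; apply/sub_atP; exists U.
move=> U sU _ wU; have [Z H] := subrep_basismx sU.
have [P [PX PV]] := re _ _ _ H wU.
exists (fun v => lker (linfun (mulmx (P v)))).
have kerP v u : (u \in lker (linfun (mulmx (P v) : 'cV_(alpha v) -> 'cV_(\dim (U v))))) = (P v *m u == 0).
  by rewrite memv_ker lfunE.
split.
- by move=> a u; rewrite !kerP mulmxA PV -mulmxA => /eqP ->; rewrite mulmx0.
- apply: fam_eq => v; apply/eqP; rewrite -subv0; apply/subvP => u.
  rewrite memv_cap memv0 kerP => /andP[/basismxP[c ->]].
  by rewrite mulmxA PX mul1mx => /eqP ->; rewrite mulmx0.
- apply: fam_eq => v; apply/eqP; rewrite eqEsubv subvf /=; apply/subvP => u _.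
  apply/memv_addP; exists (basismx (U v) *m (P v *m u)); first exact: mem_basismx.
  exists (u - basismx (U v) *m (P v *m u)); last by rewrite addrC subrK.
  by rewrite kerP mulmxBr mulmxA PX mul1mx subrr.
Qed.

End Subrepresentations.

Section PolystableDecomposition.
Variables (Q : quiver) (K : fieldType) (sigma : weight Q) (alpha : dimvec Q).
Variable V : rep K alpha.

Lemma sum_single (U : zmodType) m (F : 'I_m -> U) j :
  (forall i, i != j -> F i = 0) -> \sum_i F i = F j.
Proof. by move=> F0; rewrite (bigD1 j) //= big1 ?addr0. Qed.

Lemma mx_right_inverse a b (M : 'M[K]_(a, b)) :
  a = b -> (forall u : 'cV_a, exists c, M *m c = u) ->
  exists G, M *m G = 1%:M /\ G *m M = 1%:M.
Proof.
move=> ab; case: _ / ab in M * => surj.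
have [c cE] := boolp.choice (fun j : 'I_a => surj (delta_mx j 0)).
pose G : 'M[K]_a := \matrix_(i, j) c j i 0.
have MG : M *m G = 1%:M.
  apply/matrixP => i j; have /matrixP/(_ i 0) := cE j.
  rewrite !mxE eqxx andbT => <-; apply: eq_bigr => l _; by rewrite mxE.
by exists G; split=> //; exact: mulmx1C.
Qed.

Lemma colspace_basismx a (U : {vspace 'cV[K]_a}) : colspace (basismx U) = U.
Proof. by apply/vspaceP => u; apply/colspaceP/basismxP. Qed.

Section OneSubrepresentation.
Variables (b : dimvec Q) (X : forall v, 'M[K]_(alpha v, b v)) (Z : rep K b).
Hypothesis XZ : mxsubrep V X Z.

Let f v : 'Hom('cV[K]_(b v), 'cV[K]_(alpha v)) := linfun (mulmx (X v)).
Let fE v c : f v c = X v *m c. Proof. by rewrite lfunE. Qed.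

Let f_inj v : (lker (f v) = 0)%VS.
Proof.
have [L LX] := XZ.1 v; apply/eqP; rewrite -subv0; apply/subvP => c.
rewrite memv_ker fE memv0 => /eqP Xc.
by rewrite -[c]mul1mx -LX -mulmxA Xc mulmx0.
Qed.

Let image (W : forall v, {vspace 'cV[K]_(b v)}) v := (f v @: W v)%VS.

Let subdim_image W : subdim (image W) = subdim W.
Proof. by apply/funext => v; rewrite /subdim limg_dim_eq // f_inj capv0. Qed.

Let subrep_image W : subrep Z W -> subrep V (image W).
Proof.
move=> sW a u /memv_imgP[c cW ->]; rewrite fE mulmxA XZ.2 -mulmxA -fE.
by apply: memv_img; exact: sW.
Qed.

Let image_le W : fam_le (image W) (fun v => colspace (X v)).
Proof. by move=> v; apply: limgS; exact: subvf. Qed.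

Let preimage U : subrep V U -> fam_le U (fun v => colspace (X v)) ->
  exists2 W, subrep Z W & image W = U.
Proof.
move=> sU UX; exists (fun v => f v @^-1: U v)%VS.
  move=> a u; rewrite -!memv_preim !fE => uU.
  by rewrite mulmxA -XZ.2 -mulmxA; exact: sU.
apply/functional_extensionality_dep => v; apply/vspaceP => u.
apply/memv_imgP/idP => [[c]|uU]; first by rewrite -memv_preim => ? ->.
have /colspaceP[c uE] := subvP (UX v) u uU.
by exists c; rewrite ?fE // -memv_preim fE -uE.
Qed.

(** Subrepresentations of Z are the subrepresentations of V below the image of
    X. *)
Lemma lsimple_stable :
  lsimple sigma V (fun v => colspace (X v)) <-> stable sigma Z.
Proof.
have [sX dX] := mxsubrep_colspace XZ.
split=> [[_ wX sim]|[w0 stZ]].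
  split; first by move: wX; rewrite /wt dX.
  move=> W sW W0 W1; have := sim _ (subrep_image sW) (@image_le W).
  rewrite /wt subdim_image => -[E|E|//].
    case: W0 => v; rewrite -subdim_image E; exact: dimv0.
  by case: W1 => v; rewrite -subdim_image E dX.
split=> // [|U sU UX]; first by rewrite /wt dX.
have [W sW WU] := preimage sU UX.
have [E|H0] := pselect (subdim W =1 (fun=> 0%N)).
  constructor 1; apply: fam_eq => v; apply/eqP; rewrite -dimv_eq0 -WU.
  by rewrite -[X in X == _]/(subdim (image W) v) subdim_image E.
have [E|H1] := pselect (subdim W =1 b).
  constructor 2; apply: fam_eq => v; apply/eqP; rewrite eqEdim UX /=.
  rewrite -[X in (X <= _)%N]/(subdim (fun v => colspace (X v)) v) dX.
  by rewrite -WU -[X in (_ <= X)%N]/(subdim (image W) v) subdim_image E.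
by constructor 3; rewrite -WU /wt subdim_image; exact: stZ.
Qed.

End OneSubrepresentation.

(** The summands are simple and independent, so they can be added one by one by
    lpolystable_add. *)
Lemma polystable_lattice : polystable sigma V -> lpolystable sigma V (@famT Q K alpha).
Proof.
move=> [m [beta [S [stS [g [h [hg gh gV]]]]]]].
pose E j v := incl K (fun j => beta j v) j.
pose X j v := h v *m E j v.
pose L j v := (E j v)^T *m g v.
have LX j v : L j v *m X j v = 1%:M.
  by rewrite /L /X mulmxA -(mulmxA _ (g v)) gh mulmx1 incl_id.
have LX0 i j v : i != j -> L i v *m X j v = 0.
  by move=> ij; rewrite /L /X mulmxA -(mulmxA _ (g v)) gh mulmx1 incl_orth.
have Vh a : V a *m h (src a) = h (tgt a) *m direct_sum S a.
  rewrite -[direct_sum S a]mulmx1 -gh (mulmxA (direct_sum S a)) -gV.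
  by rewrite !mulmxA hg mul1mx.
have XS j : mxsubrep V (X j) (S j).
  split=> [v|a]; first by exists (L j v).
  rewrite /X mulmxA Vh -!mulmxA; congr (_ *m _).
  rewrite direct_sumE mulmx_suml; apply: etrans (sum_single (j := j) _) _.
    by move=> i ij; rewrite -mulmxA incl_orth ?mulmx0.
  by rewrite -mulmxA incl_id mulmx1.
pose SJ j v := colspace (X j v).
have simS j : lsimple sigma V (SJ j) := (lsimple_stable (XS j)).2 (stS j).
have kill i (s : seq 'I_m) v u : i \notin s ->
    u \in (\sum_(j <- s) SJ j v)%VS -> L i v *m u = 0.
  elim: s u => [|j s IHs] u.
    by rewrite big_nil memv0 => _ /eqP ->; rewrite mulmx0.
  rewrite inE negb_or big_cons => /andP[ij /IHs{}IHs].
  move=> /memv_addP[x /colspaceP[c ->] [y /IHs yK ->]].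
  by rewrite mulmxDr yK addr0 mulmxA LX0 // mul0mx.
have poly_s (s : seq 'I_m) : uniq s ->
    lpolystable sigma V (fun v => \sum_(j <- s) SJ j v)%VS.
  elim: s => [_|j s IHs /= /andP[js us]].
    rewrite (_ : (fun v => _) = @fam0 Q K alpha); first exact: lpolystable0.
    by apply: fam_eq => v; rewrite big_nil.
  rewrite (_ : (fun v => _) = fam_add (fun v => \sum_(j <- s) SJ j v)%VS (SJ j)).
    apply: lpolystable_add => //; first exact: IHs.
    apply: fam_eq => v; apply/eqP; rewrite -subv0; apply/subvP => u.
    rewrite memv_cap memv0 => /andP[us' /colspaceP[c uE]].
    have := kill j s v u js us'.
    by rewrite uE mulmxA LX mul1mx => ->; rewrite mulmx0.
  by apply: fam_eq => v; rewrite big_cons /fam_add addvC.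
rewrite (_ : @famT Q K alpha = fun v => \sum_(j <- index_enum 'I_m) SJ j v)%VS.
  exact/poly_s/index_enum_uniq.
apply: fam_eq => v; apply/eqP; rewrite eqEsubv subvf andbT.
apply/subvP => u _; rewrite -[u]mul1mx -hg -[h v]mulmx1 -sum_incl.
rewrite mulmx_sumr !mulmx_suml; apply: memv_suml => j _.
apply: (subvP (sumv_sup j _ _)) => //.
by apply/colspaceP; exists ((E j v)^T *m g v *m u); rewrite !mulmxA.
Qed.

(** The bases of the simple summands together form the base change. *)
Lemma lattice_polystable : lpolystable sigma V (@famT Q K alpha) -> polystable sigma V.
Proof.
move=> /lpolystable_decomposition[m [S [simS sumS dimS]]].
have sS j : subrep V (S j) by case: (simS j).
pose Z j := sval (cid (subrep_basismx (sS j))).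
have ZP j : mxsubrep V (fun v => basismx (S j v)) (Z j) by rewrite /Z; case: cid.
exists m, (fun j => subdim (S j)), Z; split.
  move=> j; apply: (lsimple_stable (ZP j)).1.
  rewrite (_ : (fun v => _) = S j) //; apply: fam_eq => v.
  exact: colspace_basismx.
pose E j v := incl K (fun j => subdim (S j) v) j.
pose H v := \sum_j basismx (S j v) *m (E j v)^T.
have HE j v : H v *m E j v = basismx (S j v).
  rewrite mulmx_suml; apply: etrans (sum_single (j := j) _) _.
    by move=> i ij; rewrite -mulmxA incl_orth ?mulmx0.
  by rewrite -mulmxA incl_id mulmx1.
have invH v : exists G, H v *m G = 1%:M /\ G *m H v = 1%:M.
  apply: mx_right_inverse; first by rewrite -[LHS](@dim_colv K) [LHS]dimS.
  move=> u; have : u \in (\sum_j S j v)%VS by rewrite -sumS memvf.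
  move=> /memv_sumP[w wS ->].
  have wE j : exists c, basismx (S j v) *m c = w j.
    by have /basismxP[c ->] := wS j isT; exists c.
  pose c j := sval (cid (wE j)).
  have cE j : basismx (S j v) *m c j = w j by rewrite /c; case: cid.
  exists (\sum_j E j v *m c j); rewrite mulmx_sumr; apply: eq_bigr => j _.
  by rewrite mulmxA HE cE.
pose G v := sval (cid (invH v)).
have HG v : H v *m G v = 1%:M by rewrite /G; case: cid => ? [].
have GH v : G v *m H v = 1%:M by rewrite /G; case: cid => ? [].
have VH a : V a *m H (src a) = H (tgt a) *m direct_sum Z a.
  rewrite direct_sumE mulmx_sumr /H mulmx_sumr; apply: eq_bigr => j _.
  by rewrite !mulmxA HE (ZP j).2.
exists G, H; split=> // a.
by rewrite -[V a]mulmx1 -HG (mulmxA (V a)) VH !mulmxA GH mul1mx.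
Qed.

Lemma polystableP : polystable sigma V <-> mxpolystable sigma V.
Proof.
rewrite -lpolystableP; split; [exact: polystable_lattice | exact: lattice_polystable].
Qed.

End PolystableDecomposition.

(** * Transfer of generic conditions between fields *)

Section Transfer.
Variables (K L : numFieldType) (phi : {rmorphism K -> L}).

Definition map_fam (I : finType) (m n : I -> nat) (B : mxfam K m n) : mxfam L m n :=
  fun a => map_mx phi (B a).

Lemma coords_map_fam (I : finType) (m n : I -> nat) (B : mxfam K m n) :
  coords (map_fam B) = fun j => phi (coords B j).
Proof. by apply/funext => -[a [r c]]; rewrite /= mxE. Qed.

Lemma polyfun_extend (I : finType) (F : (I -> K) -> K) : polyfun F ->
  exists FL : (I -> L) -> L,
    polyfun FL /\ forall x, FL (fun i => phi (x i)) = phi (F x).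
Proof.
move=> [P HP].
exists (fun z => \sum_(m <- msupp P) phi (mcoeff m P) * \prod_i z (enum_val i) ^+ m i).
split.
  apply: polyfun_sum => m; apply: polyfunM; first exact: polyfun_cst.
  by apply: polyfun_prod => i; apply: polyfunX; exact: polyfun_coord.
move=> x; rewrite HP mevalE rmorph_sum; apply: eq_bigr => m _.
rewrite rmorphM rmorph_prod; congr (_ * _).
by apply: eq_bigr => i _; rewrite rmorphXn.
Qed.

(** Generic conditions over a field and over an extension meet at a tuple with
    natural entries. *)
Lemma generic_common_extension (I : finType) (m n : I -> nat)
    (P : set (mxfam K m n)) (P' : set (mxfam L m n)) :
  generic P -> generic P' -> exists2 B, P B & P' (map_fam B).
Proof.
move=> /genericP[F [pF [B FB] FP]] /genericP[G [pG [C GC] GP]].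
have [FL [pFL FLE]] := polyfun_extend pF.
have FLB : FL (fun j => phi (coords B j)) != 0 by rewrite FLE fmorph_eq0.
have [z Fz Gz] := polyfun_common_point pFL pG FLB GC.
have [x] := polyfun_nat_point (polyfunM pFL pG) (mulf_neq0 Fz Gz).
rewrite mulf_eq0 negb_or => /andP[Fx Gx].
have xE : (fun j => (x j)%:R) = (fun j => phi (x j)%:R).
  by apply/funext => j; rewrite rmorph_nat.
exists (of_coords (fun j => (x j)%:R)).
  by apply: FP; rewrite of_coordsK -(fmorph_eq0 phi) -FLE -xE.
by apply: GP; rewrite coords_map_fam of_coordsK -xE.
Qed.

End Transfer.

Section RealPoints.
Variable R : realType.
Local Notation toC := (real_complex R).

(** A complex polynomial that does not vanish identically has a nonvanishing
    real or imaginary part, which is a real polynomial on real points. *)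
Lemma generic_real_points (I : finType) (m n : I -> nat)
    (P : set (mxfam R m n)) (P' : set (mxfam R[i] m n)) :
  generic P' -> (forall B, P' (map_fam toC B) -> P B) -> generic P.
Proof.
move=> /genericP[F [pF [C FC] FP]] PP'.
have [x Fx] := polyfun_nat_point pF FC.
have [Q HQ] := pF.
have part (re : {additive R[i] -> R}) : (forall (c : R[i]) (r : R), re (c * toC r) = re c * r) ->
    exists G : (mxfam_index m n -> R) -> R, polyfun G /\
      forall y, G y = re (F (fun j => toC (y j))).
  move=> reM.
  exists (fun y => \sum_(l <- msupp Q) re (mcoeff l Q) * \prod_i y (enum_val i) ^+ l i).
  split.
    apply: polyfun_sum => l; apply: polyfunM; first exact: polyfun_cst.
    by apply: polyfun_prod => i; apply: polyfunX; exact: polyfun_coord.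
  move=> y; rewrite HQ mevalE raddf_sum; apply: eq_bigr => l _.
  rewrite -reM rmorph_prod; congr (re (_ * _)).
  by apply: eq_bigr => i _; rewrite rmorphXn.
have conclude (re : {additive R[i] -> R}) : (forall (c : R[i]) (r : R), re (c * toC r) = re c * r) ->
    re (F (fun j => (x j)%:R)) != 0 -> generic P.
  move=> /part[G [pG GE]] G0; apply/genericP; exists G; split=> //.
    exists (of_coords (fun j => (x j)%:R)); rewrite of_coordsK GE.
    by rewrite (_ : (fun j => _) = (fun j => (x j)%:R)) //; apply/funext => j; rewrite rmorph_nat.
  move=> B; rewrite GE => GB; apply: PP'; apply: FP; rewrite coords_map_fam.
  by apply: contra_neq GB => ->; rewrite raddf0.
have [re0|] := eqVneq (complex.Re (F (fun j => (x j)%:R))) 0; last first.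
  by apply: (conclude (@complex.Re R)) => -[a b] r /=; rewrite mulr0 subr0.
have [im0|] := eqVneq (complex.Im (F (fun j => (x j)%:R))) 0; last first.
  by apply: (conclude (@complex.Im R)) => -[a b] r /=; rewrite mulr0 add0r.
by case/eqP: Fx; apply/eqP; rewrite eq_complex re0 im0 !eqxx.
Qed.

End RealPoints.

(** * Star quivers: representations with a given subrepresentation *)

Section StarData.
Variables (K : fieldType) (k p : nat) (q : 'I_k -> nat).
Variable V : forall i, 'M[K]_(p, q i).

(** Subrepresentations for the star quiver, with the sink and the sources
    separated. *)
Definition ssubmx (b : nat) (c : 'I_k -> nat) (X : 'M[K]_(p, b))
    (Y : forall i, 'M[K]_(q i, c i)) (Z : forall i, 'M[K]_(b, c i)) : Prop :=
  [/\ exists L, L *m X = 1%:M, forall i, exists L, L *m Y i = 1%:M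
    & forall i, V i *m Y i = X *m Z i].

Definition ssub b c : Prop := exists X Y Z, @ssubmx b c X Y Z.

End StarData.

(** Stability for the weight with values -n at the sink and m at the sources.
    The weight is kept apart from the dimension vector because the stable
    summands of a representation are stable for the weight of the whole. *)
Definition sstable (K : fieldType) k (n m : nat) (p : nat) (q : 'I_k -> nat)
    (V : forall i, 'M[K]_(p, q i)) : Prop := forall b c, ssub V b c ->
  [\/ b = 0%N /\ (forall i, c i = 0%N), b = p /\ (forall i, c i = q i)
    | (m * \sum_i c i < n * b)%N].

Lemma sub_at_ssub (K : fieldType) k (beta : dimvec (star_quiver k)) (V : rep K beta) b :
  sub_at V b <->
  ssub (V : forall i, 'M[K]_(beta None, beta (Some i))) (b None) (fun i => b (Some i)).
Proof.
split=> [[X [Z [LX VX]]]|[X [Y [Z [LX LY VY]]]]].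
  exists (X None), (fun i => X (Some i)), Z; split=> [|i|i].
  - exact: LX.
  - exact: LX.
  - exact: VX.
exists (fun v => match v return 'M[K]_(beta v, b v) with
   | None => X | Some i => Y i end), Z; split=> [[i|]|i].
- exact: LY.
- exact: LX.
- exact: VY.
Qed.

Section StarSubrepresentations.
Variables (k p : nat) (q : 'I_k -> nat) (b : dimvec (star_quiver k)).
Local Notation alpha := (star_dim p q).
Local Notation bx := (b None).
Local Notation by_ := (fun i => b (Some i)).

Section Parametrization.
Variable K : fieldType.

(* Parameters: base changes at the sink and at the sources, and the maps. *)
Definition star_par : finType :=
  ('I_p * 'I_p + (mxfam_index q q + mxfam_index (fun=> p) q))%type.

Definition par_g (z : star_par -> K) : 'M[K]_p := \matrix_(r, c) z (inl (r, c)).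
Definition par_h (z : star_par -> K) : mxfam K q q :=
  of_coords (fun j => z (inr (inl j))).
Definition par_T (z : star_par -> K) : mxfam K (fun=> p) q :=
  of_coords (fun j => z (inr (inr j))).

(** The middle factor maps the span of the first basis vectors at y_i into the
    span of the first basis vectors at x, so that every representation in the
    family has a subrepresentation of dimension vector b. *)
Definition star_param (z : star_par -> K) : mxfam K (fun=> p) q :=
  fun i => par_g z *m (par_T z i - copid_mx bx *m par_T z i *m pid_mx (by_ i))
           *m par_h z i.

Definition par_det (z : star_par -> K) : K :=
  \det (par_g z) * \prod_i \det (par_h z i).

(** A basis of a subspace extends to a basis of the whole space. *)
Lemma complete_to_unit a c (X : 'M[K]_(a, c)) L :
  L *m X = 1%:M -> (c <= a)%N /\ exists2 g, g \in unitmx & g *m pid_mx c = X.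
Proof.
move=> LX; have rX : \rank X = c.
  apply/eqP; rewrite eqn_leq rank_leq_col /=.
  by rewrite -{1}(mxrank1 K c) -LX mxrankM_maxr.
have ca : (c <= a)%N by rewrite -rX rank_leq_row.
split=> //; pose U : 'M[K]_(c, a) := pid_mx c; pose f : 'M[K]_a := U^T *m X^T.
have Uf : U *m f = X^T.
  by rewrite mulmxA tr_pid_mx mul_pid_mx minnn (minn_idPr ca) pid_mx_1 mul1mx.
have [|g gu Ug] := @complete_unitmx _ _ _ U f.
  by rewrite Uf mxrank_tr rX rank_pid_mx.
exists g^T; first by rewrite unitmx_tr.
by apply: trmx_inj; rewrite trmx_mul trmxK tr_pid_mx -Ug Uf.
Qed.

Lemma copid_block a c d e (W : 'M[K]_(a, c)) (Y : 'M[K]_(d, e)) : (d <= a)%N ->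
  W *m pid_mx e = pid_mx d *m Y -> copid_mx d *m W *m (pid_mx e : 'M_c) = 0.
Proof.
move=> da WY.
have -> : (pid_mx e : 'M[K]_c) = (pid_mx e : 'M_(c, e)) *m (pid_mx e : 'M_(e, c)).
  by rewrite mul_pid_mx minnn (minn_idPl (leqnn _)).
rewrite mulmxA -(mulmxA _ W) WY /copid_mx mulmxA mulmxBl mul1mx mul_pid_mx.
by rewrite minnn (minn_idPr da) subrr !mul0mx.
Qed.

(** In bases adapted to the subrepresentation, the lower left block of each map
    vanishes. *)
Lemma star_param_surj (V : mxfam K (fun=> p) q) : ssub V bx by_ ->
  exists z, par_det z != 0 /\ star_param z = V.
Proof.
move=> [X [Y [Z [[L0 L0X] LY VX]]]]; have [bxp [g gu gE]] := complete_to_unit L0X.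
have hP i : exists h : 'M[K]_(q i),
    [/\ h \in unitmx, h *m pid_mx (by_ i) = Y i & (by_ i <= q i)%N].
  by have [L1 L1X] := LY i; have [? [h hu hE]] := complete_to_unit L1X; exists h.
pose h i := sval (cid (hP i)).
have hu i : h i \in unitmx by rewrite /h; case: cid => ? [].
have hE i : h i *m pid_mx (by_ i) = Y i by rewrite /h; case: cid => ? [].
have bq i : (by_ i <= q i)%N by case: (hP i) => ? [].
pose T i := (invmx g : 'M[K]_p) *m V i *m h i.
pose z (j : star_par) : K := match j with
  | inl (r, c) => g r c
  | inr (inl j) => coords (fun i => invmx (h i)) j
  | inr (inr j) => coords T j end.
have zg : par_g z = g by apply/matrixP => r c; rewrite mxE.
have zh i : par_h z i = invmx (h i).
  by rewrite -[X in _ = X]/((fun i => invmx (h i)) i) -[fun i => invmx _]coordsK.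
have zT i : par_T z i = T i by rewrite -[T in RHS]coordsK.
exists z; split.
  rewrite /par_det zg mulf_neq0 //; first by rewrite -unitfE -unitmxE.
  by apply/prodf_neq0 => i _; rewrite zh -unitfE -unitmxE unitmx_inv.
apply/functional_extensionality_dep => i; rewrite /star_param zg zh zT.
have -> : copid_mx bx *m T i *m (pid_mx (by_ i) : 'M_(q i)) = 0.
  apply: (@copid_block p (q i) bx (by_ i) (T i) (Z i) bxp).
  rewrite /T -mulmxA hE -mulmxA VX mulmxA -gE.
  by rewrite (mulmxA (invmx g)) mulVmx // mul1mx.
by rewrite subr0 /T !mulmxA mulmxV // mul1mx mulmxK.
Qed.

Lemma star_param_sub (z : star_par -> K) : (bx <= p)%N -> (forall i, by_ i <= q i)%N ->
  par_det z != 0 -> ssub (star_param z) bx by_.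
Proof.
move=> bxp bq; rewrite mulf_eq0 negb_or => /andP[dg /prodf_neq0 dh].
have gu : par_g z \in unitmx by rewrite unitmxE unitfE.
have hu i : par_h z i \in unitmx by rewrite unitmxE unitfE dh.
pose T i := par_T z i - copid_mx bx *m par_T z i *m pid_mx (by_ i).
exists (par_g z *m (pid_mx bx : 'M_(p, bx))).
exists (fun i => (invmx (par_h z i) : 'M[K]_(q i)) *m (pid_mx (by_ i) : 'M_(q i, by_ i))).
exists (fun i : 'I_k => (pid_mx bx : 'M_(bx, p)) *m T i *m (pid_mx (by_ i) : 'M_(q i, by_ i))).
split.
- exists ((pid_mx bx : 'M_(bx, p)) *m invmx (par_g z)).
  rewrite mulmxA -(mulmxA _ (invmx _)) mulVmx // mulmx1 mul_pid_mx minnn.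
  by rewrite (minn_idPr bxp) pid_mx_1.
- move=> i; exists ((pid_mx (by_ i) : 'M_(by_ i, q i)) *m par_h z i).
  rewrite mulmxA -(mulmxA _ (par_h z i)) mulmxV // mulmx1 mul_pid_mx minnn.
  by rewrite (minn_idPr (bq i)) pid_mx_1.
move=> i /=; rewrite /star_param -/(T i) !mulmxA mulmxK // -!mulmxA; congr (_ *m _).
rewrite [RHS]mulmxA mul_pid_mx minnn (minn_idPl (leqnn _)).
have -> : (pid_mx bx : 'M[K]_p) = 1%:M - copid_mx bx by rewrite opprB addrC subrK.
rewrite [RHS]mulmxBl mul1mx [X in _ - X](_ : _ = 0) ?subr0 //.
have -> : T i *m pid_mx (by_ i)
    = par_T z i *m pid_mx (by_ i) - copid_mx bx *m (par_T z i *m (pid_mx (by_ i) : 'M_(q i, by_ i))).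
  rewrite [LHS]mulmxBl; congr (_ - _).
  by rewrite -[LHS]mulmxA mul_pid_mx minnn (minn_idPr (bq i)) mulmxA.
by rewrite [LHS]mulmxBr [X in _ - X]mulmxA copid_mx_id // subrr.
Qed.

End Parametrization.

Variables (K L : numFieldType) (phi : {rmorphism K -> L}).

Lemma star_param_map z :
  star_param (fun j => phi (z j)) = map_fam phi (star_param z).
Proof.
have gE : par_g (fun j => phi (z j)) = map_mx phi (par_g z).
  by apply/matrixP => r c; rewrite !mxE.
have hE i : par_h (fun j => phi (z j)) i = map_mx phi (par_h z i).
  by apply/matrixP => r c; rewrite !mxE.
have TE i : par_T (fun j => phi (z j)) i = map_mx phi (par_T z i).
  by apply/matrixP => r c; rewrite !mxE.
apply/functional_extensionality_dep => i.
rewrite /star_param /map_fam !map_mxM map_mxB !map_mxM gE hE TE.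
by rewrite /copid_mx !map_mxB map_mx1 !map_pid_mx.
Qed.

Lemma par_det_map z : par_det (fun j => phi (z j)) = phi (par_det z).
Proof.
rewrite /par_det rmorphM rmorph_prod -det_map_mx; congr (\det _ * _).
  by apply/matrixP => r c; rewrite !mxE.
apply: eq_bigr => i _; rewrite -det_map_mx; congr (\det _).
by apply/matrixP => r c; rewrite !mxE.
Qed.

(** Representations with a subrepresentation of dimension vector b are
    parametrized by star_param, which has rational coefficients. If FL were
    nonzero at one of them over L, then FL composed with the parametrization,
    times par_det, would be nonzero at a parameter with natural coordinates,
    which gives such a representation over K. *)
Lemma no_sub_extension (F : (mxfam_index (fun=> p) q -> K) -> K)
    (FL : (mxfam_index (fun=> p) q -> L) -> L) :
  polyfun FL -> (forall x, FL (fun j => phi (x j)) = phi (F x)) ->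
  (forall B : rep K alpha, F (coords B) != 0 -> ~ sub_at B b) ->
  forall V : rep L alpha, FL (coords V) != 0 -> ~ sub_at V b.
Proof.
move=> pFL FLE noK V FV /sub_at_ssub subV.
have [bxp bq] : (bx <= p)%N /\ forall i, (by_ i <= q i)%N.
  have [X [Y [Z [[L0 /complete_to_unit[? _]] LY _]]]] := subV; split=> // i.
  by have [L1 /complete_to_unit[]] := LY i.
have [z [dz zV]] := star_param_surj subV.
pose G z' := par_det z' * FL (coords (star_param z')).
have pg r c : polyfun (fun z' : star_par -> L => par_g z' r c).
  by apply: polyfun_eq (polyfun_coord L (inl (r, c) : star_par)) => z'; rewrite mxE.
have ph i r c : polyfun (fun z' : star_par -> L => par_h z' i r c).
  apply: polyfun_eq (polyfun_coord L (inr (inl (existT _ i (r, c))) : star_par)) => z'.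
  by rewrite mxE.
have pT i r c : polyfun (fun z' : star_par -> L => par_T z' i r c).
  apply: polyfun_eq (polyfun_coord L (inr (inr (existT _ i (r, c))) : star_par)) => z'.
  by rewrite mxE.
have pG : polyfun G.
  apply: polyfunM.
    apply: polyfunM; first exact: polyfun_det.
    by apply: polyfun_prod => i; exact: polyfun_det.
  apply: (polyfun_comp (G := fun z' => coords (star_param z')) pFL) => -[i [r c]] /=.
  apply: polyfun_mulmx => // {}r {}c; apply: polyfun_mulmx => // {}r {}c.
  have H : polyfun (fun z' : star_par -> L =>
      par_T z' i r c - (copid_mx bx *m par_T z' i *m pid_mx (by_ i)) r c).
    apply: polyfunD => //; apply: polyfunN.
    apply: polyfun_mulmx => *; last exact: polyfun_cst.
    by apply: polyfun_mulmx => // *; exact: polyfun_cst.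
  by apply: polyfun_eq H => z'; rewrite !mxE.
have [|x] := polyfun_nat_point (z := z) pG; first by rewrite /G zV mulf_neq0.
have -> : (fun j => (x j)%:R) = (fun j => phi (x j)%:R).
  by apply/funext => j; rewrite rmorph_nat.
rewrite /G star_param_map par_det_map coords_map_fam FLE -rmorphM fmorph_eq0.
rewrite mulf_eq0 negb_or => /andP[dx /noK]; apply.
by apply/sub_at_ssub/star_param_sub.
Qed.

End StarSubrepresentations.

(** * Polystability is generically true or generically false *)

Section PolystableDichotomy.
Variables (K : numClosedFieldType) (Q : quiver) (sigma : weight Q) (alpha : dimvec Q).

Section FixedDimension.
Variable b : dimvec Q.

Local Notation IV := (mxfam_index (fun a : arrow Q => alpha (tgt a)) (fun a => alpha (src a))).
Local Notation IX := (mxfam_index alpha b).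
Local Notation IL := (mxfam_index b alpha).
Local Notation IZ := (mxfam_index (fun a : arrow Q => b (tgt a)) (fun a => b (src a))).

Lemma polyfun_of_coords (J I : finType) (m n : I -> nat) (f : mxfam_index m n -> J)
    (a : I) r c :
  polyfun (fun z : J -> K => of_coords (fun j => z (f j)) a r c).
Proof.
by apply: polyfun_eq (polyfun_coord K (f (existT _ a (r, c)))) => z; rewrite mxE.
Qed.

(* Equations for a subrepresentation X with left inverse L and restricted
   maps Z. *)
Let sub_eq (e : mxfam_index b b + mxfam_index (fun a : arrow Q => alpha (tgt a)) (fun a => b (src a)))
    (z : IV + (IX + IL + IZ) -> K) : K :=
  let V : rep K alpha := of_coords (fun j => z (inl j)) in
  let X : mxfam K alpha b := of_coords (fun j => z (inr (inl (inl j)))) in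
  let L : mxfam K b alpha := of_coords (fun j => z (inr (inl (inr j)))) in
  let Z : rep K b := of_coords (fun j => z (inr (inr j))) in
  match e with
  | inl (existT v (r, c)) => (L v *m X v) r c + (- (1%:M : 'M[K]_(b v)) r c)
  | inr (existT a (r, c)) =>
      (V a *m X (src a)) r c + (- (X (tgt a) *m Z a) r c)
  end.

(* Equations for a retraction P onto that subrepresentation. *)
Let retract_eq (e : mxfam_index b b + mxfam_index (fun a : arrow Q => b (tgt a)) (fun a => alpha (src a)))
    (z : (IV + (IX + IL + IZ)) + IL -> K) : K :=
  let V : rep K alpha := of_coords (fun j => z (inl (inl j))) in
  let X : mxfam K alpha b := of_coords (fun j => z (inl (inr (inl (inl j))))) in
  let Z : rep K b := of_coords (fun j => z (inl (inr (inr j)))) in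
  let P : mxfam K b alpha := of_coords (fun j => z (inr j)) in
  match e with
  | inl (existT v (r, c)) => (P v *m X v) r c + (- (1%:M : 'M[K]_(b v)) r c)
  | inr (existT a (r, c)) =>
      (P (tgt a) *m V a) r c + (- (Z a *m P (src a)) r c)
  end.

Let sub_eqP (V : rep K alpha) (X : mxfam K alpha b) (L : mxfam K b alpha) (Z : rep K b) z :
  z = splice (coords V) (splice (splice (coords X) (coords L)) (coords Z)) ->
  (forall e, sub_eq e z = 0) <->
  (forall v, L v *m X v = 1%:M) /\ (forall a, V a *m X (src a) = X (tgt a) *m Z a).
Proof.
move=> zE; have E e : sub_eq e z = match e with
  | inl (existT v (r, c)) => (L v *m X v) r c - (1%:M : 'M[K]_(b v)) r c
  | inr (existT a (r, c)) => (V a *m X (src a)) r c - (X (tgt a) *m Z a) r c end.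
  rewrite /sub_eq zE -[X in RHS]coordsK -[L in RHS]coordsK -[Z in RHS]coordsK -[V in RHS]coordsK.
  by case: e => -[a [r c]].
split=> [H|[HL HV] e].
  split=> [v|a]; apply/matrixP => r c; apply/eqP; rewrite -subr_eq0.
    by have := H (inl (existT _ v (r, c))); rewrite E => ->.
  by have := H (inr (existT _ a (r, c))); rewrite E => ->.
by rewrite E; case: e => -[a [r c]]; rewrite ?HL ?HV subrr.
Qed.

Let retract_eqP (V : rep K alpha) (X : mxfam K alpha b) (L P : mxfam K b alpha) (Z : rep K b) z :
  z = splice (splice (coords V) (splice (splice (coords X) (coords L)) (coords Z))) (coords P) ->
  (forall e, retract_eq e z = 0) <->
  (forall v, P v *m X v = 1%:M) /\ (forall a, P (tgt a) *m V a = Z a *m P (src a)).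
Proof.
move=> zE; have E e : retract_eq e z = match e with
  | inl (existT v (r, c)) => (P v *m X v) r c - (1%:M : 'M[K]_(b v)) r c
  | inr (existT a (r, c)) => (P (tgt a) *m V a) r c - (Z a *m P (src a)) r c end.
  rewrite /retract_eq zE -[X in RHS]coordsK -[P in RHS]coordsK -[Z in RHS]coordsK -[V in RHS]coordsK.
  by case: e => -[a [r c]].
split=> [H|[HL HV] e].
  split=> [v|a]; apply/matrixP => r c; apply/eqP; rewrite -subr_eq0.
    by have := H (inl (existT _ v (r, c))); rewrite E => ->.
  by have := H (inr (existT _ a (r, c))); rewrite E => ->.
by rewrite E; case: e => -[a [r c]]; rewrite ?HL ?HV subrr.
Qed.

Let sub_eq_poly e : polyfun (sub_eq e).
Proof.
case: e => -[a [r c]] /=; apply: polyfunD.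
- by apply: polyfun_mulmx => *; exact: polyfun_of_coords.
- exact: polyfun_cst.
- by apply: polyfun_mulmx => *; exact: polyfun_of_coords.
- by apply: polyfunN; apply: polyfun_mulmx => *; exact: polyfun_of_coords.
Qed.

Let retract_eq_poly e : polyfun (retract_eq e).
Proof.
case: e => -[a [r c]] /=; apply: polyfunD.
- by apply: polyfun_mulmx => *; exact: polyfun_of_coords.
- exact: polyfun_cst.
- by apply: polyfun_mulmx => *; exact: polyfun_of_coords.
- by apply: polyfunN; apply: polyfun_mulmx => *; exact: polyfun_of_coords.
Qed.

(** The part of polystability that concerns subrepresentations of dimension
    vector b; finitely many b occur. *)
Definition polystable_at (V : rep K alpha) : Prop :=
  (sub_at V b -> weight_pairing sigma b <= 0) /\
  (forall X Z, @mxsubrep _ _ _ V b X Z -> weight_pairing sigma b = 0 -> mxretract V X Z).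

Lemma generic_constP (P : set (rep K alpha)) (F : (IV -> K) -> K) :
  polyfun F -> (exists z, F z != 0) ->
  ((forall z, F z != 0 -> P (of_coords z)) \/ (forall z, F z != 0 -> ~ P (of_coords z))) ->
  generic P \/ generic (~` P).
Proof.
move=> pF [z Fz] H.
have H2 (P' : set (rep K alpha)) : (forall z, F z != 0 -> P' (of_coords z)) -> generic P'.
  move=> H'; apply/genericP; exists F; split=> //.
    by exists (of_coords z); rewrite of_coordsK.
  by move=> B /H'; rewrite coordsK.
by case: H => H; [left | right]; exact: H2.
Qed.

(** For negative weight the condition is void. For positive weight it says that
    there is no subrepresentation, for weight zero that each has a retraction;
    both are conditions to which generic_dichotomy applies. *)
Lemma polystable_at_generic : generic polystable_at \/ generic (~` polystable_at).
Proof.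
have get (V : rep K alpha) X Z : @mxsubrep _ _ _ V b X Z -> exists L : mxfam K b alpha,
    forall e, sub_eq e (splice (coords V) (splice (splice (coords (X : mxfam K alpha b)) (coords L)) (coords Z))) = 0.
  move=> [LX VX]; exists (fun v => sval (cid (LX v))).
  apply/(@sub_eqP V X _ Z) => //; split=> // v; by case: cid.
have back (z : IV -> K) u : (forall e, sub_eq e (splice z u) = 0) ->
    let X : mxfam K alpha b := of_coords (fun j => u (inl (inl j))) in
    let L : mxfam K b alpha := of_coords (fun j => u (inl (inr j))) in
    let Z : rep K b := of_coords (fun j => u (inr j)) in
    u = splice (splice (coords X) (coords L)) (coords Z) /\
    mxsubrep (of_coords z : rep K alpha) X Z.
  move=> H X L Z.
  have uE : u = splice (splice (coords X) (coords L)) (coords Z).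
    by apply/funext => -[[j|j]|j] /=; rewrite of_coordsK.
  have E : splice z u = splice (coords (of_coords z))
      (splice (splice (coords X) (coords L)) (coords Z)) by rewrite of_coordsK -uE.
  split=> //; have [HL HV] := (@sub_eqP (of_coords z) X L Z _ E).1 H.
  by split=> // v; exists (L v).
have [wpos|wneg|w0] := ltrgt0P (weight_pairing sigma b).
  (* The equation 1 = 0 makes every subrepresentation a counterexample. *)
- pose E1 (_ : unit) (_ : (IV + (IX + IL + IZ)) + void -> K) : K := 1.
  have pE1 e : polyfun (E1 e) by exact: polyfun_cst.
  have [F [pF nF H]] := generic_dichotomy sub_eq_poly pE1.
  apply: (generic_constP pF nF); case: H => H; [left | right] => z /H.
    move=> Hz; split=> [[X [Z XZ]]|X Z _ E]; last by rewrite E ltxx in wpos.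
    have [L HL] := get _ _ _ XZ.
    have [w /(_ tt)/eqP] := Hz _ (fun e => etrans (congr1 (fun x => sub_eq e (splice x _)) (esym (of_coordsK z))) (HL e)).
    by rewrite oner_eq0.
  move=> Hz [H1 _]; apply: Hz => u /back[_ XZ].
  by have := H1 (ex_intro _ _ (ex_intro _ _ XZ)); rewrite leNgt wpos.
- left; apply/genericP; exists (fun=> 1); split; first exact: polyfun_cst.
    by exists (fun=> 0); rewrite oner_neq0.
  move=> B _; split=> [_|X Z _ E]; first exact: ltW.
  by rewrite E ltxx in wneg.
- have [F [pF nF H]] := generic_dichotomy sub_eq_poly retract_eq_poly.
  apply: (generic_constP pF nF); case: H => H; [left | right] => z /H.
    move=> Hz; split=> [_|X Z XZ _]; first by rewrite w0.
    have [L HL] := get _ _ _ XZ.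
    have [w Hw] := Hz _ (fun e => etrans (congr1 (fun x => sub_eq e (splice x _)) (esym (of_coordsK z))) (HL e)).
    exists (of_coords w : mxfam K b alpha).
    apply/(@retract_eqP (of_coords z) X L (of_coords w) Z); last exact: Hw.
    by rewrite !of_coordsK.
  move=> Hz [_ H1]; apply: Hz => u Hu; have /= [uE XZ] := back _ _ Hu.
  have [P PXZ] := H1 _ _ XZ w0; exists (coords (P : mxfam K b alpha)).
  apply/(@retract_eqP (of_coords z) _ (of_coords (fun j => u (inl (inr j)))) P _); last exact: PXZ.
  by rewrite [in LHS]uE [in RHS]of_coordsK.
Qed.

End FixedDimension.

Lemma mxpolystable_generic :
  generic [set V : rep K alpha | mxpolystable sigma V] \/
  generic [set V : rep K alpha | ~ mxpolystable sigma V].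
Proof.
have [w0|w0] := eqVneq (weight_pairing sigma alpha) 0; last first.
  by right; apply: generic_true => V [/eqP]; rewrite (negbTE w0).
pose dv (d : {dffun forall v, 'I_(alpha v).+1}) : dimvec Q := fun v => d v.
have all_s (s : seq {dffun forall v, 'I_(alpha v).+1}) :
    generic [set V | forall d, d \in s -> polystable_at (dv d) V] \/
    generic [set V | ~ forall d, d \in s -> polystable_at (dv d) V].
  elim: s => [|d s [IHs|IHs]]; first by left; apply: generic_true.
    have [H|H] := polystable_at_generic (dv d).
      left; apply: generic_sub (generic_and H IHs) => V [HV HVs] d'.
      by rewrite inE => /orP[/eqP ->//|/HVs].
    right; apply: generic_sub H => V nV HV; apply: nV; apply: HV.
    by rewrite inE eqxx.
  right; apply: generic_sub IHs => V nV HV; apply: nV => d' d's; apply: HV.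
  by rewrite inE d's orbT.
have polyE V : mxpolystable sigma V <->
    forall d, d \in enum {dffun forall v, 'I_(alpha v).+1} -> polystable_at (dv d) V.
  split=> [[_ H1 H2] d _|H].
    by split=> [/H1//|X Z]; exact: H2.
  have H' b X Z : @mxsubrep _ _ _ V b X Z -> polystable_at b V.
    move=> [LX _].
    have ba v : (b v < (alpha v).+1)%N.
      have [L LXv] := LX v; rewrite ltnS -{1}(mxrank1 K (b v)) -LXv.
      by apply: leq_trans (mxrankM_maxl _ _) _; exact: rank_leq_col.
    pose d : {dffun forall v, 'I_(alpha v).+1} := [ffun v => Ordinal (ba v)].
    have -> : b = dv d by apply/funext => v; rewrite /dv ffunE.
    by apply: H; rewrite mem_enum.
  split=> // [b [X [Z XZ]]|b X Z XZ]; first by have [H1 _] := H' _ _ _ XZ; apply: H1; exists X, Z.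
  by have [_] := H' _ _ _ XZ; apply.
have [H|H] := all_s (enum {dffun forall v, 'I_(alpha v).+1}); [left | right];
  by apply: generic_sub H => V; rewrite /= polyE.
Qed.

End PolystableDichotomy.

(** * Transport plans and the Hall condition *)

Section Transport.
Variables (A J : finType) (E : A -> J -> bool).

Definition nbhd (S : {set J}) : {set A} := [set a | [exists j in S, E a j]].

Definition hall (r : A -> nat) (m : J -> nat) : Prop :=
  forall S : {set J}, (\sum_(j in S) m j <= \sum_(a in nbhd S) r a)%N.

Lemma nbhdU (S T : {set J}) : nbhd (S :|: T) = nbhd S :|: nbhd T.
Proof.
apply/setP => a; rewrite !inE; apply/existsP/orP.
  move=> [j]; rewrite inE => /andP[/orP[jS|jT] aj]; [left|right]; apply/existsP;
  by exists j; rewrite ?jS ?jT.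
by move=> [] /existsP[j /andP[jS aj]]; exists j; rewrite inE jS ?orbT.
Qed.

Lemma nbhdS (S T : {set J}) : S \subset T -> nbhd S \subset nbhd T.
Proof. by move=> /finset.setUidPr <-; rewrite nbhdU finset.subsetUl. Qed.

Lemma sum_indicator (I : finType) (S T : {set I}) (f : I -> nat) :
  (\sum_(i in T) (if i \in S then f i else 0) = \sum_(i in T :&: S) f i)%N.
Proof.
by rewrite -big_mkcondr; apply: eq_bigl => i; rewrite inE.
Qed.

Lemma leq_sum_subset (I : finType) (S T : {set I}) (f : I -> nat) :
  S \subset T -> (\sum_(i in S) f i <= \sum_(i in T) f i)%N.
Proof.
by move=> ST; rewrite (big_setID S (A := T)) /= (finset.setIidPr ST) leq_addr.
Qed.

(** Supply-demand version of Hall's marriage theorem. If some set of columns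
    is tight and nontrivial, the problem splits along it; otherwise one unit
    may be sent along any edge between nonzero marginals. *)
Lemma hall_transport (r : A -> nat) (m : J -> nat) :
  hall r m -> (\sum_a r a = \sum_j m j)%N ->
  exists w : A -> J -> nat, [/\ forall a j, (0 < w a j)%N -> E a j,
    forall a, (\sum_j w a j = r a)%N & forall j, (\sum_a w a j = m j)%N].
Proof.
have [N] := ubnP (\sum_j m j)%N; elim: N r m => // N IHN r m; rewrite ltnS => mN Hrm tot.
have [m0|mpos] := posnP (\sum_j m j)%N.
  have mj j : m j = 0%N.
    by apply/eqP; rewrite -leqn0 -m0 (bigD1 j) //= leq_addr.
  have ra a : r a = 0%N.
    by apply/eqP; rewrite -leqn0 -m0 -tot (bigD1 a) //= leq_addr.
  by exists (fun _ _ => 0%N); split=> // [a|j]; rewrite big1 // ?ra ?mj.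
have [[S [S0 ST tight]]|strict] := pselect (exists S : {set J},
    [/\ (0 < \sum_(j in S) m j)%N, (\sum_(j in S) m j < \sum_j m j)%N
      & (\sum_(j in S) m j = \sum_(a in nbhd S) r a)%N]).
  pose m1 j := if j \in S then m j else 0%N.
  pose r1 a := if a \in nbhd S then r a else 0%N.
  pose m2 j := if j \in ~: S then m j else 0%N.
  pose r2 a := if a \in ~: nbhd S then r a else 0%N.
  have mE j : (m1 j + m2 j = m j)%N by rewrite /m1 /m2 finset.in_setC; case: (j \in S); rewrite ?addn0.
  have rE a : (r1 a + r2 a = r a)%N by rewrite /r1 /r2 finset.in_setC; case: (a \in nbhd S); rewrite ?addn0.
  have sumT (I : finType) (T : {set I}) f :
      (\sum_i (if i \in T then f i else 0) = \sum_(i in T) f i)%N by rewrite -big_mkcond.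
  have tot1 : (\sum_a r1 a = \sum_j m1 j)%N by rewrite !sumT.
  have tot2 : (\sum_a r2 a = \sum_j m2 j)%N.
    have rs : (\sum_a r a = \sum_a r1 a + \sum_a r2 a)%N.
      by rewrite -big_split; apply: eq_bigr => a _; rewrite -[LHS]rE.
    have ms : (\sum_j m j = \sum_j m1 j + \sum_j m2 j)%N.
      by rewrite -big_split; apply: eq_bigr => j _; rewrite -[LHS]mE.
    by move: tot; rewrite rs ms tot1 => /addnI.
  have H1 : hall r1 m1.
    move=> T; rewrite !sum_indicator; apply: leq_trans (Hrm _) _.
    by apply: leq_sum_subset; rewrite finset.subsetI !nbhdS ?finset.subsetIl ?finset.subsetIr.
  have H2 : hall r2 m2.
    move=> T; rewrite !sum_indicator -(leq_add2l (\sum_(j in S) m j)) {2}tight.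
    have := Hrm (T :|: S); rewrite nbhdU (big_setID S) [X in (_ <= X)%N](big_setID (nbhd S)) /=.
    by rewrite !(finset.setIidPr (finset.subsetUr _ _)) !finset.setDUl !finset.setDv !finset.setU0 !finset.setDE.
  have lt1 : (\sum_j m1 j < N)%N by rewrite sumT; exact: leq_trans mN.
  have lt2 : (\sum_j m2 j < N)%N.
    apply: leq_trans mN; rewrite (eq_bigr _ (fun j _ => esym (mE j))) big_split /=.
    by rewrite -[X in (X < _)%N]add0n ltn_add2r sumT.
  have [w1 [E1 R1 M1]] := IHN r1 m1 lt1 H1 tot1.
  have [w2 [E2 R2 M2]] := IHN r2 m2 lt2 H2 tot2.
  exists (fun a j => w1 a j + w2 a j)%N; split=> [a j|a|j].
  - by rewrite addn_gt0 => /orP[/E1|/E2].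
  - by rewrite big_split /= R1 R2.
  - by rewrite big_split /= M1 M2.
(* No tight set: every nontrivial Hall inequality has a unit to spare. *)
have [j0 mj0] : exists j, (0 < m j)%N.
  apply/existsP; apply: contraTT mpos; rewrite negb_exists => /forallP H.
  by rewrite lt0n negbK big1 // => j _; apply/eqP; rewrite -leqn0 leqNgt.
have [a0 Ea0 ra0] : exists2 a, E a j0 & (0 < r a)%N.
  have := Hrm (finset.set1 j0); rewrite big_set1 => /(leq_trans mj0) H.
  have /existsP[a /andP[aN ra]] : [exists a in nbhd (finset.set1 j0), (0 < r a)%N].
    apply: contraTT H; rewrite negb_exists => /forallP H.
    rewrite lt0n negbK big1 // => a aN; have := H a; rewrite aN /= => ra.
    by apply/eqP; rewrite -leqn0 leqNgt.
  exists a => //; move: aN; rewrite inE => /existsP[j].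
  by rewrite inE => /andP[/eqP ->].
pose m' j := (m j - (j == j0))%N; pose r' a := (r a - (a == a0))%N.
have mE j : (m' j + (j == j0) = m j)%N.
  by rewrite /m' subnK //; case: eqP => // ->.
have rE a : (r' a + (a == a0) = r a)%N.
  by rewrite /r' subnK //; case: eqP => // ->.
have sum1 (I : finType) (i0 : I) (T : {set I}) : (\sum_(i in T) (i == i0) = (i0 \in T))%N.
  case: (boolP (i0 \in T)) => iT.
    by rewrite (bigD1 i0) //= eqxx big1 // => i /andP[_ /negbTE ->].
  by rewrite big1 // => i ii; case: eqP => // ie; rewrite ie (negbTE iT) in ii.
have m'1 : (\sum_j m' j + 1 = \sum_j m j)%N.
  rewrite (bigD1 j0) //= [RHS](bigD1 j0) //= -(mE j0) eqxx addnAC.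
  by congr (_ + _)%N; apply: eq_bigr => j /negbTE jj; rewrite -[RHS]mE jj addn0.
have r'1 : (\sum_a r' a + 1 = \sum_a r a)%N.
  rewrite (bigD1 a0) //= [RHS](bigD1 a0) //= -(rE a0) eqxx addnAC.
  by congr (_ + _)%N; apply: eq_bigr => a /negbTE aa; rewrite -[RHS]rE aa addn0.
have [|||w [wE wR wM]] := IHN r' m'.
- by apply: leq_trans mN; rewrite -m'1 addn1.
- move=> T.
  have mT : (\sum_(j in T) m' j + (j0 \in T) = \sum_(j in T) m j)%N.
    by rewrite -sum1 -big_split; apply: eq_bigr => j _; exact: mE.
  have rT : (\sum_(a in nbhd T) r' a + (a0 \in nbhd T) = \sum_(a in nbhd T) r a)%N.
    by rewrite -sum1 -big_split; apply: eq_bigr => a _; exact: rE.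
  have := Hrm T; rewrite -mT -rT; have [jT|jT] := boolP (j0 \in T).
    have -> : a0 \in nbhd T by rewrite inE; apply/existsP; exists j0; rewrite jT.
    by rewrite leq_add2r.
  rewrite addn0 => le; have [->//|mT0] := posnP (\sum_(j in T) m' j)%N.
  have : (\sum_(j in T) m j != \sum_(a in nbhd T) r a)%N.
    apply/eqP => tight; apply: strict; exists T; split=> //.
      by rewrite -mT (negbTE jT) addn0.
    rewrite [X in (_ < X)%N](bigID (mem T)) /= -[X in (X < _)%N]addn0 ltn_add2l.
    by rewrite (bigD1 j0) //= addn_gt0 mj0.
  rewrite -mT -rT (negbTE jT) addn0 => ne.
  have : (\sum_(j in T) m' j < \sum_(a in nbhd T) r' a + (a0 \in nbhd T))%N.
    by rewrite ltn_neqAle ne.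
  by case: (a0 \in _); rewrite ?addn1 ?addn0 // => /ltnW.
- by apply: (@addIn 1); rewrite m'1 r'1.
exists (fun a j => w a j + ((a == a0) && (j == j0)))%N; split.
- move=> a j; rewrite addn_gt0 => /orP[/wE//|].
  by case: eqP => // ->; case: eqP => // ->.
- move=> a; rewrite big_split /= wR -[RHS]rE; congr (_ + _)%N.
  case: (a == a0) => /=; last by rewrite big1.
  by rewrite (bigD1 j0) //= eqxx big1 // => j /negbTE ->.
- move=> j; rewrite big_split /= wM -[RHS]mE; congr (_ + _)%N.
  under eq_bigr => a _ do rewrite andbC.
  case: (j == j0) => /=; last by rewrite big1.
  by rewrite (bigD1 a0) //= eqxx big1 // => a /negbTE ->.
Qed.

End Transport.

(** * The spectral theorem for real symmetric matrices *)

Section RealSpectral.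
Variable R : realType.
Local Notation toC := (real_complex R).

Lemma normc_sq_ge0 (x : R[i]) : 0 <= x * conjc x.
Proof.
case: x => a b; rewrite lecE /=.
by rewrite mulrN mulrC addNr eqxx /= mulrN opprK -!expr2 addr_ge0 ?sqr_ge0.
Qed.

(** A complex eigenvalue with eigenvector v is real, by evaluating v A against
    the conjugate of v in two ways. *)
Lemma sym_eigenvalue n (A : 'M[R]_n.+1) : A^T = A -> exists a, eigenvalue A a.
Proof.
move=> symA; pose AC : 'M[R[i]]_n.+1 := map_mx toC A.
have [z zE] := @eigenvalue_closed _ _ AC (ltn0Sn n).
have /eigenvalueP[v vA v0] := zE.
pose w : 'rV[R[i]]_n.+1 := map_mx (@conjc R) v.
have AT : AC^T = AC by rewrite /AC map_trmx symA.
have wA : w *m AC = z^*%C *: w.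
  have -> : AC = map_mx (@conjc R) AC.
    by apply/matrixP => i j; rewrite !mxE /= oppr0.
  by rewrite -map_mxM vA map_mxZ.
have vw0 : (v *m w^T) 0 0 != 0.
  apply: contra_neq v0 => H; apply/matrixP => i j; rewrite ord1 [RHS]mxE.
  move: H; rewrite mxE => /eqP; rewrite psumr_eq0; last first.
    by move=> l _; rewrite !mxE; exact: normc_sq_ge0.
  move=> /allP/(_ j); rewrite mem_index_enum !mxE => /(_ isT) /=.
  by rewrite mulf_eq0 conjc_eq0 orbb => /eqP.
have zreal : z = z^*%C.
  apply: (mulIf vw0).
  have <- : (z *: v *m w^T) 0 0 = z * (v *m w^T) 0 0 by rewrite -scalemxAl mxE.
  have <- : (v *m (z^*%C *: w)^T) 0 0 = z^*%C * (v *m w^T) 0 0.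
    by rewrite linearZ /= -scalemxAr mxE.
  by rewrite -vA -wA trmx_mul AT mulmxA.
exists (complex.Re z).
have zRe : z = toC (complex.Re z).
  case: z zreal {zE vA wA} => a b /= [] H; congr (_ +i* _)%C.
  by move/eqP: H; rewrite -addr_eq0 -mulr2n mulrn_eq0 => /eqP.
rewrite eigenvalue_root_char -(fmorph_root toC) map_char_poly.
by rewrite -[X in root _ X]zRe -eigenvalue_root_char.
Qed.

(** The Householder reflection exchanging the first basis vector and a given
    unit vector. *)
Lemma householder n (u : 'rV[R]_n.+1) : (u *m u^T) 0 0 = 1 ->
  exists H : 'M[R]_n.+1, [/\ H^T = H, H *m H = 1%:M & delta_mx 0 0 *m H = u].
Proof.
move=> u1; pose e : 'rV[R]_n.+1 := delta_mx 0 0.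
have [ue|ue] := eqVneq e u.
  by exists 1%:M; rewrite trmx1 mulmx1 mulmx1.
pose w := e - u; pose c := (w *m w^T) 0 0.
have wwE : w *m w^T = c%:M by rewrite [LHS]mx11_scalar.
have c0 : c != 0.
  apply: contra_neq ue; rewrite /c mxE => /eqP; rewrite psumr_eq0; last first.
    by move=> l _; rewrite [w^T _ _]mxE -expr2 sqr_ge0.
  move=> /allP H; apply/eqP; rewrite -subr_eq0; apply/eqP/matrixP => i j.
  have := H j (mem_index_enum j); rewrite ord1 [w^T _ _]mxE mulf_eq0 orbb => /= /eqP.
  by move=> ->; rewrite mxE.
have ew : e *m w^T = (c / 2)%:M.
  rewrite [LHS]mx11_scalar; congr (_%:M).
  have ee : (e *m e^T) 0 0 = 1.
    by rewrite -rowE !mxE !eqxx.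
  have sym : (u *m e^T) 0 0 = (e *m u^T) 0 0.
    by rewrite -[in LHS](trmxK (u *m e^T)) trmx_mul trmxK mxE.
  have -> : c = 2 * (e *m w^T) 0 0; last by field.
  have sub (x y : 'M[R]_1) : (x - y) 0 0 = x 0 0 - y 0 0 by rewrite !mxE.
  rewrite /c /w linearB /= mulmxBl !mulmxBr !sub u1 ee sym.
  ring.
pose X := (2 / c) *: (w^T *m w).
have XX : X *m X = X + X.
  rewrite /X -scalemxAl -scalemxAr mulmxA -(mulmxA w^T) wwE mul_mx_scalar.
  rewrite -scalemxAl !scalerA -scalerDl; congr (_ *: _).
  by field.
exists (1%:M - X); split.
- by rewrite linearB /= /X linearZ /= trmx_mul trmxK trmx1.
- rewrite mulmxBl !mulmxBr !mul1mx mulmx1 XX.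
  by rewrite opprB addrK subrK.
- rewrite -/e mulmxBr mulmx1 /X -scalemxAr mulmxA ew mul_scalar_mx scalerA.
  have -> : 2 / c * (c / 2) = 1 by field.
  by rewrite scale1r /w opprB addrC subrK.
Qed.

(** Deflation: a reflection moves an eigenvector to the first basis vector, and
    symmetry leaves a smaller symmetric block. *)
Lemma sym_spectral n (A : 'M[R]_n) : A^T = A ->
  exists (U : 'M[R]_n) (d : 'rV[R]_n), U^T *m U = 1%:M /\ A = U *m diag_mx d *m U^T.
Proof.
elim: n A => [|n IHn] A symA.
  by exists 0, 0; split; apply/matrixP => -[].
have [a /eigenvalueP[v vA v0]] := sym_eigenvalue symA.
pose s := (v *m v^T) 0 0.
have s0 : 0 < s.
  rewrite lt_neqAle /s mxE sumr_ge0 ?andbT; last by move=> l _; rewrite mxE -expr2 sqr_ge0.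
  apply: contra_neq v0 => /esym/eqP; rewrite psumr_eq0; last first.
    by move=> l _; rewrite mxE -expr2 sqr_ge0.
  move=> /allP H; apply/matrixP => i j; have := H j (mem_index_enum j).
  by rewrite ord1 [v^T _ _]mxE mulf_eq0 orbb => /= /eqP ->; rewrite mxE.
pose u := (Num.sqrt s)^-1 *: v.
have sq0 : Num.sqrt s != 0 by rewrite gt_eqF // sqrtr_gt0.
have u1 : (u *m u^T) 0 0 = 1.
  rewrite /u linearZ /= -scalemxAl -scalemxAr scalerA mxE -/s -invfM -expr2.
  by rewrite sqr_sqrtr ?(ltW s0) // mulVf // gt_eqF.
have uA : u *m A = a *: u by rewrite /u -scalemxAl vA !scalerA mulrC.
have [H [HT HH eH]] := householder u1.
pose B : 'M[R]_(1 + n) := H *m A *m H.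
have symB : B^T = B by rewrite /B !trmx_mul HT symA mulmxA.
have AE : A = H *m B *m H.
  by rewrite /B !mulmxA HH mul1mx -mulmxA HH mulmx1.
have eB : row 0 B = a *: delta_mx 0 0.
  by rewrite rowE /B !mulmxA eH uA -scalemxAl -eH -mulmxA HH mulmx1.
have B0 j : B 0 j = a * (j == 0)%:R.
  by have /rowP/(_ j) := eB; rewrite !mxE /= => ->.
clearbody B; have l0 : lshift n (0 : 'I_1) = 0 :> 'I_(1 + n) by exact: val_inj.
have ur0 : ursubmx B = 0.
  by apply/matrixP => i j; rewrite !ord1 !mxE l0 B0 mulr0.
have BE : B = block_mx a%:M 0 0 (drsubmx B).
  rewrite -[LHS]submxK; congr block_mx => //.
    by apply/matrixP => i j; rewrite !ord1 !mxE l0 B0 eqxx mulr1.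
  by rewrite -symB -trmx_ursub ur0 trmx0.
have [|U [d [UU Dr]]] := IHn (drsubmx B); first by rewrite trmx_drsub symB.
pose W : 'M[R]_(1 + n) := block_mx 1%:M 0 0 U.
pose D : 'rV[R]_(1 + n) := row_mx a%:M d.
have WW : W^T *m W = 1%:M.
  rewrite tr_block_mx !trmx0 trmx1 mulmx_block.
  by rewrite !mulmx1 !mulmx0 !mul0mx !addr0 add0r UU -scalar_mx_block.
have WD : W *m diag_mx D *m W^T = B.
  rewrite [RHS]BE Dr diag_mx_row tr_block_mx !trmx0 trmx1.
  rewrite !mulmx_block !(mulmx0, mul0mx, mulmx1, mul1mx, addr0, add0r).
  by congr block_mx; apply/matrixP => i j; rewrite !ord1 !mxE.
have [H' [HT' HH' AE']] : exists H' : 'M[R]_(1 + n),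
  [/\ H'^T = H', H' *m H' = 1%:M & A = H' *m B *m H'] by exists H.
exists (H' *m W), D; split.
  by rewrite trmx_mul HT' -mulmxA (mulmxA H') HH' mul1mx.
by rewrite trmx_mul HT' [LHS]AE' -WD !mulmxA.
Qed.

End RealSpectral.

(** * Maxima of continuous functions on closed subsets of boxes *)

Section ContinuousFunctions.
Variables (R : realType) (T : topologicalType).

Definition contfun (F : T -> R) : Prop := continuous F.

Lemma contfun_cst c : contfun (fun=> c).
Proof. by move=> x; exact: cvg_cst. Qed.

Lemma contfunD F G : contfun F -> contfun G -> contfun (fun x => F x + G x).
Proof. by move=> cF cG x; apply: cvgD; [exact: cF | exact: cG]. Qed.

Lemma contfunM F G : contfun F -> contfun G -> contfun (fun x => F x * G x).
Proof. by move=> cF cG x; apply: cvgM; [exact: cF | exact: cG]. Qed.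

Lemma contfunN F : contfun F -> contfun (fun x => - F x).
Proof. by move=> cF x; apply: cvgN; exact: cF. Qed.

Lemma contfun_sum (S : Type) (r : seq S) (p : pred S) (F : S -> T -> R) :
  (forall t, contfun (F t)) -> contfun (fun x => \sum_(t <- r | p t) F t x).
Proof.
move=> HF; elim: r => [|t r IHr].
  by rewrite (_ : (fun x => _) = fun=> 0); [exact: contfun_cst | apply/funext => x; rewrite big_nil].
case pt : (p t).
  rewrite (_ : (fun x => _) = fun x => F t x + \sum_(u <- r | p u) F u x).
    exact: contfunD.
  by apply/funext => x; rewrite big_cons pt.
rewrite (_ : (fun x => _) = fun x => \sum_(u <- r | p u) F u x) //.
by apply/funext => x; rewrite big_cons pt.
Qed.

Lemma contfun_expR F : contfun F -> contfun (fun x => expR (F x)).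
Proof. by move=> cF x; apply: continuous_comp; [exact: cF | exact: continuous_expR]. Qed.

Lemma contfun_mulmx a b c (A : T -> 'M[R]_(a, b))
    (B : T -> 'M[R]_(b, c)) :
  (forall i j, contfun (fun x => A x i j)) ->
  (forall i j, contfun (fun x => B x i j)) ->
  forall i j, contfun (fun x => (A x *m B x) i j).
Proof.
move=> HA HB i j.
rewrite (_ : (fun x => _) = fun x => \sum_t A x i t * B x t j).
  by apply: contfun_sum => t; exact: contfunM.
by apply/funext => x; rewrite mxE.
Qed.

End ContinuousFunctions.

Section CompactBoxes.
Variables (R : realType) (I : finType).

Definition coord_space : topologicalType := prod_topology (fun _ : I => R).

Lemma contfun_coord (i : I) : contfun (fun x : coord_space => x i).
Proof. exact: (@proj_continuous I (fun=> R) i). Qed.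

Lemma compact_attain (G F : coord_space -> R) (C : R) :
  contfun G -> contfun F ->
  (exists x : coord_space, G x = 0 /\ forall i, `|x i| <= C) ->
  exists x : coord_space, [/\ G x = 0, forall i, `|x i| <= C
    & forall y, G y = 0 -> (forall i, `|y i| <= C) -> F y <= F x].
Proof.
move=> cG cF [x0 [Gx0 x0C]].
pose T := coord_space.
pose box : set T := [set x : T | forall i, `[- C, C]%classic (x i)].
pose D : set T := [set x : T | G x = 0] `&` box.
have cbox : compact box.
  apply: (@tychonoff I (fun=> R) (fun=> `[- C, C]%classic)) => i.
  exact: segment_compact.
have cD : compact D.
  rewrite /D setIC; apply: compact_closedI => //.
  apply: (@closed_comp _ _ (G : T -> R) [set 0]) => [x _|]; first exact: cG.
  exact: closed_eq.
have inbox (x : T) : box x <-> forall i, `|x i| <= C.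
  by split=> H i; have := H i; rewrite /= in_itv /= ler_norml.
have [||x] := @compact_EVT_max T R F D _ cD.
- by exists x0; split=> //; apply/inbox.
- exact: continuous_subspaceT.
rewrite inE => -[Gx /inbox xC] xmax; exists x; split=> // y Gy yC.
by apply: xmax; rewrite inE; split=> //; apply/inbox.
Qed.

End CompactBoxes.

(** * Orthonormal frames and subrepresentations *)

Section Frames.
Variables (R : realType) (k d : nat) (e : 'I_k -> nat).
Variable B : forall i, 'M[R]_(d, e i).

Definition cols : finType := {i : 'I_k & 'I_(e i)}.

Definition slot (i : 'I_k) (b : 'I_(e i)) : cols := existT _ i b.

Definition fiber (S : {set cols}) (i : 'I_k) : {set 'I_(e i)} :=
  finset (fun b => slot b \in S).

Lemma card_fiber (S : {set cols}) : (\sum_i #|fiber S i| = #|S|)%N.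
Proof.
transitivity (\sum_(i < k) \sum_(b : 'I_(e i) | slot b \in S) 1)%N.
  by apply: eq_bigr => i _; rewrite -sum1_card; apply: eq_bigl => b; rewrite inE.
rewrite -sum1_card (@sig_big_dep _ _ _ _ (fun i : 'I_k => 'I_(e i) : finType) xpredT
  (fun i b => slot b \in S) (fun _ _ => 1%N)) /=.
by apply: eq_bigl => -[i b].
Qed.

(** Orthonormal bases at the sink and at the sources, as columns. *)
Definition frame (U : 'M[R]_d) (V : forall i, 'M[R]_(e i)) : Prop :=
  U^T *m U = 1%:M /\ forall i, (V i)^T *m V i = 1%:M.

Definition coef (U : 'M[R]_d) (V : forall i, 'M[R]_(e i)) (a : 'I_d) (j : cols) : R :=
  (U^T *m B (tag j) *m V (tag j)) a (tagged j) ^+ 2.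

Lemma coef_ge0 U V a j : 0 <= coef U V a j.
Proof. exact: sqr_ge0. Qed.

(** Vanishing of a rectangle of coefficients exhibits the span of the frame
    vectors indexed by N and S as a subrepresentation. *)
Lemma frame_sub U V (N : {set 'I_d}) (S : {set cols}) : frame U V ->
  (forall a j, a \notin N -> j \in S -> coef U V a j = 0) ->
  ssub B #|N| (fun i => #|fiber S i|).
Proof.
move=> [UU VV] c0.
have orth a c (W : 'M[R]_a) (f : 'I_c -> 'I_a) : injective f -> W^T *m W = 1%:M ->
    (colsub f W)^T *m colsub f W = 1%:M.
  move=> fi WW; rewrite trmx_mxsub mul_rowsub_mx mulmx_colsub WW.
  by apply/matrixP => x y; rewrite !mxE (inj_eq fi).
exists (colsub (@enum_val _ (mem N)) U), (fun i => colsub (@enum_val _ (mem (fiber S i))) (V i)).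
exists (fun i => rowsub (@enum_val _ (mem N))
  (U^T *m B i *m colsub (@enum_val _ (mem (fiber S i))) (V i))).
split.
- by eexists; apply: (orth _ _ _ _ enum_val_inj UU).
- by move=> i; eexists; apply: (orth _ _ _ _ enum_val_inj (VV i)).
move=> i; set Y := colsub _ (V i).
have UUt : U *m U^T = 1%:M by exact: mulmx1C.
have M0 a y : a \notin N -> (U^T *m B i *m Y) a y = 0.
  move=> aN; apply/eqP; rewrite -sqrf_eq0; apply/eqP.
  rewrite -[RHS](c0 a (slot (enum_val y)) aN); last first.
    by have := enum_valP y; rewrite inE.
  by rewrite /coef /= /Y mulmx_colsub [colsub _ _ _ _]mxE.
have -> : B i *m Y = U *m (U^T *m B i *m Y) by rewrite !mulmxA UUt mul1mx.
set M := U^T *m B i *m Y in M0 *; clearbody M.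
apply/matrixP => r y; rewrite !mxE (bigID (mem N)) /= [X in _ + X]big1 ?addr0.
  by rewrite big_enum_val; apply: eq_bigr => t _; rewrite !mxE.
by move=> a aN; rewrite M0 ?mulr0.
Qed.

Definition frame_index : finType := ('I_d * 'I_d + mxfam_index e e)%type.
Definition frameU (x : frame_index -> R) : 'M[R]_d := \matrix_(r, c) x (inl (r, c)).
Definition frameV (x : frame_index -> R) : mxfam R e e := of_coords (fun j => x (inr j)).

Definition frame_of (U : 'M[R]_d) (V : mxfam R e e) (j : frame_index) : R :=
  match j with inl (r, c) => U r c | inr j' => coords V j' end.

Lemma frame_ofU U V : frameU (frame_of U V) = U.
Proof. by apply/matrixP => r c; rewrite mxE. Qed.

Lemma frame_ofV U V : frameV (frame_of U V) = V.
Proof. exact: coordsK. Qed.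

(** The frames are the zero set of this continuous function, which is how
    compact_attain sees them. *)
Definition orth_defect a (W : 'M[R]_a) : R :=
  \sum_r \sum_c (W^T *m W - 1%:M) r c * (W^T *m W - 1%:M) r c.

Lemma orth_defect_ge0 a (W : 'M[R]_a) : 0 <= orth_defect W.
Proof. by do 2!apply: sumr_ge0 => ? _; rewrite -expr2 sqr_ge0. Qed.

Lemma orth_defect_eq0 a (W : 'M[R]_a) : orth_defect W = 0 <-> W^T *m W = 1%:M.
Proof.
split=> [/eqP|WW]; last first.
  by apply: big1 => r _; apply: big1 => c _; rewrite WW subrr mxE mulr0.
rewrite psumr_eq0 => [/allP H|r _]; last by apply: sumr_ge0 => c _; rewrite -expr2 sqr_ge0.
apply/matrixP => r c; apply/eqP; rewrite -subr_eq0.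
have := H r (mem_index_enum r); rewrite /= psumr_eq0 => [/allP H'|c' _]; last by rewrite -expr2 sqr_ge0.
have := H' c (mem_index_enum c); rewrite /= mulf_eq0 orbb.
by rewrite [(_ - _ : matrix _ _ _) r c]mxE [(- _ : matrix _ _ _) r c]mxE.
Qed.

Definition frame_defect (x : frame_index -> R) : R :=
  orth_defect (frameU x) + \sum_i orth_defect (frameV x i).

Lemma frame_defect_eq0 x : frame_defect x = 0 <-> frame (frameU x) (frameV x).
Proof.
rewrite /frame_defect; split=> [/eqP|[UU VV]]; last first.
  rewrite (orth_defect_eq0 _).2 // big1 ?addr0 // => i _.
  exact/orth_defect_eq0.
rewrite paddr_eq0 ?orth_defect_ge0 //; last by apply: sumr_ge0 => i _; exact: orth_defect_ge0.
move=> /andP[/eqP/orth_defect_eq0 UU].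
rewrite psumr_eq0 => [/allP H|i _]; last exact: orth_defect_ge0.
by split=> // i; apply/orth_defect_eq0/eqP/(H i (mem_index_enum i)).
Qed.

Lemma orth_entry a (W : 'M[R]_a) r c : W^T *m W = 1%:M -> `|W r c| <= 1.
Proof.
move=> /matrixP/(_ c c); rewrite !mxE eqxx => H.
rewrite -(@expr_le1 _ 2) // -normrX ger0_norm ?sqr_ge0 // -[leRHS]H.
rewrite (bigD1 r) //= mxE -expr2 lerDl; apply: sumr_ge0 => i _.
by rewrite mxE -expr2 sqr_ge0.
Qed.

Lemma frame_bounded x : frame (frameU x) (frameV x) -> forall j, `|x j| <= 1.
Proof.
move=> [UU VV] [[r c]|[i [r c]]].
  by have := orth_entry r c UU; rewrite mxE.
by have := orth_entry r c (VV i); rewrite mxE.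
Qed.

Section Continuity.
Variables (T : topologicalType) (f : T -> frame_index -> R).
Hypothesis cf : forall j, contfun (fun x => f x j).

Let contU r c : contfun (fun x => frameU (f x) r c).
Proof.
by rewrite (_ : (fun x => _) = fun x => f x (inl (r, c))) //; apply/funext => x; rewrite mxE.
Qed.

Let contV i r c : contfun (fun x => frameV (f x) i r c).
Proof.
rewrite (_ : (fun x => _) = fun x => f x (inr (existT _ i (r, c)))) //.
by apply/funext => x; rewrite mxE.
Qed.

Let cont_tr a b (W : T -> 'M[R]_(a, b)) : (forall r c, contfun (fun x => W x r c)) ->
  forall r c, contfun (fun x => (W x)^T r c).
Proof.
move=> cW r c; rewrite (_ : (fun x => _) = fun x => W x c r) //.
by apply/funext => x; rewrite mxE.
Qed.

Lemma contfun_coef a j : contfun (fun x => coef (frameU (f x)) (frameV (f x)) a j).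
Proof.
rewrite (_ : (fun x => _) = fun x =>
  ((frameU (f x))^T *m B (tag j) *m frameV (f x) (tag j)) a (tagged j) *
  ((frameU (f x))^T *m B (tag j) *m frameV (f x) (tag j)) a (tagged j)); last first.
  by apply/funext => x; rewrite -expr2.
have H : contfun (fun x => ((frameU (f x))^T *m B (tag j) *m frameV (f x) (tag j)) a (tagged j)).
  apply: contfun_mulmx => // r c; apply: contfun_mulmx => [r' c'|r' c'].
    exact: cont_tr.
  exact: contfun_cst.
exact: contfunM.
Qed.

Let cont_defect a (W : T -> 'M[R]_a) : (forall r c, contfun (fun x => W x r c)) ->
  contfun (fun x => orth_defect (W x)).
Proof.
move=> cW; apply: contfun_sum => r; apply: contfun_sum => c.
have H : contfun (fun x => ((W x)^T *m W x - 1%:M) r c).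
  rewrite (_ : (fun x => _) = fun x => ((W x)^T *m W x) r c + - (1%:M : 'M_a) r c).
    apply: contfunD; last exact: contfun_cst.
    by apply: contfun_mulmx => //; exact: cont_tr.
  by apply/funext => x; rewrite mxE [(- _ : matrix _ _ _) r c]mxE.
exact: contfunM.
Qed.

Lemma contfun_frame_defect : contfun (fun x => frame_defect (f x)).
Proof.
apply: contfunD; first exact: cont_defect.
by apply: contfun_sum => i; exact: cont_defect.
Qed.

End Continuity.

(** The frames form a compact set, so a rectangle that vanishes at no frame
    contains, at every frame, an entry bounded below uniformly. *)
Lemma rectangle_gap (N : {set 'I_d}) (S : {set cols}) :
  ~ ssub B #|N| (fun i => #|fiber S i|) ->
  exists2 delta : R, 0 < delta & forall U V, frame U V ->
    exists a j, [/\ a \notin N, j \in S & delta <= coef U V a j].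
Proof.
move=> nosub.
pose F (x : coord_space R frame_index) : R :=
  - \sum_(a | a \notin N) \sum_(j in S) coef (frameU x) (frameV x) a j.
have cF : contfun F.
  apply: contfunN; apply: contfun_sum => a; apply: contfun_sum => j.
  by apply: contfun_coef => l; exact: contfun_coord.
have cG : contfun (frame_defect : coord_space R frame_index -> R).
  by apply: contfun_frame_defect => l; exact: contfun_coord.
have [|x [Gx _ xmax]] := compact_attain (C := 1) cG cF.
  exists (frame_of 1%:M (fun=> 1%:M)); split.
    apply/frame_defect_eq0; rewrite frame_ofU frame_ofV.
    by split=> [|i]; rewrite trmx1 mulmx1.
  apply: frame_bounded; rewrite frame_ofU frame_ofV.
  by split=> [|i]; rewrite trmx1 mulmx1.
have fx : frame (frameU x) (frameV x) by apply/frame_defect_eq0.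
have Fx : F x < 0.
  rewrite lt_neqAle; apply/andP; split; last first.
    by rewrite oppr_le0; do 2!apply: sumr_ge0 => ? _; exact: coef_ge0.
  apply/negP => /eqP F0; apply: nosub; apply: (frame_sub fx) => a j aN jS.
  have {}F0 : \sum_(a | a \notin N) \sum_(j in S) coef (frameU x) (frameV x) a j = 0.
    by apply/eqP; rewrite -oppr_eq0; apply/eqP.
  have H1 := psumr_eq0P (fun a _ => sumr_ge0 _ (fun j _ => coef_ge0 _ _ a j)) F0 aN.
  exact: psumr_eq0P (fun j _ => coef_ge0 _ _ a j) H1 j jS.
(* Some entry is at least the minimal total divided by a strict upper bound for
   the number of entries. *)
pose c : R := (d * #|{: cols}|).+1%:R.
have c0 : 0 < c by rewrite ltr0n.
exists (- F x / c); first by rewrite divr_gt0 // oppr_gt0.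
move=> U V fUV; apply: contrapT => H.
have : F (frame_of U V) <= F x.
  apply: xmax.
    by apply/frame_defect_eq0; rewrite frame_ofU frame_ofV.
  by apply: frame_bounded; rewrite frame_ofU frame_ofV.
apply/negP; rewrite -ltNge ltrNr /F frame_ofU frame_ofV.
have le a j : a \notin N -> j \in S -> coef U V a j <= - F x / c.
  by move=> aN jS; rewrite leNgt; apply/negP => lt; apply: H; exists a, j; rewrite ltW.
have K0 : 0 <= - F x / c by rewrite divr_ge0 ?oppr_ge0 ?ltW.
apply: (@le_lt_trans _ _ (\sum_(a : 'I_d) \sum_(j : cols) - F x / c)).
  rewrite big_mkcond; apply: ler_sum => a _; case: ifP => aN; last exact: sumr_ge0.
  by rewrite big_mkcond; apply: ler_sum => j _; case: ifP => // jS; exact: le.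
rewrite [ltRHS](_ : _ = - F x / c * c); last by rewrite divfK // gt_eqF.
rewrite !sumr_const -mulrnA -mulr_natr ltr_pM2l; last first.
  by rewrite divr_gt0 // oppr_gt0.
by rewrite /c ltr_nat ltnS card_ord mulnC.
Qed.

Definition edge (delta : R) U V (a : 'I_d) (j : cols) : bool := delta <= coef U V a j.

(** A uniform Hall condition. If the frame vectors in S and their neighbours in
    the graph of the coefficients above delta did not have the dimensions of a
    subrepresentation, the gap lemma would produce one more neighbour. *)
Lemma frames_hall : exists2 delta : R, 0 < delta & forall U V, frame U V ->
  forall S : {set cols},
    ssub B #|nbhd (edge delta U V) S| (fun i => #|fiber S i|).
Proof.
have H (x : {set 'I_d} * {set cols}) : exists delta : R, 0 < delta /\
    (~ ssub B #|x.1| (fun i => #|fiber x.2 i|) -> forall U V, frame U V ->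
      exists a j, [/\ a \notin x.1, j \in x.2 & delta <= coef U V a j]).
  have [s|/rectangle_gap[delta d0 Hd]] := pselect (ssub B #|x.1| (fun i => #|fiber x.2 i|)).
    by exists 1; split=> // /(_ s).
  by exists delta.
have [df dfP] := boolp.choice H.
exists (\big[Order.min/1]_x df x).
  apply: (big_ind (fun y => 0 < y)) => // [x y x0 y0|x _]; last by case: (dfP x).
  by rewrite lt_min x0.
move=> U V fUV S; apply: contrapT => nosub.
set N := nbhd _ S in nosub.
have [_ /(_ nosub U V fUV)[a [j [aN jS ge]]]] := dfP (N, S).
move: aN; rewrite /= inE negb_exists => /forallP/(_ j).
rewrite jS /edge /= => /negP; apply; apply: le_trans ge.
exact: bigmin_le_cond.
Qed.

End Frames.

(** * The objective on diagonal matrices *)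

Section TransportBound.
Variable R : realType.

(** The maximum is at exp x = w / delta. *)
Lemma linear_minus_exp (w : nat) (delta : R) : 0 < delta ->
  exists l : R, 0 <= l /\ forall x, w%:R * x - delta * expR x <= l.
Proof.
move=> d0; case: w => [|w].
  by exists 0; split=> // x; rewrite mul0r sub0r oppr_le0 mulr_ge0 ?expR_ge0 // ltW.
pose W : R := w.+1%:R; have W0 : 0 < W by rewrite ltr0n.
exists `|W * (1 + ln (delta / W))|; split=> // x.
apply: le_trans (_ : - (W * (1 + ln (delta / W))) <= _); last first.
  by rewrite -normrN ler_norm.
have E : delta * expR x = W * expR (x + ln (delta / W)).
  rewrite expRD lnK ?posrE ?divr_gt0 //.
  by rewrite [RHS]mulrC -mulrA divfK ?gt_eqF // mulrC.
have := expR_ge1Dx (x + ln (delta / W)).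
rewrite -(ler_pM2l W0) -E => H.
by rewrite -/W; lra.
Qed.

Variables (A J : finType).

(** Along the edges of a transport plan w, the inequality
    w x - c exp x <= const holds uniformly for c bounded below; off the plan
    the terms have the right sign. *)
Lemma transport_bound (r : A -> nat) (m : J -> nat) (delta M : R) :
  0 < delta -> 1 <= M -> (\sum_a r a = \sum_j m j)%N ->
  exists L : R, forall c : A -> J -> R, (forall a j, 0 <= c a j) ->
    hall (fun a j => delta <= c a j) r m ->
    forall s t, \sum_a (r a)%:R * s a + \sum_j (m j)%:R * t j
      - M * \sum_a \sum_j c a j * expR (s a + t j) <= L.
Proof.
move=> d0 M1 tot.
pose N := (\sum_a r a)%N; pose K := \sum_(w < N.+1) sval (cid (linear_minus_exp w d0)).
exists (\sum_(a : A) \sum_(j : J) K) => c c0 Hh s t.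
have [w [wE wr wm]] := hall_transport Hh tot.
have lK (v : nat) : (v <= N)%N ->
    0 <= K /\ forall x, v%:R * x - delta * expR x <= K.
  move=> vN; have l0 (u : 'I_N.+1) : 0 <= sval (cid (linear_minus_exp u d0)).
    by case: cid => ? [].
  split; first exact: sumr_ge0.
  move=> x; apply: le_trans (_ : sval (cid (linear_minus_exp v d0)) <= _).
    by case: cid => ? [].
  rewrite /K (bigD1 (Ordinal (vN : (v < N.+1)%N))) //= lerDl; exact: sumr_ge0.
have -> : \sum_a (r a)%:R * s a = \sum_a \sum_j (w a j)%:R * s a.
  by apply: eq_bigr => a _; rewrite -wr natr_sum mulr_suml.
have -> : \sum_j (m j)%:R * t j = \sum_a \sum_j (w a j)%:R * t j.
  rewrite exchange_big; apply: eq_bigr => j _.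
  by rewrite -wm natr_sum mulr_suml.
rewrite -big_split mulr_sumr -sumrB; apply: ler_sum => a _.
rewrite -big_split mulr_sumr -sumrB; apply: ler_sum => j _ /=.
have wN : (w a j <= N)%N.
  by rewrite /N (bigD1 a) //= -wr (bigD1 j) //= -addnA leq_addr.
have [K0 Kx] := lK _ wN; rewrite -mulrDr.
have e0 : 0 <= c a j * expR (s a + t j) by rewrite mulr_ge0 ?expR_ge0.
have [w0|wpos] := posnP (w a j).
  by rewrite w0 mul0r sub0r; nra.
apply: le_trans (Kx (s a + t j)); rewrite lerB //.
apply: le_trans (_ : c a j * expR (s a + t j) <= _); last by nra.
by rewrite ler_wpM2r ?expR_ge0 // wE.
Qed.

End TransportBound.

Section DiagonalObjective.
Variables (R : realType) (k d : nat) (e : 'I_k -> nat).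
Variable B : forall i, 'M[R]_(d, e i).
Variables (n p : nat).
Hypothesis n_gt0 : (0 < n)%N.
Hypothesis p_gt0 : (0 < p)%N.
Hypothesis weight0 : (n * d = p * \sum_i e i)%N.
Local Notation cols := (cols e).

Definition diag_obj U V (s : 'I_d -> R) (t : cols -> R) : R :=
  n%:R * \sum_a s a + p%:R * \sum_j t j
  - \sum_a \sum_j coef B U V a j * expR (s a + t j).

Lemma card_cols : (#|{: cols}| = \sum_i e i)%N.
Proof.
rewrite -cardsT -(card_fiber (finset.setTfor cols)); apply: eq_bigr => i _.
rewrite -[RHS]card_ord; apply: eq_card => b; by rewrite !inE.
Qed.

Lemma tot_np : (\sum_(a < d) n = \sum_(j : cols) p)%N.
Proof.
by rewrite !sum_nat_const card_ord card_cols mulnC weight0 mulnC.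
Qed.

(** Semistability is the Hall condition of frames_hall for the marginals n and
    p. *)
Lemma diag_obj_bounded :
  (forall b c, ssub B b c -> (p * \sum_i c i <= n * b)%N) ->
  exists L, forall U V s t, frame U V -> diag_obj U V s t <= L.
Proof.
move=> ss; have [delta d0 Hd] := frames_hall B.
have [L HL] := transport_bound (r := fun=> n) (m := fun=> p) d0 (lexx 1) tot_np.
exists L => U V s t fUV.
have := HL (coef B U V) (fun a j => coef_ge0 B U V a j) _ s t.
rewrite mul1r -!mulr_sumr; apply => S.
rewrite !sum_nat_const mulnC [X in (_ <= X)%N]mulnC -(card_fiber S).
exact: ss (Hd U V fUV S).
Qed.

Hypothesis stableB : sstable n p B.

(** The marginals are doubled to leave room for a perturbation by one unit at
    one row and one column; stability keeps the Hall condition true. *)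
Lemma diag_obj_coercive : exists L, forall U V s t a j, frame U V ->
  2 * diag_obj U V s t + (s a + t j) <= L /\
  2 * diag_obj U V s t - (s a + t j) <= L.
Proof.
have [delta d0 Hd] := frames_hall B.
pose rp (a0 : 'I_d) a := (2 * n + (a == a0))%N.
pose mp (j0 : cols) j := (2 * p + (j == j0))%N.
pose rm (a0 : 'I_d) a := (2 * n - (a == a0))%N.
pose mm (j0 : cols) j := (2 * p - (j == j0))%N.
have sum1 (I : finType) (i0 : I) (T : {set I}) : (\sum_(i in T) (i == i0) = (i0 \in T))%N.
  case: (boolP (i0 \in T)) => iT.
    by rewrite (bigD1 i0) //= eqxx big1 // => i /andP[_ /negbTE ->].
  by rewrite big1 // => i ii; case: eqP => // ie; rewrite ie (negbTE iT) in ii.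
have sump (I : finType) (i0 : I) (T : {set I}) (w : nat) :
    (\sum_(i in T) (2 * w + (i == i0)) = 2 * (#|T| * w) + (i0 \in T))%N.
  by rewrite big_split /= sum1 sum_nat_const mulnCA.
have summ (I : finType) (i0 : I) (T : {set I}) (w : nat) : (0 < w)%N ->
    (\sum_(i in T) (2 * w - (i == i0)) + (i0 \in T) = 2 * (#|T| * w))%N.
  move=> w0; rewrite -(sum1 _ i0) -big_split /= mulnCA -sum_nat_const.
  apply: eq_bigr => i _; rewrite subnK // mul2n -addnn.
  by case: (i == i0); rewrite // addn_gt0 w0.
have key U V (S : {set cols}) : frame U V ->
    [\/ #|S| = 0%N /\ #|nbhd (edge B delta U V) S| = 0%N,
        S = finset.setTfor cols /\ nbhd (edge B delta U V) S = finset.setTfor 'I_d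
      | (#|S| * p < #|nbhd (edge B delta U V) S| * n)%N].
  move=> fUV; have := stableB (Hd U V fUV S); rewrite card_fiber.
  case=> [[N0 S0]|[Nd Se]|lt].
  - constructor 1; split=> //; rewrite -card_fiber big1 // => i _; exact: S0.
  - constructor 2; split; apply/eqP.
      rewrite eqEcard finset.subsetT cardsT card_cols -card_fiber.
      by apply: leq_sum => i _; have /= -> := Se i.
    by rewrite eqEcard finset.subsetT cardsT card_ord Nd /= leqnn.
  - by constructor 3; rewrite mulnC [X in (_ < X)%N]mulnC.
have totT : (#|finset.setTfor cols| * p = #|finset.setTfor 'I_d| * n)%N.
  by rewrite !cardsT -!sum_nat_const -tot_np.
have hallp U V a0 j0 : frame U V -> hall (edge B delta U V) (rp a0) (mp j0).
  move=> fUV S; rewrite !sump.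
  have [[S0 N0]|[-> NT]|lt] := key U V S fUV.
  - rewrite S0 N0; move/eqP: S0; rewrite cards_eq0 => /eqP ->.
    by rewrite finset.in_set0.
  - by rewrite NT totT !finset.in_setT.
  - apply: leq_trans (leq_addr _ _).
    move: lt; move: (#|S| * p)%N (#|nbhd (edge B delta U V) S| * n)%N => x y.
    by case: (j0 \in S) => /=; lia.
have hallm U V a0 j0 : frame U V -> hall (edge B delta U V) (rm a0) (mm j0).
  move=> fUV S.
  have Hm := summ _ j0 S p p_gt0.
  have Hn := summ _ a0 (nbhd (edge B delta U V) S) n n_gt0.
  have [[S0 N0]|[ST NT]|lt] := key U V S fUV.
  - by move: Hm; rewrite S0 mul0n muln0 => /eqP; rewrite addn_eq0 => /andP[/eqP -> _].
  - move: Hm Hn; rewrite NT ST !finset.in_setT totT => <- /eqP.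
    by rewrite eqn_add2r => /eqP ->.
  - rewrite -(leq_add2r (a0 \in nbhd (edge B delta U V) S)) Hn.
    move: Hm lt; move: (#|S| * p)%N (#|nbhd (edge B delta U V) S| * n)%N => x y.
    move: (\sum_(i in S) _)%N => z.
    by case: (a0 \in nbhd _ S); case: (j0 \in S) => /=; lia.
have totp a0 j0 : (\sum_a rp a0 a = \sum_j mp j0 j)%N.
  have := sump _ a0 (finset.setTfor 'I_d) n; have := sump _ j0 (finset.setTfor cols) p.
  rewrite !finset.in_setT totT => <-.
  by rewrite !(eq_bigl _ _ (fun x => finset.in_setT x)) => ->.
have totm a0 j0 : (\sum_a rm a0 a = \sum_j mm j0 j)%N.
  have := summ _ a0 (finset.setTfor 'I_d) n n_gt0; have := summ _ j0 (finset.setTfor cols) p p_gt0.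
  rewrite !finset.in_setT totT => <- /eqP; rewrite eqn_add2r => /eqP.
  by rewrite !(eq_bigl _ _ (fun x => finset.in_setT x)) => ->.
have one2 : 1 <= 2 :> R by rewrite ler1n.
have delta1 (I : finType) (i0 : I) (f : I -> R) : \sum_i (i == i0)%:R * f i = f i0.
  rewrite (bigD1 i0) //= eqxx mul1r big1 ?addr0 // => i /negbTE ->.
  by rewrite mul0r.
have wsump (I : finType) (i0 : I) (f : I -> R) (w : nat) :
    \sum_i (2 * w + (i == i0))%:R * f i = 2 * (w%:R * \sum_i f i) + f i0.
  rewrite -(delta1 I i0 f) !mulr_sumr -big_split; apply: eq_bigr => i _ /=.
  by rewrite natrD natrM mulrDl mulrA.
have wsumm (I : finType) (i0 : I) (f : I -> R) (w : nat) : (0 < w)%N ->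
    \sum_i (2 * w - (i == i0))%:R * f i = 2 * (w%:R * \sum_i f i) - f i0.
  move=> w0; rewrite -(delta1 I i0 f) !mulr_sumr -sumrB; apply: eq_bigr => i _ /=.
  rewrite natrB ?natrM ?mulrBl ?mulrA //.
  by case: (i == i0); rewrite // muln_gt0 w0.
have Lp a j : {L | forall U V s t, frame U V -> 2 * diag_obj U V s t + (s a + t j) <= L}.
  have /cid[L HL] := transport_bound d0 one2 (totp a j).
  exists L => U V s t fUV.
  have := HL (coef B U V) (fun a j => coef_ge0 B U V a j) (hallp U V a j fUV) s t.
  by rewrite /rp /mp !wsump /diag_obj; lra.
have Lm a j : {L | forall U V s t, frame U V -> 2 * diag_obj U V s t - (s a + t j) <= L}.
  have /cid[L HL] := transport_bound d0 one2 (totm a j).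
  exists L => U V s t fUV.
  have := HL (coef B U V) (fun a j => coef_ge0 B U V a j) (hallm U V a j fUV) s t.
  by rewrite /rm /mm !wsumm // /diag_obj; lra.
exists (\sum_a \sum_j (`|sval (Lp a j)| + `|sval (Lm a j)|)) => U V s t a j fUV.
have le : `|sval (Lp a j)| + `|sval (Lm a j)| <=
    \sum_a \sum_j (`|sval (Lp a j)| + `|sval (Lm a j)|).
  rewrite (bigD1 a) //= (bigD1 j) //= -addrA lerDl addr_ge0 //.
    by apply: sumr_ge0 => j' _; rewrite addr_ge0.
  by do 2!apply: sumr_ge0 => ? _; rewrite addr_ge0.
have H1 := svalP (Lp a j) U V s t fUV; have H2 := svalP (Lm a j) U V s t fUV.
have n1 := ler_norm (sval (Lp a j)); have n2 := ler_norm (sval (Lm a j)).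
have n3 := normr_ge0 (sval (Lp a j)); have n4 := normr_ge0 (sval (Lm a j)).
by split; lra.
Qed.

(** The invariance under rescaling T by exp x and the T_i by exp (- x). *)
Lemma diag_obj_shift U V s t (x : R) :
  diag_obj U V (fun a => s a + x) (fun j => t j - x) = diag_obj U V s t.
Proof.
rewrite /diag_obj; congr (_ - _); last first.
  apply: eq_bigr => a _; apply: eq_bigr => j _; congr (_ * expR _); ring.
rewrite big_split sumrB /= !sumr_const card_ord card_cols.
have : (n%:R * d%:R = p%:R * (\sum_i e i)%:R :> R) by rewrite -!natrM weight0.
move=> H; rewrite -[x *+ d]mulr_natl -[x *+ _]mulr_natl.
transitivity (n%:R * \sum_a s a + p%:R * \sum_j t j
    + (n%:R * d%:R - p%:R * (\sum_i e i)%:R) * x); first by ring.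
by rewrite H subrr mul0r addr0.
Qed.

(** Coercivity bounds all sums s_a + t_j where the objective is at least its
    value at the origin; a shift then makes s vanish at one place and confines
    all variables to a box. *)
Lemma diag_obj_attained : (0 < d)%N -> exists U V s t, frame U V /\
  forall U' V' s' t', frame U' V' -> diag_obj U' V' s' t' <= diag_obj U V s t.
Proof.
move=> d_gt0; have [L HL] := diag_obj_coercive.
pose a0 : 'I_d := Ordinal d_gt0.
have /card_gt0P[j0 _] : (0 < #|{: cols}|)%N.
  by rewrite card_cols -(ltn_pmul2l p_gt0) muln0 -weight0 muln_gt0 n_gt0.
have fr1 : frame (1%:M : 'M[R]_d) (fun i => 1%:M : 'M[R]_(e i)).
  by split=> [|i]; rewrite trmx1 mulmx1.
pose f0 := diag_obj 1%:M (fun i => 1%:M) (fun=> 0) (fun=> 0).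
pose rho := `|L - 2 * f0|.
have rho0 : 0 <= rho by exact: normr_ge0.
have rhoL : L - 2 * f0 <= rho by exact: ler_norm.
pose idx : finType := (frame_index d e + ('I_d + cols))%type.
pose fx (x : idx -> R) := fun j => x (inl j).
pose F (x : coord_space R idx) : R := diag_obj (frameU (fx x)) (frameV (fx x))
  (fun a => x (inr (inl a))) (fun j => x (inr (inr j))).
pose G (x : coord_space R idx) : R := frame_defect (fx x).
have cfx j : contfun (fun x : coord_space R idx => fx x j) by exact: contfun_coord.
have cG : contfun G by exact: contfun_frame_defect.
have cs a : contfun (fun x : coord_space R idx => x (inr (inl a))) by exact: contfun_coord.
have ct j : contfun (fun x : coord_space R idx => x (inr (inr j))) by exact: contfun_coord.
have cF : contfun F.
  apply: contfunD; first apply: contfunD.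
  - by apply: contfunM; [exact: contfun_cst | exact: contfun_sum].
  - by apply: contfunM; [exact: contfun_cst | exact: contfun_sum].
  apply: contfunN; apply: contfun_sum => a; apply: contfun_sum => j.
  apply: contfunM; first exact: contfun_coef.
  by apply: contfun_expR; exact: contfunD.
pose pt U V (s : 'I_d -> R) (t : cols -> R) (j : idx) : R := match j with
  | inl j => frame_of U V j | inr (inl a) => s a | inr (inr j) => t j end.
have ptG U V s t : frame U V -> G (pt U V s t) = 0.
  by move=> fUV; apply/frame_defect_eq0; rewrite frame_ofU frame_ofV.
have ptF U V s t : F (pt U V s t) = diag_obj U V s t.
  by rewrite /F frame_ofU frame_ofV.
have ptC U V s t : frame U V -> (forall a, `|s a| <= 1 + 2 * rho) ->
    (forall j, `|t j| <= 1 + 2 * rho) -> forall j, `|pt U V s t j| <= 1 + 2 * rho.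
  move=> fUV sC tC [j|[a|j]] //=.
  apply: le_trans (_ : 1 <= _); last by rewrite lerDl; lra.
  by apply: frame_bounded; rewrite frame_ofU frame_ofV.
have zC : `|0 : R| <= 1 + 2 * rho by rewrite normr0; lra.
have [|x [Gx _ xmax]] := compact_attain (C := 1 + 2 * rho) cG cF.
  by exists (pt 1%:M (fun i => 1%:M) (fun=> 0) (fun=> 0)); split; [exact: ptG | exact: ptC].
have fxx : frame (frameU (fx x)) (frameV (fx x)) by apply/frame_defect_eq0.
have f0x : f0 <= F x.
  by rewrite -[f0]ptF; apply: xmax; [exact: ptG | exact: ptC].
exists (frameU (fx x)), (frameV (fx x)), (fun a => x (inr (inl a))), (fun j => x (inr (inr j))).
split=> // U V s t fUV; rewrite -/(F x).
have [le|lt] := lerP (diag_obj U V s t) f0; first exact: le_trans le f0x.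
have st a j : `|s a + t j| <= rho.
  have [H1 H2] := HL U V s t a j fUV.
  by rewrite ler_norml; apply/andP; split; lra.
rewrite -(diag_obj_shift U V s t (- s a0)) -ptF.
have tb j : `|t j - - s a0| <= rho by rewrite opprK addrC.
apply: xmax; first exact: ptG.
apply: ptC => // [a|j]; last by apply: le_trans (tb j) _; lra.
have -> : s a - s a0 = (s a + t j0) - (s a0 + t j0) by ring.
apply: le_trans (ler_normB _ _) _.
by have := st a j0; have := st a0 j0; lra.
Qed.

End DiagonalObjective.

(** * Positive definite matrices *)

Section PositiveDefinite.
Variable R : realType.

Lemma norm_sq_ge0 a (u : 'cV[R]_a) : 0 <= (u^T *m u) 0 0.
Proof. by rewrite mxE; apply: sumr_ge0 => i _; rewrite mxE -expr2 sqr_ge0. Qed.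

Lemma norm_sq_eq0 a (u : 'cV[R]_a) : (u^T *m u) 0 0 = 0 -> u = 0.
Proof.
rewrite mxE => H; apply/matrixP => i j; rewrite ord1 [RHS]mxE; apply/eqP.
rewrite -sqrf_eq0; apply/eqP.
have H1 (l : 'I_a) : true -> 0 <= u^T 0 l * u l 0 by rewrite mxE -expr2 sqr_ge0.
by have := psumr_eq0P H1 H (isT : xpredT i); rewrite mxE -expr2.
Qed.

Lemma norm_sq_gt0 a (u : 'cV[R]_a) : u != 0 -> 0 < (u^T *m u) 0 0.
Proof.
move=> u0; rewrite lt_neqAle norm_sq_ge0 andbT eq_sym.
by apply: contra_neq u0; exact: norm_sq_eq0.
Qed.

Lemma posdef1 a : posdefmx (1%:M : 'M[R]_a).
Proof. by split=> [|u /norm_sq_gt0]; rewrite ?trmx1 ?mulmx1. Qed.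

Lemma posdef_congr a (A G : 'M[R]_a) :
  G \in unitmx -> posdefmx A -> posdefmx (G *m A *m G^T).
Proof.
move=> Gu [sA pA]; split; first by rewrite !trmx_mul trmxK sA mulmxA.
move=> u u0; have Gu0 : G^T *m u != 0.
  apply: contra_neq u0 => Gu0.
  have Gtu : G^T \in unitmx by rewrite unitmx_tr.
  by rewrite -[u](mulKmx Gtu) Gu0 mulmx0.
by have := pA _ Gu0; rewrite trmx_mul trmxK !mulmxA.
Qed.

Definition expdiag a (s : 'I_a -> R) : 'M[R]_a := diag_mx (\row_i expR (s i)).

Lemma expdiagE a (s : 'I_a -> R) i j : expdiag s i j = expR (s i) *+ (i == j).
Proof. by rewrite !mxE. Qed.

Lemma det_expdiag a (s : 'I_a -> R) : \det (expdiag s) = expR (\sum_i s i).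
Proof.
by rewrite det_diag expR_sum; apply: eq_bigr => i _; rewrite mxE.
Qed.

Lemma posdef_spectral a (T : 'M[R]_a) : posdefmx T ->
  exists (U : 'M[R]_a) s, U^T *m U = 1%:M /\ T = U *m expdiag s *m U^T.
Proof.
move=> [sT pT]; have [U [v [UU TE]]] := sym_spectral sT.
have v0 i : 0 < v 0 i.
  pose x : 'cV[R]_a := U *m delta_mx i 0.
  have x0 : x != 0.
    apply/eqP => x0; have : U^T *m x = 0 by rewrite x0 mulmx0.
    rewrite mulmxA UU mul1mx => /matrixP/(_ i 0).
    by rewrite !mxE !eqxx => /eqP; rewrite oner_eq0.
  have := pT x x0; rewrite TE /x trmx_mul !mulmxA.
  rewrite -(mulmxA _ U^T) UU mulmx1 -(mulmxA _ U^T) UU mulmx1.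
  by rewrite trmx_delta -rowE -colE !mxE eqxx mulr1n.
exists U, (fun i => ln (v 0 i)); split=> //; rewrite [LHS]TE; congr (_ *m _ *m _).
by apply/matrixP => i j; rewrite !mxE lnK // posrE.
Qed.

Lemma posdef_expdiag a (U : 'M[R]_a) s : U^T *m U = 1%:M ->
  posdefmx (U *m expdiag s *m U^T).
Proof.
move=> UU; apply: posdef_congr; first by case/mulmx1_unit: UU.
have -> : expdiag s = expdiag (fun i => s i / 2) *m 1%:M *m (expdiag (fun i => s i / 2))^T.
  rewrite tr_diag_mx mulmx1 mulmx_diag; congr diag_mx; apply/rowP => i.
  by rewrite !mxE -expRD; congr expR; field.
apply: posdef_congr; last exact: posdef1.
by rewrite unitmxE det_expdiag unitfE gt_eqF // expR_gt0.
Qed.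

Lemma det_orth a (U D : 'M[R]_a) : U^T *m U = 1%:M -> \det (U *m D *m U^T) = \det D.
Proof.
move=> UU; have H : \det U * \det U = 1.
  by rewrite -{1}det_tr -det_mulmx UU det1.
by rewrite !det_mulmx det_tr mulrAC H mul1r.
Qed.

Lemma posdef_det a (T : 'M[R]_a) : posdefmx T -> 0 < \det T.
Proof.
by move=> /posdef_spectral[U [s [UU ->]]]; rewrite det_orth // det_expdiag expR_gt0.
Qed.

Lemma posdef_sqrt a (T : 'M[R]_a) : posdefmx T -> exists2 G, G \in unitmx & T = G *m G^T.
Proof.
move=> /posdef_spectral[U [s [UU ->]]].
exists (U *m expdiag (fun i => s i / 2)).
  rewrite unitmx_mul; apply/andP; split; first by case/mulmx1_unit: UU.
  by rewrite unitmxE det_expdiag unitfE gt_eqF // expR_gt0.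
rewrite trmx_mul tr_diag_mx [RHS]mulmxA -[X in _ = X *m _]mulmxA; congr (_ *m _ *m _).
rewrite mulmx_diag; congr diag_mx; apply/rowP => i.
by rewrite !mxE -expRD; congr expR; field.
Qed.

(** The determinant of a rank-one perturbation of the identity, from the two
    block triangular factorizations of the same matrix. *)
Lemma det_rank_one a (u : 'cV[R]_a) (x : R) :
  \det (1%:M + x *: (u *m u^T)) = 1 + x * (u^T *m u) 0 0.
Proof.
pose M : 'M[R]_(1 + a) := block_mx 1%:M (- (x *: u^T)) u 1%:M.
have E1 : M = block_mx 1%:M 0 u 1%:M *m block_mx 1%:M (- (x *: u^T)) 0 (1%:M + x *: (u *m u^T)).
  rewrite mulmx_block !(mulmx0, mul0mx, mulmx1, mul1mx, addr0, add0r).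
  by rewrite mulmxN -scalemxAr addrCA addNr addr0.
have E2 : M = block_mx (1%:M + x *: (u^T *m u)) (- (x *: u^T)) 0 1%:M *m block_mx 1%:M 0 u 1%:M.
  rewrite mulmx_block !(mulmx0, mul0mx, mulmx1, mul1mx, addr0, add0r).
  by rewrite mulNmx -scalemxAl addrK.
have := congr1 determinant E1; rewrite {1}E2 !det_mulmx det_lblock !det_ublock.
rewrite !det1 !mulr1 !mul1r => <-.
by rewrite det_mx11 !mxE eqxx.
Qed.

End PositiveDefinite.

(** * The objective and changes of basis *)

Section Objective.
Variables (R : realType) (k : nat) (n p : nat).

Section FixedDimensions.
Variables (d : nat) (e : 'I_k -> nat).
Local Notation cols := (cols e).
Implicit Types B C : forall i, 'M[R]_(d, e i).
Implicit Types T : 'M[R]_d.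
Implicit Types Ts : forall i, 'M[R]_(e i).

Definition posdefs T Ts : Prop := posdefmx T /\ forall i, posdefmx (Ts i).

(** The coefficients n and p are independent of the sizes d and e of the
    matrices, so that direct summands have the same kind of objective. *)
Definition obj B T Ts : R :=
  n%:R * ln (\det T) + p%:R * (\sum_i ln (\det (Ts i)))
  - \sum_i \tr (T *m B i *m Ts i *m (B i)^T).

Definition maximizer B T Ts : Prop :=
  posdefs T Ts /\ forall T' Ts', posdefs T' Ts' -> obj B T' Ts' <= obj B T Ts.

(** The critical-point equations of the objective at the identity. *)
Definition balanced C : Prop :=
  \sum_i C i *m (C i)^T = n%:R%:M /\ forall i, (C i)^T *m C i = p%:R%:M.

Definition diagT (U : 'M[R]_d) (s : 'I_d -> R) : 'M[R]_d := U *m expdiag s *m U^T.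
Definition diagTs (V : forall i, 'M[R]_(e i)) (t : cols -> R) : forall i, 'M[R]_(e i) :=
  fun i => V i *m expdiag (fun b => t (slot b)) *m (V i)^T.

Lemma sum_cols (F : cols -> R) : \sum_j F j = \sum_i \sum_b F (@slot _ e i b).
Proof.
by rewrite (@sig_big_dep _ _ _ _ (fun i : 'I_k => 'I_(e i) : finType) xpredT
  (fun i b => true) (fun i b => F (slot b))) /=; apply: eq_bigr => -[i b].
Qed.

Lemma posdefs_diag U V s t : frame U V -> posdefs (diagT U s) (diagTs V t).
Proof. by move=> [UU VV]; split=> [|i]; exact: posdef_expdiag. Qed.

Lemma posdefs_spectral T Ts : posdefs T Ts ->
  exists U V s t, [/\ frame U V, T = diagT U s & Ts = diagTs V t].
Proof.
move=> [/posdef_spectral[U [s [UU ->]]] /(_ _)/posdef_spectral pTs].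
pose VS i := cid (pTs i).
pose t (j : cols) : R := sval (cid (svalP (VS (tag j)))) (tagged j).
exists U, (fun i => sval (VS i)), s, t; split=> //.
  by split=> // i; case: (cid (svalP (VS i))) => ? [].
apply/functional_extensionality_dep => i; rewrite /diagTs.
have [_ {1}->] := svalP (cid (svalP (VS i))).
by [].
Qed.

Lemma obj_diag B U V s t : frame U V ->
  obj B (diagT U s) (diagTs V t) = diag_obj B n p U V s t.
Proof.
move=> [UU VV]; rewrite /obj /diag_obj det_orth // det_expdiag expRK.
congr (_ + _ * _ - _).
  rewrite sum_cols; apply: eq_bigr => i _.
  by rewrite det_orth // det_expdiag expRK.
under [RHS]eq_bigr => a _ do rewrite sum_cols.
rewrite [RHS]exchange_big; apply: eq_bigr => i _ /=.
set M := U^T *m B i *m V i.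
have -> : \tr (diagT U s *m B i *m diagTs V t i *m (B i)^T) =
    \tr (expdiag s *m M *m expdiag (fun b => t (slot b)) *m M^T).
  rewrite /diagT /diagTs mulmxA -!mulmxA mxtrace_mulC /M !trmx_mul trmxK.
  by rewrite !mulmxA.
have cE a b : coef B U V a (@slot _ e i b) = M a b ^+ 2 by [].
clearbody M; rewrite /mxtrace; apply: eq_bigr => a _.
rewrite mxE; apply: eq_bigr => b _; rewrite [M^T _ _]mxE.
rewrite mul_mx_diag mxE mul_diag_mx mxE !mxE cE expRD; ring.
Qed.

Lemma posdefs1 : posdefs 1%:M (fun i => 1%:M).
Proof. by split=> [|i]; exact: posdef1. Qed.

Lemma obj1 B : obj B 1%:M (fun i => 1%:M) = - \sum_i \tr (B i *m (B i)^T).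
Proof.
rewrite /obj det1 ln1 mulr0 add0r big1 => [|i _]; last by rewrite det1 ln1.
by rewrite mulr0 add0r; congr (- _); apply: eq_bigr => i _; rewrite mul1mx mulmx1.
Qed.

Definition conjT (g : 'M[R]_d) T := g^T *m T *m g.
Definition conjTs (h : forall i, 'M[R]_(e i)) Ts : forall i, 'M[R]_(e i) :=
  fun i => h i *m Ts i *m (h i)^T.
Definition act (g : 'M[R]_d) (h : forall i, 'M[R]_(e i)) B : forall i, 'M[R]_(d, e i) :=
  fun i => g *m B i *m h i.

Lemma posdefs_conj g h T Ts : g \in unitmx -> (forall i, h i \in unitmx) ->
  posdefs T Ts -> posdefs (conjT g T) (conjTs h Ts).
Proof.
move=> gu hu [pT pTs]; split=> [|i]; last exact: posdef_congr.
by rewrite /conjT -{2}(trmxK g); apply: posdef_congr => //; rewrite unitmx_tr.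
Qed.

(** A base change can be moved from B onto the positive definite matrices; the
    objective changes by a constant. *)
Lemma obj_act B g h T Ts : g \in unitmx -> (forall i, h i \in unitmx) ->
  posdefs T Ts ->
  obj B (conjT g T) (conjTs h Ts) = obj (act g h B) T Ts
    + (n%:R * ln (\det g ^+ 2) + p%:R * \sum_i ln (\det (h i) ^+ 2)).
Proof.
move=> gu hu [pT pTs]; rewrite /obj.
have ln_conj a (G A : 'M[R]_a) : G \in unitmx -> posdefmx A ->
    ln (\det G * \det A * \det G) = ln (\det A) + ln (\det G ^+ 2).
  move=> Gu pA; rewrite -lnM ?posrE ?posdef_det //; first by congr ln; ring.
  by rewrite lt_neqAle sqr_ge0 andbT eq_sym sqrf_eq0 -unitfE -unitmxE.
have -> : ln (\det (conjT g T)) = ln (\det T) + ln (\det g ^+ 2).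
  by rewrite !det_mulmx det_tr ln_conj.
have -> : \sum_i ln (\det (conjTs h Ts i)) =
    \sum_i ln (\det (Ts i)) + \sum_i ln (\det (h i) ^+ 2).
  by rewrite -big_split; apply: eq_bigr => i _; rewrite !det_mulmx det_tr ln_conj.
have -> : \sum_i \tr (conjT g T *m B i *m conjTs h Ts i *m (B i)^T) =
    \sum_i \tr (T *m act g h B i *m Ts i *m (act g h B i)^T).
  apply: eq_bigr => i _; rewrite /conjT /conjTs /act -!mulmxA mxtrace_mulC.
  by rewrite !trmx_mul !mulmxA.
ring.
Qed.

Lemma conj_surj g h T Ts : g \in unitmx -> (forall i, h i \in unitmx) ->
  posdefs T Ts -> exists T' Ts', [/\ posdefs T' Ts', T = conjT g T' & Ts = conjTs h Ts'].
Proof.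
move=> gu hu pTT; exists (conjT (invmx g) T), (conjTs (fun i => invmx (h i)) Ts).
split.
- by apply: posdefs_conj => // [|i]; rewrite unitmx_inv.
- rewrite /conjT !mulmxA -trmx_mul mulVmx // trmx1 mul1mx -mulmxA mulVmx //.
  by rewrite mulmx1.
apply/functional_extensionality_dep => i.
rewrite /conjTs !mulmxA mulmxV // mul1mx -mulmxA -trmx_mul mulmxV //.
by rewrite trmx1 mulmx1.
Qed.

Lemma maximizer_act B g h T Ts : g \in unitmx -> (forall i, h i \in unitmx) ->
  posdefs T Ts -> maximizer B (conjT g T) (conjTs h Ts) <-> maximizer (act g h B) T Ts.
Proof.
move=> gu hu pTT; split=> [[_ H]|[_ H]]; split=> //.
- move=> T' Ts' pT'; have := H _ _ (posdefs_conj gu hu pT').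
  by rewrite !obj_act // lerD2r.
- exact: posdefs_conj.
- move=> T0 Ts0 /(conj_surj gu hu)[T' [Ts' [pT' -> ->]]].
  by rewrite !obj_act // lerD2r; exact: H.
Qed.

(** Square roots of positive definite matrices serve as base changes, which
    reduces the study of maximizers to the identity. *)
Lemma maximizer_normal T Ts : posdefs T Ts -> exists g h,
  [/\ g \in unitmx, forall i, h i \in unitmx, T = conjT g 1%:M & Ts = conjTs h (fun i => 1%:M)].
Proof.
move=> [/posdef_sqrt[G Gu ->] /(_ _)/posdef_sqrt pTs].
pose hS i := cid2 (pTs i).
exists G^T, (fun i => s2val (hS i)); split.
- by rewrite unitmx_tr.
- by move=> i; exact: s2valP (hS i).
- by rewrite /conjT trmxK mulmx1.
apply/functional_extensionality_dep => i; rewrite /conjTs mulmx1.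
exact: s2valP' (hS i).
Qed.

End FixedDimensions.
End Objective.

(** * Maximizers and balanced tuples *)

Section CriticalPoints.
Variables (R : realType) (k : nat) (n p : nat).
Hypothesis n_gt0 : (0 < n)%N.
Hypothesis p_gt0 : (0 < p)%N.

(** Both sides vanish at 0, where the line touches the curve from below, so the
    slopes m and A agree. *)
Lemma tangent_slope (m A : R) : 0 < m ->
  (forall y, m * y <= (expR y - 1) * A) -> A = m.
Proof.
move=> m0 H.
have up (y : R) : 0 < y < 1 -> expR y - 1 <= y / (1 - y).
  move=> /andP[y0 y1]; have := expR_ge1Dx (- y); rewrite expRN => le.
  rewrite lerBlDr -[leLHS]invrK.
  have -> : y / (1 - y) + 1 = (1 - y)^-1 by field; rewrite subr_eq0 gt_eqF.
  by rewrite lef_pV2 ?posrE ?invr_gt0 ?expR_gt0 // subr_gt0.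
have A0 : 0 <= A.
  have H1 := H 1; rewrite leNgt; apply/negP => An.
  have e1 := expR_gt1Dx (oner_neq0 R).
  by have : (expR 1 - 1) * A <= 0; [nra | lra].
apply/eqP; rewrite eq_le; apply/andP; split; rewrite leNgt; apply/negP => lt.
  (* At - z the inequality gives A <= m (1 + z) = (A + m) / 2. *)
  pose z := (A - m) / (2 * m); have z0 : 0 < z by rewrite divr_gt0 ?subr_gt0 ?mulr_gt0.
  have Hz := H (- z); have e1 := expR_ge1Dx z; have e0 := expR_gt0 z.
  have le : z / (1 + z) <= 1 - expR (- z).
    rewrite expRN lerBrDr -lerBrDl.
    have -> : 1 - z / (1 + z) = (1 + z)^-1 by field; rewrite gt_eqF //; lra.
    by rewrite lef_pV2 ?posrE //; lra.
  have : z / (1 + z) * A <= m * z.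
    by apply: le_trans (_ : (1 - expR (- z)) * A <= _); [rewrite ler_wpM2r | lra].
  rewrite mulrAC ler_pdivrMr; last by lra.
  have -> : m * z * (1 + z) = z * (m * (1 + z)) by ring.
  rewrite ler_pM2l // => le2.
  have : m * (2 * z) = A - m by rewrite /z; field; rewrite gt_eqF.
  by lra.
(* At y the inequality gives m (1 - y) <= A, where m (1 - y) = (A + m) / 2. *)
pose y := (m - A) / (2 * m).
have y0 : 0 < y by rewrite divr_gt0 ?subr_gt0 ?mulr_gt0.
have y1 : y < 1 by rewrite /y ltr_pdivrMr; lra.
have Hy := H y; have := up y; rewrite y0 y1 => /(_ isT) le.
have : m * y <= y / (1 - y) * A.
  by apply: le_trans Hy _; rewrite ler_wpM2r.
rewrite mulrAC ler_pdivlMr; last by lra.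
have -> : m * y * (1 - y) = y * (m * (1 - y)) by ring.
rewrite ler_pM2l // => le2.
have : m * (2 * y) = m - A by rewrite /y; field; rewrite gt_eqF.
by lra.
Qed.

(** A symmetric matrix is determined by its quadratic form. *)
Lemma quadratic_scalar a (S : 'M[R]_a) (c : R) : S^T = S ->
  (forall u : 'cV[R]_a, u != 0 -> (u^T *m S *m u) 0 0 = c * (u^T *m u) 0 0) -> S = c%:M.
Proof.
move=> symS HS; pose D := S - c%:M.
have qf (u : 'cV[R]_a) : (u^T *m D *m u) 0 0 = 0.
  have [->|u0] := eqVneq u 0; first by rewrite mulmx0 mxE.
  rewrite /D mulmxBr mulmxBl mxE HS // mul_mx_scalar -scalemxAl.
  by rewrite [(- _ : matrix _ _ _) 0 0]mxE [(_ *: _ : matrix _ _ _) 0 0]mxE subrr.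
have qe (i j : 'I_a) : ((delta_mx i 0 : 'cV_a)^T *m D *m (delta_mx j 0 : 'cV_a)) 0 0 = D i j.
  by rewrite trmx_delta -rowE -colE !mxE.
have symD i j : D i j = D j i.
  by rewrite /D !mxE eq_sym; congr (_ - _); rewrite -[in LHS]symS mxE.
apply/eqP; rewrite -subr_eq0 -/D; clearbody D; apply/eqP/matrixP => i j; rewrite [RHS]mxE.
have := qf (delta_mx i 0 + delta_mx j 0).
rewrite [(_ + _)^T]linearD /= 2!mulmxDl !mulmxDr.
rewrite ![(_ + _ : matrix _ _ _) 0 0]mxE !qe.
have Dii l : D l l = 0 by rewrite -qe qf.
by rewrite !Dii (symD j i) add0r addr0 -mulr2n => /eqP; rewrite mulrn_eq0 /= => /eqP.
Qed.

Variables (d : nat) (e : 'I_k -> nat).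
Implicit Types C : forall i, 'M[R]_(d, e i).

Lemma trace_rank_one a b (M : 'M[R]_(a, b)) (u : 'cV[R]_a) :
  \tr ((u *m u^T) *m M *m M^T) = (u^T *m (M *m M^T) *m u) 0 0.
Proof.
by rewrite -!mulmxA mxtrace_mulC -trace_mx11 !mulmxA.
Qed.

(** The eigenvalue on the line of u is exp y, and 1 on its complement. *)
Lemma posdef_rank_one a (u : 'cV[R]_a) (y : R) : u != 0 ->
  posdefmx (1%:M + ((expR y - 1) / (u^T *m u) 0 0) *: (u *m u^T)).
Proof.
move=> u0; have N0 := norm_sq_gt0 u0; set N := (u^T *m u) 0 0 in N0 *.
set x := (expR y - 1) / N.
split=> [|v v0]; first by rewrite [LHS]linearD linearZ /= trmx1 trmx_mul trmxK.
rewrite mulmxDr mulmxDl mulmx1 -scalemxAr -scalemxAl.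
have -> : v^T *m (u *m u^T) *m v = (v^T *m u) *m (u^T *m v) by rewrite !mulmxA.
rewrite mxE [(_ *: _ : matrix _ _ _) 0 0]mxE.
have sc : (v^T *m u) *m (u^T *m v) = ((u^T *m v) 0 0 ^+ 2)%:M.
  have -> : v^T *m u = (u^T *m v)^T by rewrite trmx_mul trmxK.
  by rewrite {1 2}[u^T *m v]mx11_scalar tr_scalar_mx mul_scalar_mx scale_scalar_mx expr2.
rewrite sc [_%:M 0 0]mxE eqxx mulr1n.
set r := (u^T *m v) 0 0.
have v1 := norm_sq_gt0 v0; set W := (v^T *m v) 0 0 in v1 *.
have CS : r ^+ 2 <= N * W.
  have := norm_sq_ge0 (N *: v - r *: u).
  have E : ((N *: v - r *: u)^T *m (N *: v - r *: u)) 0 0 = N * (N * W - r ^+ 2).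
    have -> : (N *: v - r *: u)^T = N *: v^T - r *: u^T.
      by rewrite linearB !linearZ.
    rewrite mulmxBl !mulmxBr -!scalemxAl -!scalemxAr.
    have -> : v^T *m u = (u^T *m v)^T by rewrite trmx_mul trmxK.
    rewrite !mxE -/N -/W.
    have e1 : \sum_j u^T 0 j * u j 0 = N by rewrite /N mxE.
    have e2 : \sum_j v^T 0 j * v j 0 = W by rewrite /W mxE.
    have e3 : \sum_j u^T 0 j * v j 0 = r by rewrite /r mxE.
    rewrite e1 e2 e3; ring.
  by rewrite E pmulr_rge0 // subr_ge0.
have x1 : - N^-1 < x.
  have -> : - N^-1 = - 1 / N by rewrite mulN1r.
  by rewrite /x ltr_pM2r ?invr_gt0 // ltrBrDr addNr expR_gt0.
have r0 : 0 <= r ^+ 2 by exact: sqr_ge0.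
have : - N^-1 * r ^+ 2 <= x * r ^+ 2 by rewrite ler_wpM2r // ltW.
have le : N^-1 * r ^+ 2 <= W by rewrite mulrC ler_pdivrMr // mulrC.
move: r0 le; rewrite le_eqVlt => /orP[/eqP <-|r0] le.
  by rewrite !mulr0 addr0.
have : - N^-1 * r ^+ 2 < x * r ^+ 2 by rewrite ltr_pM2r.
by rewrite mulNr; lra.
Qed.

(** Scaling the identity by exp y along a vector u gives a function of y that is
    maximal at 0; tangent_slope turns this into the value at u of the quadratic
    form in question. *)
Lemma maximizer_balanced C : maximizer n p C 1%:M (fun i => 1%:M) -> balanced n p C.
Proof.
move=> [_ Hmax]; split.
  apply: quadratic_scalar.
    by rewrite raddf_sum; apply: eq_bigr => i _ /=; rewrite trmx_mul trmxK.
  move=> u u0; have N0 := norm_sq_gt0 u0; set N := (u^T *m u) 0 0 in N0 *.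
  set S := \sum_i _.
  apply: (mulIf (x := N^-1)); first by rewrite invr_eq0 gt_eqF.
  rewrite mulfK ?gt_eqF //; apply: tangent_slope; first by rewrite ltr0n.
  move=> y; set x := (expR y - 1) / N.
  have pT := posdef_rank_one y u0.
  have := Hmax _ (fun i => 1%:M) (conj pT (fun i => @posdef1 _ _)).
  rewrite obj1 /obj -/N -/x det_rank_one -/N divfK ?gt_eqF // addrCA subrr addr0 expRK.
  rewrite big1 ?mulr0 ?addr0 => [|i _]; last by rewrite det1 ln1.
  have -> : \sum_i \tr ((1%:M + x *: (u *m u^T)) *m C i *m 1%:M *m (C i)^T) =
      \sum_i \tr (C i *m (C i)^T) + x * (u^T *m S *m u) 0 0.
    rewrite /S mulmx_sumr mulmx_suml summxE mulr_sumr -big_split; apply: eq_bigr => i _ /=.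
    rewrite mulmx1 !mulmxDl mul1mx mxtraceD -!scalemxAl mxtraceZ.
    by rewrite trace_rank_one.
  by rewrite mulrAC /x; lra.
move=> i0; apply: quadratic_scalar; first by rewrite trmx_mul trmxK.
move=> u u0; have N0 := norm_sq_gt0 u0; set N := (u^T *m u) 0 0 in N0 *.
apply: (mulIf (x := N^-1)); first by rewrite invr_eq0 gt_eqF.
rewrite mulfK ?gt_eqF //; apply: tangent_slope; first by rewrite ltr0n.
move=> y; set x := (expR y - 1) / N.
have pT := posdef_rank_one y u0.
pose Ts := dfwith (fun i => 1%:M : 'M[R]_(e i)) (1%:M + x *: (u *m u^T)).
have Ts0 : Ts i0 = 1%:M + x *: (u *m u^T) by rewrite /Ts dfwith_in.
have Ts1 i : i != i0 -> Ts i = 1%:M by move=> ii; rewrite /Ts dfwith_out // eq_sym.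
have pTs i : posdefmx (Ts i).
  by have [->|ii] := eqVneq i i0; [rewrite Ts0 | rewrite Ts1 //; exact: posdef1].
have := Hmax 1%:M Ts (conj (@posdef1 _ _) pTs).
rewrite obj1 /obj det1 ln1 mulr0 add0r (bigD1 i0) //= Ts0.
rewrite det_rank_one -/N divfK ?gt_eqF // addrCA subrr addr0 expRK.
rewrite [X in y + X]big1 ?addr0 => [|i ii]; last by rewrite Ts1 // det1 ln1.
have -> : \sum_i \tr (1%:M *m C i *m Ts i *m (C i)^T) =
    \sum_i \tr (C i *m (C i)^T) + x * (u^T *m ((C i0)^T *m C i0) *m u) 0 0.
  rewrite (bigD1 i0) //= [X in _ = X + _](bigD1 i0) //= -addrA [X in _ = _ + X]addrC addrA.
  congr (_ + _); last first.
    by apply: eq_bigr => i ii; rewrite Ts1 // mul1mx mulmx1.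
  rewrite Ts0 mul1mx mulmxDr mulmxDl mulmx1 mxtraceD; congr (_ + _).
  rewrite -scalemxAr -scalemxAl mxtraceZ; congr (_ * _).
  transitivity (\tr ((C i0 *m u) *m (u^T *m (C i0)^T))); first by rewrite !mulmxA.
  by rewrite mxtrace_mulC -trace_mx11 !mulmxA.
by rewrite mulrAC /x; lra.
Qed.

End CriticalPoints.

Section AdaptedFrames.
Variables (R : realType) (k : nat) (n p : nat).
Variables (d : nat) (e : 'I_k -> nat).
Local Notation cols := (cols e).
Implicit Types B C : forall i, 'M[R]_(d, e i).

(** The eigenvectors of X X^T with nonzero eigenvalue span the image of X. *)
Lemma adapted_basis a b (X : 'M[R]_(a, b)) L : L *m X = 1%:M ->
  exists (U : 'M[R]_a) (N : {set 'I_a}), [/\ U^T *m U = 1%:M, #|N| = b,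
    forall i c, i \notin N -> (U^T *m X) i c = 0
    & forall i, i \in N -> exists z, col i U = X *m z].
Proof.
move=> LX; have [|U [v [UU AE]]] := @sym_spectral R a (X *m X^T).
  by rewrite trmx_mul trmxK.
pose N : {set 'I_a} := finset (fun i => v 0 i != 0).
have UUt : U *m U^T = 1%:M by exact: mulmx1C.
have D : (U^T *m X) *m (U^T *m X)^T = diag_mx v.
  rewrite trmx_mul trmxK -!mulmxA (mulmxA X) AE !mulmxA UU mul1mx.
  by rewrite -mulmxA UU mulmx1.
have zero i c : i \notin N -> (U^T *m X) i c = 0.
  rewrite inE negbK => /eqP vi; apply/eqP; rewrite -sqrf_eq0; apply/eqP.
  have /matrixP/(_ i i) := D; rewrite mxE [RHS]mxE eqxx vi mulr1n => H.
  have H1 (l : 'I_b) : true -> 0 <= (U^T *m X) i l * (U^T *m X)^T l i.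
    by rewrite [X in _ * X]mxE -expr2 sqr_ge0.
  by have := psumr_eq0P H1 H (isT : xpredT c); rewrite [X in _ * X]mxE -expr2.
have span i : i \in N -> exists z, col i U = X *m z.
  rewrite inE => vi; exists ((v 0 i)^-1 *: (X^T *m col i U)).
  rewrite -scalemxAr; have -> : X *m (X^T *m col i U) = v 0 i *: col i U.
    rewrite mulmxA colE mulmxA AE -(mulmxA _ U^T) UU mulmx1 -colE.
    by apply/matrixP => r s; rewrite -colE mxE mul_mx_diag !mxE mulrC.
  by rewrite scalerA mulVf // scale1r.
exists U, N; split=> //; apply/eqP; rewrite eqn_leq; apply/andP; split.
  have [z zE] := boolp.choice (fun l : 'I_#|N| => span _ (enum_valP l)).
  pose UN : 'M[R]_(a, #|N|) := colsub (@enum_val _ (mem N)) U.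
  have UNE : UN = X *m (\matrix_(r, l) z l r 0).
    apply/matrixP => r l; rewrite [LHS]mxE.
    have /matrixP/(_ r 0) := zE l; rewrite [X in X = _]mxE => ->.
    by rewrite !mxE; apply: eq_bigr => t _; rewrite !mxE.
  have orth : UN^T *m UN = 1%:M.
    rewrite trmx_mxsub mul_rowsub_mx mulmx_colsub UU.
    by apply/matrixP => x y; rewrite !mxE (inj_eq enum_val_inj).
  rewrite -(mxrank1 R #|N|) -orth (leq_trans (mxrankM_maxr _ _)) // UNE.
  by rewrite (leq_trans (mxrankM_maxl _ _)) // rank_leq_col.
have XE : X = colsub (@enum_val _ (mem N)) U *m rowsub (@enum_val _ (mem N)) (U^T *m X).
  rewrite -[LHS]mul1mx -UUt -mulmxA; apply/matrixP => r c.
  rewrite mxE [RHS]mxE (bigID (mem N)) /= [X in _ + X]big1 ?addr0.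
    by rewrite big_enum_val; apply: eq_bigr => t _; rewrite [in RHS]mxE [X in _ = _ * X]mxE.
  by move=> i iN; rewrite (zero i c iN) mulr0.
rewrite -{1}(mxrank1 R b) -LX (leq_trans (mxrankM_maxr _ _)) // XE.
by rewrite (leq_trans (mxrankM_maxl _ _)) // rank_leq_col.
Qed.

(** Every subrepresentation is spanned by vectors of some frame; this is the
    converse of frame_sub. *)
Lemma sub_frame B b c : ssub B b c ->
  exists U V (N : {set 'I_d}) (S : {set cols}),
    [/\ frame U V, #|N| = b, forall i, #|fiber S i| = c i
      & forall a j, a \notin N -> j \in S -> coef B U V a j = 0].
Proof.
move=> [X [Y [Z [[L LX] LY BY]]]].
have [U [N [UU Nb UX _]]] := adapted_basis LX.
have VP i : exists VN : 'M[R]_(e i) * {set 'I_(e i)}, [/\ VN.1^T *m VN.1 = 1%:M, #|VN.2| = c i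
    & forall b, b \in VN.2 -> exists z, col b VN.1 = Y i *m z].
  have [L1 L1Y] := LY i; have [V [S [VV Sc _ VY]]] := adapted_basis L1Y.
  by exists (V, S).
pose VS i := sval (cid (VP i)).
have VSP i : [/\ (VS i).1^T *m (VS i).1 = 1%:M, #|(VS i).2| = c i
    & forall b, b \in (VS i).2 -> exists z, col b (VS i).1 = Y i *m z].
  by rewrite /VS; case: cid.
pose S : {set cols} := finset (fun j : cols => tagged j \in (VS (tag j)).2).
exists U, (fun i => (VS i).1), N, S; split=> //.
- by split=> // i; case: (VSP i).
- move=> i; have [_ Sc _] := VSP i; apply: etrans Sc; apply: eq_card => x.
  by rewrite !inE.
move=> a [i x] aN; rewrite inE /= => xS; have [_ _ /(_ x xS)[z zE]] := VSP i.
rewrite /coef /=; apply/eqP; rewrite sqrf_eq0; apply/eqP.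
have -> : (U^T *m B i *m (VS i).1) a x = (U^T *m X *m (Z i *m z)) a 0.
  transitivity (col x (U^T *m B i *m (VS i).1) a 0); first by rewrite [RHS]mxE.
  by rewrite colE -mulmxA -colE zE !mulmxA -(mulmxA _ (B i)) BY !mulmxA.
by rewrite mxE big1 // => l _; rewrite UX // mul0r.
Qed.

(** Along the family with s = - tau on the subrepresentation at the sink,
    t = tau on the subrepresentation at the sources, and 0 elsewhere, the
    exponential terms stay bounded while the linear terms grow like tau times
    the weight. *)
Lemma bounded_semistable B M :
  (forall T Ts, posdefs T Ts -> obj n p B T Ts <= M) ->
  forall b c, ssub B b c -> (p * \sum_i c i <= n * b)%N.
Proof.
move=> HM b c /sub_frame[U [V [N [S [fUV Nb Sc c0]]]]].
rewrite leqNgt; apply/negP => lt.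
pose K := \sum_a \sum_j coef B U V a j.
pose s tau (a : 'I_d) : R := if a \in N then - tau else 0.
pose t tau (j : cols) : R := if j \in S then tau else 0.
have K0 : 0 <= K by do 2!apply: sumr_ge0 => ? _; exact: coef_ge0.
have sS tau : \sum_a s tau a = - (tau * b%:R).
  by rewrite -big_mkcond sumr_const Nb mulNrn mulr_natr.
have tS tau : \sum_j t tau j = tau * (\sum_i c i)%:R.
  rewrite -big_mkcond sumr_const -card_fiber mulr_natr.
  by congr (_ *+ _); apply: eq_bigr => i _; exact: Sc.
have H tau : 0 <= tau -> tau * (p%:R * (\sum_i c i)%:R - n%:R * b%:R) <= M + K.
  move=> tau0; have := HM _ _ (posdefs_diag (s tau) (t tau) fUV).
  rewrite obj_diag // /diag_obj sS tS.
  have : \sum_a \sum_j coef B U V a j * expR (s tau a + t tau j) <= K.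
    apply: ler_sum => a _; apply: ler_sum => j _.
    have [aN|aN] := boolP (a \in N); last have [jS|jS] := boolP (j \in S).
    - rewrite /s /t aN -[leRHS]mulr1 ler_wpM2l ?coef_ge0 // -expR0 ler_expR.
      by case: ifP => _; lra.
    - by rewrite c0 ?mul0r.
    - by rewrite /s /t (negbTE aN) (negbTE jS) addr0 expR0 mulr1.
  by lra.
have gap : 1 <= p%:R * (\sum_i c i)%:R - n%:R * b%:R :> R.
  by rewrite -!natrM lerBrDr -[1]/(1%:R) -natrD ler_nat add1n.
have M0 := normr_ge0 M; have M1 := ler_norm M.
have : (`|M| + K + 1) * (p%:R * (\sum_i c i)%:R - n%:R * b%:R) <= M + K.
  by apply: H; lra.
have : `|M| + K + 1 <= (`|M| + K + 1) * (p%:R * (\sum_i c i)%:R - n%:R * b%:R).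
  by rewrite -[leLHS]mulr1 ler_wpM2l //; lra.
by lra.
Qed.

Section Balanced.
Variable C : forall i, 'M[R]_(d, e i).
Hypothesis balC : balanced n p C.

Lemma balanced_row U V a : frame U V -> \sum_j coef C U V a j = n%:R.
Proof.
move=> [UU VV]; rewrite sum_cols.
have -> : n%:R = (U^T *m (\sum_i C i *m (C i)^T) *m U) a a.
  by rewrite balC.1 mul_mx_scalar -scalemxAl UU !mxE eqxx mulr1.
rewrite mulmx_sumr mulmx_suml summxE; apply: eq_bigr => i _.
have VVt : V i *m (V i)^T = 1%:M by apply: mulmx1C.
have -> : U^T *m (C i *m (C i)^T) *m U = (U^T *m C i *m V i) *m (U^T *m C i *m V i)^T.
  by rewrite !trmx_mul trmxK !mulmxA -(mulmxA _ (V i)) VVt mulmx1.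
by rewrite mxE; apply: eq_bigr => x _; rewrite [X in _ = _ * X]mxE -expr2.
Qed.

Lemma balanced_col U V j : frame U V -> \sum_a coef C U V a j = p%:R.
Proof.
move=> [UU VV]; case: j => i x.
have UUt : U *m U^T = 1%:M by apply: mulmx1C.
have -> : p%:R = ((V i)^T *m ((C i)^T *m C i) *m V i) x x.
  by rewrite balC.2 mul_mx_scalar -scalemxAl VV !mxE eqxx mulr1.
have -> : (V i)^T *m ((C i)^T *m C i) *m V i = (U^T *m C i *m V i)^T *m (U^T *m C i *m V i).
  by rewrite !trmx_mul trmxK !mulmxA -(mulmxA _ U) UUt mulmx1.
by rewrite mxE; apply: eq_bigr => a _; rewrite [X in _ = X * _]mxE -expr2.
Qed.

Lemma diagT0 (U : 'M[R]_d) (V : forall i, 'M[R]_(e i)) : frame U V ->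
  diagT U (fun=> 0) = 1%:M /\ diagTs V (fun=> 0) = (fun i => 1%:M).
Proof.
have E a : expdiag (fun _ : 'I_a => 0) = 1%:M :> 'M[R]_a.
  by apply/matrixP => i j; rewrite expdiagE expR0 mxE.
move=> [UU VV]; rewrite /diagT E mulmx1; split; first exact: mulmx1C.
apply/functional_extensionality_dep => i; rewrite /diagTs E mulmx1.
exact: mulmx1C.
Qed.

(** The coefficients of a balanced tuple form a matrix with constant row and
    column sums, so the objective falls short of its value at the identity by
    the weighted sum of exp x - 1 - x. *)
Lemma balanced_diag U V s t : frame U V ->
  diag_obj C n p U V s t = obj n p C 1%:M (fun i => 1%:M)
    - \sum_a \sum_j coef C U V a j * (expR (s a + t j) - (1 + (s a + t j))).
Proof.
move=> fUV; have [T0 Ts0] := diagT0 fUV.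
have -> : obj n p C 1%:M (fun i => 1%:M) = - \sum_a \sum_j coef C U V a j.
  rewrite -{1}T0 -Ts0 obj_diag // /diag_obj.
  rewrite [\sum_(a < d) 0]big1 // [\sum_(j : cols) 0]big1 // !mulr0 add0r sub0r.
  by congr (- _); do 2!apply: eq_bigr => ? _; rewrite expR0 mulr1.
rewrite /diag_obj.
have -> : n%:R * \sum_a s a = \sum_a \sum_j coef C U V a j * s a.
  by rewrite mulr_sumr; apply: eq_bigr => a _; rewrite -(balanced_row a fUV) mulr_suml.
have -> : p%:R * \sum_j t j = \sum_a \sum_j coef C U V a j * t j.
  rewrite mulr_sumr exchange_big; apply: eq_bigr => j _ /=.
  by rewrite -(balanced_col j fUV) mulr_suml.
rewrite -[X in _ = X - _]sumrN -big_split -!sumrB; apply: eq_bigr => a _ /=.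
rewrite -[X in _ = X - _]sumrN -big_split -!sumrB; apply: eq_bigr => j _ /=.
ring.
Qed.

Let term_ge0 U V s t a j :
  0 <= coef C U V a j * (expR (s a + t j) - (1 + (s a + t j))).
Proof. by rewrite mulr_ge0 ?coef_ge0 // subr_ge0 expR_ge1Dx. Qed.

Lemma balanced_maximizer : maximizer n p C 1%:M (fun i => 1%:M).
Proof.
split; first exact: (posdefs1 _ _ _).
move=> _ _ /posdefs_spectral[U [V [s [t [fUV -> ->]]]]].
rewrite obj_diag // balanced_diag // gerBl.
by do 2!apply: sumr_ge0 => ? _; exact: term_ge0.
Qed.

(** The equality case: exp x = 1 + x only for x = 0. *)
Lemma balanced_maximizerP U V s t : frame U V ->
  maximizer n p C (diagT U s) (diagTs V t) <->
  forall a j, coef C U V a j != 0 -> s a + t j = 0.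
Proof.
move=> fUV; split=> [[_ H] a j cn0|H].
  have := H _ _ (posdefs1 _ _ _); rewrite obj_diag // balanced_diag // lerBrDr gerDl => le.
  have {le} /eqP : \sum_a \sum_j coef C U V a j * (expR (s a + t j) - (1 + (s a + t j))) = 0.
    apply/eqP; rewrite eq_le le; do 2!apply: sumr_ge0 => ? _; exact: term_ge0.
  move=> /eqP E.
  have r0 a' : true -> 0 <= \sum_j coef C U V a' j * (expR (s a' + t j) - (1 + (s a' + t j))).
    by move=> _; apply: sumr_ge0 => ? _; exact: term_ge0.
  have Ea := psumr_eq0P r0 E (isT : xpredT a).
  have := psumr_eq0P (fun j _ => term_ge0 U V s t a j) Ea (isT : xpredT j).
  move=> /eqP; rewrite mulf_eq0 (negbTE cn0) /= subr_eq0 => /eqP E2.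
  apply/eqP; apply: contraT => /expR_gt1Dx; by rewrite E2 ltxx.
split; first exact: posdefs_diag.
move=> T' Ts' pT'; have [_ /(_ _ _ pT')] := balanced_maximizer.
rewrite obj_diag // balanced_diag // big1 ?subr0 // => a _.
rewrite big1 // => j _; have [->|/H ->] := eqVneq (coef C U V a j) 0.
  by rewrite mul0r.
by rewrite expR0 addr0 subrr mulr0.
Qed.

(** A subrepresentation of nonnegative weight of a balanced tuple has an
    invariant orthogonal complement: the columns of S have total p #|S|, lie in
    the rows of N, and already exhaust the total n #|N| of these rows. *)
Lemma balanced_block U V (N : {set 'I_d}) (S : {set cols}) : frame U V ->
  (forall a j, a \notin N -> j \in S -> coef C U V a j = 0) ->
  (n * #|N| <= p * #|S|)%N ->
  forall a j, a \in N -> j \notin S -> coef C U V a j = 0.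
Proof.
move=> fUV c0 le.
have HS : \sum_(j in S) \sum_(a in N) coef C U V a j = (p * #|S|)%:R.
  rewrite natrM mulr_natr -sumr_const; apply: eq_bigr => j jS.
  rewrite -(balanced_col j fUV) [RHS](bigID (mem N)) /= [X in _ = _ + X]big1 ?addr0 //.
  by move=> a aN; exact: c0.
have HN : \sum_(a in N) \sum_j coef C U V a j = (n * #|N|)%:R.
  rewrite natrM mulr_natr -sumr_const; apply: eq_bigr => a _; exact: balanced_row.
have E : \sum_(a in N) \sum_(j | j \notin S) coef C U V a j <= 0.
  have -> : \sum_(a in N) \sum_(j | j \notin S) coef C U V a j =
      \sum_(a in N) \sum_j coef C U V a j - \sum_(j in S) \sum_(a in N) coef C U V a j.
    rewrite [X in _ = _ - X]exchange_big -sumrB; apply: eq_bigr => a _ /=.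
    by rewrite [X in _ = X - _](bigID (mem S)) /= [X in _ = X - _]addrC addrK.
  by rewrite HN HS subr_le0 ler_nat.
move=> a j aN jS.
have E0 : \sum_(a in N) \sum_(j | j \notin S) coef C U V a j = 0.
  by apply/eqP; rewrite eq_le E; do 2!apply: sumr_ge0 => ? _; exact: coef_ge0.
have r0 a' : a' \in N -> 0 <= \sum_(j | j \notin S) coef C U V a' j.
  by move=> _; apply: sumr_ge0 => ? _; exact: coef_ge0.
have Ea := psumr_eq0P r0 E0 aN.
exact: (psumr_eq0P (fun j _ => coef_ge0 C U V a j) Ea (jS : (fun j => j \notin S) j)).
Qed.

End Balanced.
End AdaptedFrames.

(** * Stability and uniqueness of maximizers *)

Section Uniqueness.
Variables (R : realType) (k : nat) (n p : nat).
Hypothesis n_gt0 : (0 < n)%N.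
Hypothesis p_gt0 : (0 < p)%N.
Variables (d : nat) (e : 'I_k -> nat).
Local Notation cols := (cols e).
Implicit Types B C : forall i, 'M[R]_(d, e i).

Lemma ssub_act_sub B g h b c : g \in unitmx -> (forall i, h i \in unitmx) ->
  ssub B b c -> ssub (act g h B) b c.
Proof.
move=> gu hu [X [Y [Z [[L LX] LY BY]]]].
exists ((g : 'M[R]_d) *m X), (fun i => (invmx (h i) : 'M[R]_(e i)) *m Y i), Z; split.
- by exists (L *m (invmx g : 'M[R]_d)); rewrite mulmxA -(mulmxA L) mulVmx // mulmx1.
- move=> i; have [L1 L1Y] := LY i; exists (L1 *m (h i : 'M[R]_(e i))).
  by rewrite mulmxA -(mulmxA L1) mulmxV // mulmx1.
- by move=> i; rewrite /act !mulmxA mulmxK // -!mulmxA BY.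
Qed.

Lemma act_inv B g h : g \in unitmx -> (forall i, h i \in unitmx) ->
  act (invmx g) (fun i => invmx (h i)) (act g h B) = B.
Proof.
move=> gu hu; apply/functional_extensionality_dep => i.
by rewrite /act !mulmxA mulVmx // mul1mx mulmxK.
Qed.

Lemma ssub_act B g h b c : g \in unitmx -> (forall i, h i \in unitmx) ->
  ssub (act g h B) b c <-> ssub B b c.
Proof.
move=> gu hu; split=> [H|]; last exact: ssub_act_sub.
rewrite -(act_inv B gu hu); apply: ssub_act_sub => // [|i]; by rewrite unitmx_inv.
Qed.

Lemma sstable_act B g h : g \in unitmx -> (forall i, h i \in unitmx) ->
  sstable n p (act g h B) <-> sstable n p B.
Proof. by move=> gu hu; split=> H b c /(ssub_act B b c gu hu); exact: H. Qed.

Lemma maximizer_act_balanced B T Ts : maximizer n p B T Ts -> exists g h,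
  [/\ g \in unitmx, forall i, h i \in unitmx, balanced n p (act g h B),
      T = conjT g 1%:M & Ts = conjTs h (fun i => 1%:M)].
Proof.
move=> mB; have [pTT _] := mB; have [g [h [gu hu TE TsE]]] := maximizer_normal pTT.
exists g, h; split=> //; apply: maximizer_balanced => //.
by apply/(maximizer_act n p B gu hu (posdefs1 _ _ _)); rewrite -TE -TsE.
Qed.

Lemma stable_balanced B : (n * d = p * \sum_i e i)%N -> sstable n p B ->
  exists g h, [/\ g \in unitmx, forall i, h i \in unitmx & balanced n p (act g h B)].
Proof.
move=> w0 sB; have [d0|d_gt0] := posnP d.
  have e0 i : e i = 0%N.
    have /eqP : (p * \sum_i e i)%N = 0%N by rewrite -w0 d0 muln0.
    rewrite muln_eq0 gtn_eqF //= sum_nat_eq0 => /forallP/(_ i)/implyP/(_ isT).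
    by move=> /eqP.
  exists 1%:M, (fun i => 1%:M); split=> [|i|]; rewrite ?unitmx1 //.
  split=> [|i]; apply/matrixP => r.
    by have := ltn_ord r; rewrite {2}d0.
  by have := ltn_ord r; rewrite {2}e0.
have [U [V [s [t [fUV H]]]]] := diag_obj_attained n_gt0 p_gt0 w0 sB d_gt0.
have mB : maximizer n p B (diagT U s) (diagTs V t).
  split; first exact: posdefs_diag.
  move=> _ _ /posdefs_spectral[U' [V' [s' [t' [fUV' -> ->]]]]].
  by rewrite !obj_diag //; exact: H.
by have [g [h [gu hu bal _ _]]] := maximizer_act_balanced mB; exists g, h.
Qed.

(** For a maximizer in diagonal form, the eigenvectors of T for one eigenvalue
    and those of the T_i for the inverse eigenvalue span a subrepresentation
    of weight zero, which stability forces to be everything. *)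
Lemma stable_maximizer_scalar C T Ts : (0 < d)%N ->
  balanced n p C -> sstable n p C -> maximizer n p C T Ts ->
  exists2 x : R, 0 < x & T = x%:M /\ forall i, Ts i = (x^-1)%:M.
Proof.
move=> d_gt0 balC sC mC; have [pTT _] := mC.
have [U [V [s [t [fUV TE TsE]]]]] := posdefs_spectral pTT.
rewrite TE TsE in mC *; move/(balanced_maximizerP balC _ _ fUV): mC => st0.
pose x := s (Ordinal d_gt0).
pose N : {set 'I_d} := finset (fun a => s a == x).
pose S : {set cols} := finset (fun j => t j == - x).
have c1 a j : a \notin N -> j \in S -> coef C U V a j = 0.
  rewrite !inE => aN /eqP jS; apply/eqP; apply: contraNT aN => /st0.
  by rewrite jS => /eqP; rewrite subr_eq0.
have c2 a j : a \in N -> j \notin S -> coef C U V a j = 0.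
  rewrite !inE => /eqP aN jS; apply/eqP; apply: contraNT jS => /st0.
  by rewrite aN addrC => /eqP; rewrite addr_eq0.
have wNS : (p * #|S| = n * #|N|)%N.
  apply/eqP; rewrite -(eqr_nat R) !natrM !mulr_natr -!sumr_const; apply/eqP.
  transitivity (\sum_(j in S) \sum_(a in N) coef C U V a j).
    apply: eq_bigr => j jS; rewrite -(balanced_col balC j fUV).
    rewrite (bigID (mem N)) /= [X in _ + X]big1 ?addr0 //.
    by move=> a aN; exact: c1.
  rewrite exchange_big; apply: eq_bigr => a aN; rewrite -(balanced_row balC a fUV).
  rewrite [RHS](bigID (mem S)) /= [X in _ = _ + X]big1 ?addr0 //.
  by move=> j jS; exact: c2.
have := sC _ _ (frame_sub fUV c1); rewrite card_fiber wNS ltnn => -[[N0 _]|[Nd Sc]|//].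
  have : Ordinal d_gt0 \in N by rewrite inE.
  by move/eqP: N0; rewrite cards_eq0 => /eqP ->; rewrite finset.in_set0.
have NT a : s a = x.
  have /eqP NT : N == finset.setTfor 'I_d by rewrite eqEcard finset.subsetT cardsT card_ord Nd /= leqnn.
  by have := finset.in_setT a; rewrite -NT inE => /eqP.
have ST i b : t (@slot _ e i b) = - x.
  have /eqP ST : fiber S i == finset.setTfor 'I_(e i) by rewrite eqEcard finset.subsetT cardsT card_ord Sc /= leqnn.
  by have := finset.in_setT b; rewrite -ST !inE => /eqP.
have ed a (W : 'M[R]_a) (f : 'I_a -> R) y : W^T *m W = 1%:M -> (forall i, f i = y) ->
    W *m expdiag f *m W^T = (expR y)%:M.
  move=> WW fy; have -> : expdiag f = (expR y)%:M.
    by apply/matrixP => i j; rewrite expdiagE fy mxE.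
  by rewrite mul_mx_scalar -scalemxAl mulmx1C // scalemx1.
exists (expR x); first exact: expR_gt0.
case: fUV => UU VV; split; first exact: ed.
by move=> i; rewrite -expRN; apply: ed.
Qed.

Lemma tensZ a b (A : 'M[R]_a) (D : 'M[R]_b) (x y : R) :
  (x *: A) *t (y *: D) = (x * y) *: (A *t D).
Proof.
apply/matrixP => i j; case: (mxtens_indexP i) => i0 i1; case: (mxtens_indexP j) => j0 j1.
by rewrite [RHS]mxE !tensmxE !mxE; ring.
Qed.

(** Relative to a maximizer moved to the identity, any other is (x, 1 / x), and
    the Kronecker products do not see x. *)
Lemma stable_unique B T Ts T' Ts' : (0 < d)%N -> sstable n p B ->
  maximizer n p B T Ts -> maximizer n p B T' Ts' -> forall i, T *t Ts i = T' *t Ts' i.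
Proof.
move=> d_gt0 sB m1 m2 i.
have [g [h [gu hu bal -> ->]]] := maximizer_act_balanced m1.
have [pT' _] := m2; have [T0 [Ts0 [pT0 TE TsE]]] := conj_surj gu hu pT'.
rewrite TE TsE in m2 *; move/(maximizer_act n p B gu hu pT0): m2 => m2.
have sC : sstable n p (act g h B) by apply/sstable_act.
have [x x0 [-> TsS]] := stable_maximizer_scalar d_gt0 bal sC m2.
rewrite /conjT /conjTs TsS !mulmx1 !mul_mx_scalar -!scalemxAl tensZ.
by rewrite mulfV ?gt_eqF // scale1r.
Qed.

Lemma tens_conj a b (g A : 'M[R]_a) (h D : 'M[R]_b) :
  (g^T *m A *m g) *t (h *m D *m h^T) = (g^T *t h) *m (A *t D) *m (g *t h^T).
Proof. by rewrite !tensmx_mul. Qed.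

(** If a balanced tuple has a nontrivial subrepresentation of nonnegative
    weight, then it splits orthogonally, and scaling T by exp 1 and the T_i by
    exp (- 1) on one summand only produces another maximizer. Equality of the
    Kronecker products would make s_a + t_j vanish everywhere, also for a and j
    in different summands. *)
Lemma unique_stable B T Ts : (0 < k)%N -> (0 < d)%N -> (forall i, (0 < e i)%N) ->
  maximizer n p B T Ts ->
  (forall T Ts T' Ts', maximizer n p B T Ts -> maximizer n p B T' Ts' ->
    forall i, T *t Ts i = T' *t Ts' i) ->
  sstable n p B.
Proof.
move=> k_gt0 d_gt0 e_gt0 m1 uniq.
have [g [h [gu hu bal TE TsE]]] := maximizer_act_balanced m1.
apply/(sstable_act B gu hu) => b c sub.
have [lt|le] := ltnP (p * \sum_i c i) (n * b); first by constructor 3.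
have [U [V [N [S [fUV Nb Sc c1]]]]] := sub_frame sub.
have SE : #|S| = (\sum_i c i)%N by rewrite -card_fiber; apply: eq_bigr => i _; exact: Sc.
have c2 := balanced_block bal fUV c1 (leq_trans (eq_leq (congr1 (muln n) Nb)) (leq_trans le (eq_leq (congr1 (muln p) (esym SE))))).
pose s (a : 'I_d) : R := (a \in N)%:R.
pose t (j : cols) : R := - (j \in S)%:R.
have m2 : maximizer n p (act g h B) (diagT U s) (diagTs V t).
  apply/(balanced_maximizerP bal _ _ fUV) => a j; rewrite /s /t.
  have [aN|aN] := boolP (a \in N); have [jS|jS] := boolP (j \in S) => cn0.
  - by rewrite subrr.
  - by rewrite (c2 a j aN jS) eqxx in cn0.
  - by rewrite (c1 a j aN jS) eqxx in cn0.
  - by rewrite subr0.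
have m2' : maximizer n p B (conjT g (diagT U s)) (conjTs h (diagTs V t)).
  by apply/(maximizer_act n p B gu hu (posdefs_diag s t fUV)).
have st a j : s a + t j = 0.
  case: j => i x; have := uniq _ _ _ _ m1 m2' i.
  rewrite TE TsE !tens_conj.
  have gh1 : (g^T *t h i) \in unitmx by rewrite tensmx_unit ?unitmx_tr // -lt0n ?e_gt0.
  have gh2 : (g *t (h i)^T) \in unitmx by rewrite tensmx_unit ?unitmx_tr // -lt0n ?e_gt0.
  move=> /(can_inj (mulmxK gh2))/(can_inj (mulKmx gh1)) E.
  case: fUV => UU VV.
  have E2 : (U^T *t (V i)^T) *m (1%:M *t 1%:M) *m (U *t V i) =
            (U^T *t (V i)^T) *m (diagT U s *t diagTs V t i) *m (U *t V i) by rewrite E.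
  move: E2; rewrite !tensmx_mul !mulmx1 UU VV /diagT /diagTs !mulmxA UU VV !mul1mx.
  rewrite -!mulmxA UU VV !mulmx1 => /matrixP/(_ (mxtens_index (a, x)) (mxtens_index (a, x))).
  rewrite !tensmxE !expdiagE !mxE !eqxx !mulr1n mulr1 -expRD => /esym/eqP.
  by rewrite -[X in _ == X]expR0 => /eqP/expR_inj.
have [N0|Npos] := posnP #|N|.
  constructor 1; split; first by rewrite -Nb.
  have S0 j : j \notin S.
    have := st (Ordinal d_gt0) j; rewrite /s /t.
    move/eqP: N0; rewrite cards_eq0 => /eqP ->; rewrite finset.in_set0 sub0r => /eqP.
    by rewrite oppr_eq0 pnatr_eq0 eqb0.
  move=> i; rewrite -Sc; apply: eq_card0 => x; rewrite inE.
  exact/negbTE.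
constructor 2; have /card_gt0P[a aN] := Npos.
have SA j : j \in S.
  have := st a j; rewrite /s /t aN => /eqP; rewrite subr_eq0 eq_sym.
  by case: (j \in S) => //; rewrite eq_sym oner_eq0.
split.
  rewrite -Nb -[RHS]card_ord; apply: eq_card => a'; rewrite [RHS]inE.
  have := st a' (@slot _ e (Ordinal k_gt0) (Ordinal (e_gt0 _))); rewrite /s /t SA.
  by case: (a' \in N) => // /eqP; rewrite sub0r oppr_eq0 oner_eq0.
by move=> i; rewrite -Sc -[RHS]card_ord; apply: eq_card => x; rewrite !inE SA.
Qed.

End Uniqueness.

(** * Direct sums of balanced tuples *)

Section BlockDiagonal.
Variable K : fieldType.

Definition blockdiag m (r c : 'I_m -> nat) (A : forall j, 'M[K]_(r j, c j)) :
    'M[K]_((\sum_j r j)%N, (\sum_j c j)%N) :=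
  \sum_j incl K r j *m A j *m (incl K c j)^T.

Lemma blockdiag_mul m (r c s : 'I_m -> nat) (A : forall j, 'M[K]_(r j, c j))
    (D : forall j, 'M[K]_(c j, s j)) :
  blockdiag A *m blockdiag D = blockdiag (fun j => A j *m D j).
Proof.
rewrite /blockdiag mulmx_suml; apply: eq_bigr => j _.
rewrite mulmx_sumr; apply: etrans (sum_single (j := j) _) _ => [l lj|].
  by rewrite !mulmxA -(mulmxA _ _^T) incl_orth ?mulmx0 ?mul0mx // eq_sym.
by rewrite !mulmxA -(mulmxA _ _^T) incl_id mulmx1.
Qed.

Lemma blockdiag_tr m (r c : 'I_m -> nat) (A : forall j, 'M[K]_(r j, c j)) :
  (blockdiag A)^T = blockdiag (fun j => (A j)^T).
Proof.
rewrite /blockdiag raddf_sum; apply: eq_bigr => j _ /=.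
by rewrite !trmx_mul trmxK mulmxA.
Qed.

Lemma blockdiag_scalar m (r : 'I_m -> nat) x :
  blockdiag (fun j => x%:M : 'M[K]_(r j)) = x%:M.
Proof.
rewrite /blockdiag -[RHS]mulmx1 mul_scalar_mx -sum_incl scaler_sumr.
by apply: eq_bigr => j _; rewrite mul_mx_scalar scalemxAl.
Qed.

Lemma blockdiag_sum m (I : finType) (r c : 'I_m -> nat) (A : I -> forall j, 'M[K]_(r j, c j)) :
  \sum_i blockdiag (A i) = blockdiag (fun j => \sum_i A i j).
Proof.
rewrite /blockdiag exchange_big; apply: eq_bigr => j _ /=.
by rewrite mulmx_sumr mulmx_suml.
Qed.

End BlockDiagonal.

(** * The Schofield weight *)

Section SchofieldWeight.
Variables (k p : nat) (q : 'I_k -> nat).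
Local Notation n := (\sum_i q i)%N.
Local Notation sigma := (schofield_weight (star_dim p q)).

Lemma schofield_pairing (b : dimvec (star_quiver k)) :
  weight_pairing sigma b = (p * \sum_i b (Some i))%N%:Z - (n * b None)%N%:Z.
Proof.
rewrite /weight_pairing (bigD1 None) //= addrC; congr (_ + _); last first.
  by rewrite PoszM mulNr.
rewrite (reindex_omap Some id) /=; last by case.
rewrite (eq_bigl xpredT) => [|i]; last by rewrite eqxx.
by rewrite -mulr_sumr PoszM -[X in _ = _ * X]natz natr_sum; congr (_ * _);
  apply: eq_bigr => i _; rewrite natz.
Qed.

Lemma schofield_le0 b :
  (weight_pairing sigma b <= 0) = (p * \sum_i b (Some i) <= n * b None)%N.
Proof. by rewrite schofield_pairing subr_le0 lez_nat. Qed.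

Lemma schofield_lt0 b :
  (weight_pairing sigma b < 0) = (p * \sum_i b (Some i) < n * b None)%N.
Proof. by rewrite schofield_pairing subr_lt0 ltz_nat. Qed.

Lemma schofield_eq0 b :
  (weight_pairing sigma b = 0) <-> (p * \sum_i b (Some i) = n * b None)%N.
Proof.
rewrite schofield_pairing; split=> [/eqP|->]; last by rewrite subrr.
by rewrite subr_eq0 => /eqP[].
Qed.

Lemma schofield_total : weight_pairing sigma (star_dim p q) = 0.
Proof. by apply/schofield_eq0; rewrite /= mulnC. Qed.

Definition dim_of (b : nat) (c : 'I_k -> nat) : dimvec (star_quiver k) :=
  fun v => if v is Some i then c i else b.

End SchofieldWeight.

Section StableSstable.
Variables (R : realType) (k p : nat) (q : 'I_k -> nat).
Local Notation n := (\sum_i q i)%N.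
Local Notation sigma := (schofield_weight (star_dim p q)).

Lemma stable_sstable (beta : dimvec (star_quiver k)) (V : rep R beta) :
  stable sigma V -> sstable n p (V : forall i, 'M[R]_(beta None, beta (Some i))).
Proof.
move=> /stableP[_ H] b c H1.
have [b0|b0] := pselect (dim_of b c = (fun=> 0%N)).
  constructor 1; split=> [|i]; first by rewrite -[LHS]/(dim_of b c None) b0.
  by rewrite -[LHS]/(dim_of b c (Some i)) b0.
have [b1|b1] := pselect (dim_of b c = beta).
  constructor 2; split=> [|i]; first by rewrite -[LHS]/(dim_of b c None) b1.
  by rewrite -[LHS]/(dim_of b c (Some i)) b1.
constructor 3; have := H (dim_of b c); rewrite schofield_lt0; apply => //.
exact/sub_at_ssub.
Qed.

Hypothesis n_gt0 : (0 < n)%N.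
Hypothesis p_gt0 : (0 < p)%N.

(** A change of basis given by matrices of formally different sizes, as arises
    from an isomorphism with a direct sum, is one by invertible matrices. *)
Lemma balanced_square d d' (e e' : 'I_k -> nat) (B : forall i, 'M[R]_(d, e i))
    (g : 'M[R]_(d', d)) g' (h : forall i, 'M[R]_(e i, e' i)) h' :
  g *m g' = 1%:M -> g' *m g = 1%:M ->
  (forall i, h i *m h' i = 1%:M) -> (forall i, h' i *m h i = 1%:M) ->
  balanced n p (fun i => g *m B i *m h i) ->
  exists g h, [/\ g \in unitmx, forall i, h i \in unitmx & balanced n p (act g h B)].
Proof.
have dim_eq a b (M : 'M[R]_(a, b)) N : M *m N = 1%:M -> N *m M = 1%:M -> a = b.
  move=> MN NM; apply/eqP; rewrite eqn_leq; apply/andP; split.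
    by rewrite -{1}(mxrank1 R a) -MN (leq_trans (mxrankM_maxl _ _)) // rank_leq_col.
  by rewrite -{1}(mxrank1 R b) -NM (leq_trans (mxrankM_maxr _ _)) // rank_leq_row // MN rank_leq_col.
move=> gg g'g hh h'h bal.
have ee : e = e' by apply/funext => i; exact: dim_eq (hh i) (h'h i).
have dd := dim_eq _ _ _ _ g'g gg.
subst d' e'; exists g, h; split=> // [|i]; first by case/mulmx1_unit: gg.
by case/mulmx1_unit: (hh i).
Qed.

(** A polystable real representation can be balanced: its stable summands
    can, and balanced tuples are closed under direct sums. *)
Lemma polystable_balanced (V : rep R (star_dim p q)) : polystable sigma V ->
  exists g h, [/\ g \in unitmx, forall i, h i \in unitmx
    & balanced n p (act g h (V : forall i, 'M[R]_(p, q i)))].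
Proof.
move=> [m [beta [S [stS [g [h [hg gh gV]]]]]]].
have bS j : exists gj hj, [/\ gj \in unitmx, forall i, hj i \in unitmx
    & balanced n p (act gj hj (S j : forall i, 'M[R]_(beta j None, beta j (Some i))))].
  apply: stable_balanced => //; last exact: stable_sstable.
  by apply/esym/schofield_eq0; case: (stS j).
pose gS j := sval (cid (bS j)); pose hS j := sval (cid (svalP (cid (bS j)))).
have bal j : [/\ gS j \in unitmx, forall i, hS j i \in unitmx
    & balanced n p (act (gS j) (hS j) (S j : forall i, 'M[R]_(beta j None, beta j (Some i))))].
  by rewrite /hS; case: (cid (svalP (cid (bS j)))).
pose G := blockdiag gS; pose G' := blockdiag (fun j => invmx (gS j) : 'M[R]_(beta j None)).
pose H i := blockdiag (fun j => hS j i); pose H' i := blockdiag (fun j => invmx (hS j i) : 'M[R]_(beta j (Some i))).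
have GG' : G *m G' = 1%:M.
  rewrite blockdiag_mul -[RHS]blockdiag_scalar; apply: eq_bigr => j _.
  by case: (bal j) => gu _ _; rewrite mulmxV.
have G'G : G' *m G = 1%:M.
  rewrite blockdiag_mul -[RHS]blockdiag_scalar; apply: eq_bigr => j _.
  by case: (bal j) => gu _ _; rewrite mulVmx.
have HH' i : H i *m H' i = 1%:M.
  rewrite blockdiag_mul -[RHS]blockdiag_scalar; apply: eq_bigr => j _.
  by case: (bal j) => _ hu _; rewrite mulmxV.
have H'H i : H' i *m H i = 1%:M.
  rewrite blockdiag_mul -[RHS]blockdiag_scalar; apply: eq_bigr => j _.
  by case: (bal j) => _ hu _; rewrite mulVmx.
have CE i : (G *m g None) *m V i *m (h (Some i) *m H i) =
    blockdiag (fun j => act (gS j) (hS j) (S j : forall i, 'M[R]_(beta j None, beta j (Some i))) i).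
  have gVi : g None *m V i = direct_sum S i *m g (Some i) := gV i.
  rewrite -(mulmxA G) gVi -!mulmxA (mulmxA (g (Some i))) (gh (Some i)) mul1mx.
  have -> : direct_sum S i = blockdiag (fun j => S j i) := direct_sumE S i.
  rewrite !blockdiag_mul; apply: eq_bigr => j _; congr (_ *m _ *m _).
  exact: mulmxA.
apply: (@balanced_square _ _ _ _ _ (G *m g None) (h None *m G')
  (fun i => h (Some i) *m H i) (fun i => H' i *m g (Some i))).
- by rewrite mulmxA -(mulmxA G) (gh None) mulmx1.
- by rewrite mulmxA -(mulmxA (h None)) G'G mulmx1 (hg None).
- by move=> i; rewrite mulmxA -(mulmxA (h (Some i))) HH' mulmx1 (hg (Some i)).
- by move=> i; rewrite mulmxA -(mulmxA (H' i)) (gh (Some i)) mulmx1 H'H.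
split=> [|i].
  pose A i j := act (gS j) (hS j) (S j : forall i, 'M[R]_(beta j None, beta j (Some i))) i.
  transitivity (\sum_(i < k) blockdiag (fun j => A i j *m (A i j)^T)).
    by apply: eq_bigr => i _; rewrite CE blockdiag_tr blockdiag_mul.
  rewrite blockdiag_sum -blockdiag_scalar; apply: eq_bigr => j _.
  by case: (bal j) => _ _ [-> _].
rewrite CE blockdiag_tr blockdiag_mul -blockdiag_scalar; apply: eq_bigr => j _.
by case: (bal j) => _ _ [_ ->].
Qed.

End StableSstable.

(** * Balanced tuples over the complex numbers *)

Section Hermitian.
Variable R : realType.
Local Notation K := R[i].
Local Notation toC := (real_complex R).

Definition adj a b (M : 'M[K]_(a, b)) : 'M[K]_(b, a) := map_mx (@conjc R) M^T.

Lemma adjM a b c (M : 'M[K]_(a, b)) (N : 'M[K]_(b, c)) : adj (M *m N) = adj N *m adj M.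
Proof. by rewrite /adj trmx_mul map_mxM. Qed.

Lemma adjK a b (M : 'M[K]_(a, b)) : adj (adj M) = M.
Proof. by apply/matrixP => i j; rewrite !mxE conjcK. Qed.

Lemma adjB a b (M N : 'M[K]_(a, b)) : adj (M - N) = adj M - adj N.
Proof. by apply/matrixP => i j; rewrite !mxE rmorphB. Qed.

Lemma adj1 a : adj 1%:M = 1%:M :> 'M[K]_a.
Proof. by rewrite /adj trmx1 map_mx1. Qed.

Lemma adj_real a b (M : 'M[R]_(a, b)) : adj (map_mx toC M) = map_mx toC M^T.
Proof. by apply/matrixP => i j; rewrite !mxE conjc_real. Qed.

Lemma trace_adj a b (M : 'M[K]_(a, b)) : \tr (M *m adj M) = \sum_i \sum_j M i j * conjc (M i j).
Proof. by apply: eq_bigr => i _; rewrite mxE; apply: eq_bigr => j _; rewrite !mxE. Qed.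

Lemma trace_adj_ge0 a b (M : 'M[K]_(a, b)) : 0 <= \tr (M *m adj M).
Proof. by rewrite trace_adj; do 2!apply: sumr_ge0 => ? _; exact: normc_sq_ge0. Qed.

Lemma trace_adj_eq0 a b (M : 'M[K]_(a, b)) : \tr (M *m adj M) = 0 -> M = 0.
Proof.
rewrite trace_adj => H; apply/matrixP => i j; rewrite [RHS]mxE.
have r0 i' : true -> 0 <= \sum_j M i' j * conjc (M i' j).
  by move=> _; apply: sumr_ge0 => ? _; exact: normc_sq_ge0.
have Hi := psumr_eq0P r0 H (isT : xpredT i).
have r1 j' : true -> 0 <= M i j' * conjc (M i j') by move=> _; exact: normc_sq_ge0.
have /eqP := psumr_eq0P r1 Hi (isT : xpredT j).
by rewrite mulf_eq0 conjc_eq0 orbb => /eqP.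
Qed.

(** With Y the conjugate transpose of X, the retraction is Q = (Y X)^-1 Y, for
    which X Q is the orthogonal projection onto the image of X. *)
Lemma orthogonal_retraction a b (X : 'M[K]_(a, b)) L : L *m X = 1%:M ->
  exists Q : 'M[K]_(b, a), Q *m X = 1%:M /\ adj (X *m Q) = X *m Q.
Proof.
move=> LX; pose G := adj X *m X.
have [G' G'G] : exists G', G' *m G = 1%:M.
  apply: mx_left_inverse => v Gv.
  have Xv : X *m v = 0.
    rewrite -[X *m v]adjK -[RHS]adjK; congr adj; rewrite /adj trmx0 map_mx0 -/(adj _).
    apply: trace_adj_eq0; rewrite adjK adjM -mulmxA (mulmxA (adj X)) -/G.
    by rewrite [G *m _]Gv mulmx0 mxtrace0.
  by rewrite -[v]mul1mx -LX -mulmxA Xv mulmx0.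
have GG' : G *m G' = 1%:M by exact: mulmx1C.
have adjG : adj G = G by rewrite /G adjM adjK.
have adjG' : adj G' = G'.
  have : adj G' *m G = 1%:M.
    by rewrite -{1}adjG -adjM GG' adj1.
  by move=> H; rewrite -[LHS]mulmx1 -GG' mulmxA H mul1mx.
exists (G' *m adj X); split; first by rewrite -mulmxA.
by rewrite !adjM adjK adjG' mulmxA.
Qed.

Variables (k n p d : nat) (e : 'I_k -> nat).
Variable C : forall i, 'M[R]_(d, e i).
Hypothesis balC : balanced n p C.
Local Notation W := (fun i => map_mx toC (C i)).

(** For the orthogonal projections PP and QQ onto a subrepresentation of
    dimensions b and c of a balanced tuple, the sum over i of the squared norms
    of PP W_i (1 - QQ_i) is n b - p (sum of the c_i). Hence weights are
    nonpositive, and in weight zero the projections form a morphism. *)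
Lemma balanced_retract b c X Y Z : @ssubmx _ _ _ _ W b c X Y Z ->
  (p * \sum_i c i <= n * b)%N /\
  ((p * \sum_i c i)%N = (n * b)%N -> exists P Q,
    [/\ P *m X = 1%:M, forall i, Q i *m Y i = 1%:M & forall i, P *m W i = Z i *m Q i]).
Proof.
move=> [[L LX] LY WY].
have [P [PX PH]] := orthogonal_retraction LX.
have QP i : exists Q : 'M[K]_(c i, e i), Q *m Y i = 1%:M /\ adj (Y i *m Q) = Y i *m Q.
  by have [L1 L1Y] := LY i; exact: orthogonal_retraction L1Y.
pose Q i := sval (cid (QP i)).
have QY i : Q i *m Y i = 1%:M by rewrite /Q; case: cid => ? [].
have QH i : adj (Y i *m Q i) = Y i *m Q i by rewrite /Q; case: cid => ? [].
have [PP PPE] : exists PP, PP = X *m P by eexists.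
have [QQ QQE] : exists QQ, forall i, QQ i = Y i *m Q i by exists (fun i => Y i *m Q i).
have PPH : adj PP = PP by rewrite PPE PH.
have QQH i : adj (QQ i) = QQ i by rewrite QQE QH.
have PPP : PP *m PP = PP by rewrite PPE mulmxA -(mulmxA X) PX mulmx1.
have QQQ i : QQ i *m QQ i = QQ i by rewrite QQE mulmxA -(mulmxA (Y i)) QY mulmx1.
have PWQ i : PP *m W i *m QQ i = W i *m QQ i.
  by rewrite QQE PPE !mulmxA -(mulmxA _ (W i)) WY !mulmxA -(mulmxA X) PX mulmx1.
pose D i := PP *m W i *m (1%:M - QQ i).
have Q1 i : (1%:M - QQ i) *m (1%:M - QQ i) = 1%:M - QQ i.
  by rewrite mulmxBl mul1mx mulmxBr mulmx1 QQQ subrr subr0.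
have DD i : \tr (D i *m adj (D i)) = \tr (W i *m adj (W i) *m PP) - (p * c i)%:R.
  have -> : D i *m adj (D i) = PP *m (W i *m adj (W i) *m PP) - W i *m QQ i *m adj (W i).
    have -> : adj (D i) = (1%:M - QQ i) *m (adj (W i) *m PP).
      by rewrite /D !adjM adjB adj1 QQH PPH.
    rewrite /D mulmxA -(mulmxA _ _ (1%:M - QQ i)) Q1.
    rewrite mulmxBr mulmx1 PWQ mulmxBl !mulmxA; congr (_ - _).
    have := congr1 (@adj _ _) (PWQ i); rewrite !adjM QQH PPH => E.
    by rewrite -!mulmxA E.
  rewrite mxtraceD raddfN /=; congr (_ - _).
    by rewrite mxtrace_mulC -!mulmxA PPP.
  rewrite -mulmxA mxtrace_mulC -mulmxA.
  have -> : adj (W i) *m W i = p%:R%:M.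
    by rewrite adj_real -map_mxM balC.2 map_scalar_mx /= rmorph_nat.
  by rewrite mul_mx_scalar mxtraceZ QQE mxtrace_mulC QY mxtrace1 natrM.
have total : \sum_i \tr (D i *m adj (D i)) = (n * b)%:R - (p * \sum_i c i)%:R.
  rewrite (eq_bigr _ (fun i _ => DD i)) sumrB -(big_morph _ (@mxtraceD _ _) (@mxtrace0 _ _)) -mulmx_suml.
  have -> : \sum_i W i *m adj (W i) = n%:R%:M.
    rewrite -(rmorph_nat toC n) -map_scalar_mx -balC.1 map_mx_sum.
    by apply: eq_bigr => i _; rewrite adj_real map_mxM.
  rewrite mul_scalar_mx mxtraceZ PPE mxtrace_mulC PX mxtrace1 -natrM.
  by rewrite -natr_sum big_distrr.
split.
  rewrite -(ler_nat K) -subr_ge0 -total.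
  by apply: sumr_ge0 => i _; exact: trace_adj_ge0.
move=> E; exists P, Q; split=> // i.
have Di : D i = 0.
  apply: trace_adj_eq0.
  have H : \sum_i \tr (D i *m adj (D i)) = 0 by rewrite total E subrr.
  have ge0 i' : true -> 0 <= \tr (D i' *m adj (D i')) by move=> _; exact: trace_adj_ge0.
  exact: psumr_eq0P ge0 H i isT.
have PWE : PP *m W i = W i *m QQ i.
  by move: Di; rewrite /D mulmxBr mulmx1 PWQ => /eqP; rewrite subr_eq0 => /eqP.
rewrite -[P]mul1mx -PX -(mulmxA P) -PPE -mulmxA PWE QQE !mulmxA -(mulmxA P) WY.
by rewrite mulmxA PX mul1mx.
Qed.

End Hermitian.

Section Complexification.
Variables (R : realType) (k p : nat) (q : 'I_k -> nat).
Local Notation n := (\sum_i q i)%N.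
Local Notation K := R[i].
Local Notation toC := (real_complex R).
Local Notation sigma := (schofield_weight (star_dim p q)).

(** Invertible base changes carry subrepresentations and retractions along. *)
Lemma balanced_complex_mxpolystable (B : ipca_data R p q) g h :
  g \in unitmx -> (forall i, h i \in unitmx) -> balanced n p (act g h B) ->
  mxpolystable sigma (map_fam toC B : rep K (star_dim p q)).
Proof.
move=> gu hu bal.
pose gC : 'M[K]_p := map_mx toC g; pose hC i : 'M[K]_(q i) := map_mx toC (h i).
have gCu : gC \in unitmx by rewrite map_unitmx.
have hCu i : hC i \in unitmx by rewrite map_unitmx.
have gV : (invmx gC : 'M[K]_p) *m gC = 1%:M by exact: mulVmx.
have hV i : hC i *m (invmx (hC i) : 'M[K]_(q i)) = 1%:M by exact: mulmxV.
have key b X Z : @mxsubrep _ _ _ (map_fam toC B : rep K (star_dim p q)) b X Z ->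
    @ssubmx _ _ _ _ (fun i => map_mx toC (act g h B i)) (b None) (fun i => b (Some i))
      (gC *m X None) (fun i => (invmx (hC i) : 'M[K]_(q i)) *m X (Some i)) Z.
  move=> [LX VX]; split.
  - have [L LX0] := LX None; exists (L *m (invmx gC : 'M[K]_p)).
    by rewrite mulmxA -(mulmxA L) gV mulmx1.
  - move=> i; have [L LXi] := LX (Some i); exists (L *m (hC i : 'M[K]_(q i))).
    by rewrite mulmxA -(mulmxA L) hV mulmx1.
  - move=> i; have VXi : map_mx toC (B i) *m X (Some i) = X None *m Z i := VX i.
    rewrite /act !map_mxM -/gC -/(hC i) !mulmxA mulmxK //.
    by rewrite -mulmxA VXi mulmxA.
split; first exact: schofield_total.
  move=> b [X [Z XZ]]; rewrite schofield_le0.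
  by have [] := balanced_retract bal (key _ _ _ XZ).
move=> b X Z XZ /schofield_eq0 wb.
have [_ /(_ wb)[P [Q [PX QY PW]]]] := balanced_retract bal (key _ _ _ XZ).
exists (fun v => match v return 'M[K]_(b v, star_dim p q v) with
  | None => P *m gC | Some i => Q i *m (invmx (hC i) : 'M[K]_(q i)) end).
split=> [[i|]|i] /=.
- by rewrite -mulmxA; exact: QY.
- by rewrite -mulmxA; exact: PX.
have := PW i; rewrite /act !map_mxM -/gC -/(hC i) => PWi.
rewrite mulmxA -PWi -/(map_fam toC B i) !mulmxA mulmxK //.
Qed.

Lemma map_mxsubrep (B : ipca_data R p q) b X Z :
  @mxsubrep _ _ _ (B : rep R (star_dim p q)) b X Z ->
  mxsubrep (map_fam toC B : rep K (star_dim p q)) (map_fam toC (X : mxfam R (star_dim p q) b))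
    (map_fam toC Z).
Proof.
move=> [LX VX]; split.
  by move=> v; have [L LXv] := LX v; exists (map_mx toC L); rewrite -map_mxM LXv map_mx1.
by move=> a; rewrite /map_fam -!map_mxM VX.
Qed.

Lemma sub_at_complex (B : ipca_data R p q) b :
  sub_at (B : rep R (star_dim p q)) b -> sub_at (map_fam toC B : rep K (star_dim p q)) b.
Proof. by move=> [X [Z /map_mxsubrep H]]; eexists; eexists; exact: H. Qed.

Lemma map_Re_mulr a b c (P : 'M[K]_(a, b)) (M : 'M[R]_(b, c)) :
  map_mx (@complex.Re R) (P *m map_mx toC M) = map_mx (@complex.Re R) P *m M.
Proof.
apply/matrixP => i j; rewrite !mxE raddf_sum; apply: eq_bigr => l _; rewrite !mxE.
by case: (P i l) => x y /=; rewrite mulr0 subr0.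
Qed.

Lemma map_Re_mull a b c (M : 'M[R]_(a, b)) (P : 'M[K]_(b, c)) :
  map_mx (@complex.Re R) (map_mx toC M *m P) = M *m map_mx (@complex.Re R) P.
Proof.
apply/matrixP => i j; rewrite !mxE raddf_sum; apply: eq_bigr => l _; rewrite !mxE.
by case: (P l j) => x y /=; rewrite mul0r subr0.
Qed.

(** The real part of a complex retraction is a real retraction. *)
Lemma complex_mxpolystable_real (B : ipca_data R p q) :
  mxpolystable sigma (map_fam toC B : rep K (star_dim p q)) ->
  mxpolystable sigma (B : rep R (star_dim p q)).
Proof.
move=> [w0 ss re]; split=> // [b /sub_at_complex|b X Z XZ wb]; first exact: ss.
have [P [PX PV]] := re _ _ _ (map_mxsubrep XZ) wb.
exists (fun v => map_mx (@complex.Re R) (P v)); split=> [v|a].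
  rewrite -map_Re_mulr [X in map_mx _ X](PX v).
  by apply/matrixP => i j; rewrite !mxE; case: (i == j).
by rewrite -map_Re_mulr -map_Re_mull; congr map_mx; exact: PV.
Qed.

Lemma complex_stable_real (B : ipca_data R p q) :
  stable sigma (map_fam toC B : rep K (star_dim p q)) ->
  stable sigma (B : rep R (star_dim p q)).
Proof.
move=> /stableP[w0 H]; apply/stableP; split=> // b /sub_at_complex; exact: H.
Qed.

End Complexification.

(** * The generic criteria *)

Section Assembly.
Variables (R : realType) (k p : nat) (q : 'I_k -> nat).
Local Notation n := (\sum_i q i)%N.
Local Notation K := R[i].
Local Notation toC := (real_complex R).
Local Notation sigma := (schofield_weight (star_dim p q)).

(** The complex open set is the nonvanishing locus of the real polynomial that
    defines the real one; a single polynomial serves all dimension vectors in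
    bad. *)
Lemma generic_complex_no_sub (P : set (ipca_data R p q)) (bad : set (dimvec (star_quiver k))) :
  generic P -> (forall B, P B -> forall b, bad b -> ~ sub_at (B : rep R (star_dim p q)) b) ->
  generic [set V : rep K (star_dim p q) | forall b, bad b -> ~ sub_at V b].
Proof.
move=> /genericP[F [polyF [B0 FB0] FP]] noP.
have [FL [polyFL FLE]] := polyfun_extend toC polyF.
apply/genericP; exists FL; split=> //.
  exists (map_fam toC B0); rewrite coords_map_fam FLE fmorph_eq0 //.
move=> V FLV b badb.
apply: (no_sub_extension polyFL FLE) FLV => B FB.
exact: noP (FP _ FB) b badb.
Qed.

Lemma semistable_bounded (B : ipca_data R p q) :
  semistable sigma (B : rep R (star_dim p q)) -> ipca_bounded_above B.
Proof.
move=> /semistableP[_ ss].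
have ss' b c : ssub B b c -> (p * \sum_i c i <= n * b)%N.
  move=> sbc; have := ss (dim_of b c); rewrite schofield_le0; apply.
  exact/sub_at_ssub.
have [L HL] := diag_obj_bounded (mulnC n p) ss'.
exists L => T Ts /posdefs_spectral[U [V [s [t [fr -> ->]]]]].
by rewrite -[ipca_fun _ _ _]/(obj n p B _ _) obj_diag //; exact: HL.
Qed.

Lemma balanced_exists (B : ipca_data R p q) g h :
  g \in unitmx -> (forall i, h i \in unitmx) -> balanced n p (act g h B) -> ipca_exists B.
Proof.
move=> gu hu /balanced_maximizer M.
exists (conjT g 1%:M), (conjTs h (fun=> 1%:M)).
by apply/maximizer_act => //; exact: M.1.
Qed.

Lemma bounded_generic_semistable :
  generic [set B : ipca_data R p q | ipca_bounded_above B] ->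
  schofield_semistable R (star_dim p q).
Proof.
move=> gen.
have := generic_complex_no_sub (bad := [set b | 0 < weight_pairing sigma b]) gen.
move=> H; apply: generic_sub (H _) => [V noV|B [M bd] b /= wb].
  apply/semistableP; split=> [|b sb]; first exact: schofield_total.
  by rewrite leNgt; apply/negP => /noV.
move/sub_at_ssub => sb; move: wb; rewrite ltNge schofield_le0 => /negP; apply.
exact: (bounded_semistable bd sb).
Qed.

Lemma semistable_generic_bounded :
  schofield_semistable R (star_dim p q) ->
  generic [set B : ipca_data R p q | ipca_bounded_above B].
Proof.
move=> gen; apply: generic_real_points gen _ => B /semistableP[w0 ss].
apply: semistable_bounded; apply/semistableP; split=> // b /sub_at_complex.
exact: ss.
Qed.

Hypothesis k_gt0 : (0 < k)%N.
Hypothesis p_gt0 : (0 < p)%N.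
Hypothesis q_gt0 : forall i, (0 < q i)%N.

Lemma total_gt0 : (0 < n)%N.
Proof.
by rewrite (bigD1 (Ordinal k_gt0)) //= addn_gt0 q_gt0.
Qed.

(** If polystability failed for generic complex tuples, it would fail for a real
    tuple that has a maximizer, against balanced_complex_mxpolystable. *)
Lemma exists_generic_polystable :
  generic [set B : ipca_data R p q | ipca_exists B] ->
  schofield_polystable R (star_dim p q).
Proof.
move=> gen; case: (mxpolystable_generic K sigma (star_dim p q)) => [|bad].
  by apply: generic_sub => V /polystableP.
have [B [T [Ts M]] []] := generic_common_extension toC gen bad.
have [g [h [gu hu bal _ _]]] := maximizer_act_balanced total_gt0 p_gt0 M.
exact: balanced_complex_mxpolystable gu hu bal.
Qed.

Lemma polystable_generic_exists :
  schofield_polystable R (star_dim p q) ->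
  generic [set B : ipca_data R p q | ipca_exists B].
Proof.
move=> gen; apply: generic_real_points gen _ => B /polystableP/complex_mxpolystable_real/polystableP.
move=> /(polystable_balanced total_gt0 p_gt0)[g [h [gu hu bal]]].
exact: balanced_exists gu hu bal.
Qed.

Lemma unique_generic_stable :
  generic [set B : ipca_data R p q | ipca_exists_uniquely B] ->
  schofield_stable R (star_dim p q).
Proof.
move=> gen.
have H := generic_complex_no_sub (bad := [set b | [/\ b <> (fun=> 0%N), b <> star_dim p q
  & 0 <= weight_pairing sigma b]]) gen.
apply: generic_sub (H _) => [V noV|B [[T [Ts M]] uni] b /= [b0 b1 wb]].
  apply/stableP; split=> [|b sb b0 b1]; first exact: schofield_total.
  by rewrite ltNge; apply/negP => wb; exact: (noV b).
have st := unique_stable total_gt0 p_gt0 k_gt0 p_gt0 q_gt0 M uni.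
move/sub_at_ssub => /st[[bN bS]|[bN bS]|].
- by apply: b0; apply/funext => -[i|]; [exact: bS|exact: bN].
- by apply: b1; apply/funext => -[i|]; [exact: bS|exact: bN].
- by rewrite -schofield_lt0 ltNge wb.
Qed.

Lemma stable_generic_unique :
  schofield_stable R (star_dim p q) ->
  generic [set B : ipca_data R p q | ipca_exists_uniquely B].
Proof.
move=> gen; apply: generic_real_points gen _ => B /complex_stable_real/stable_sstable st.
have [g [h [gu hu bal]]] := stable_balanced total_gt0 p_gt0 (mulnC n p) st.
split; first exact: balanced_exists gu hu bal.
by move=> T Ts T' Ts'; exact: (stable_unique total_gt0 p_gt0 p_gt0 st).
Qed.

End Assembly.

Theorem theorem4p3 (R : realType) (k p : nat) (q : 'I_k -> nat)
    (k_gt0 : (0 < k)%N) (p_gt0 : (0 < p)%N) (q_gt0 : forall i, (0 < q i)%N) :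
  [/\ generic [set B : ipca_data R p q | ipca_bounded_above B] <->
        schofield_semistable R (star_dim p q),
      generic [set B : ipca_data R p q | ipca_exists B] <->
        schofield_polystable R (star_dim p q)
    & generic [set B : ipca_data R p q | ipca_exists_uniquely B] <->
        schofield_stable R (star_dim p q)].
Proof.
split; split.
- exact: bounded_generic_semistable.
- exact: semistable_generic_bounded.
- exact: exists_generic_polystable.
- exact: polystable_generic_exists.
- exact: unique_generic_stable.
- exact: stable_generic_unique.
Qed.
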